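(* Let $N$ be a squarefree positive integer with $\gcd(N,6)=1$. Then $$c\phi_N(n)\sim\sum_{d\mid N}\frac{N}{d}\,P\!\left(\frac{N}{d^2}n-\frac{N^2-d^2}{24d^2}\right)\quad\text{as } n\to\infty.$$
   Context: Let $q=e^{2\pi i z}$, $(q;q)_\infty=\prod_{n\ge1}(1-q^n)$. For $m\ge1$ let $\theta_m(x)=\sum_{i=1}^m x_i^2+\sum_{1\le i<j\le m}x_ix_j$ and $f_{\theta_m}(z)=\sum_{x\in\mathbb{Z}^m}q^{\theta_m(x)}$ (with $f_{\theta_0}=1$). $c\phi_N(n)$ is Andrews' number of $N$-colored generalized Frobenius partitions of $n$, equivalently defined by $\sum_{n\ge0}c\phi_N(n)q^n=f_{\theta_{N-1}}(z)/(q;q)_\infty^N$. $P(n)$ is the partition function, with $P(x)=0$ when $x$ is not a nonnegative integer. $a_n\sim b_n$ means $a_n/b_n\to1$. *)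

(* Defs.v *)
From HB Require Import structures.
From mathcomp Require Import all_boot all_order all_algebra finmap.
From mathcomp Require Import all_classical all_reals all_analysis.
From mathcomp Require Import zify.
Set Implicit Arguments.
Unset Strict Implicit.
Unset Printing Implicit Defensive.
Import Order.TTheory GRing.Theory Num.Theory.
Import numFieldNormedType.Exports.
Local Open Scope classical_set_scope.
Local Open Scope ring_scope.

Definition squarefree (N : nat) : Prop :=
  forall d : nat, (d ^ 2 %| N)%N -> d = 1%N.

(* Formal power series in q over int, given by their coefficients. *)
Definition fps := nat -> int.

Definition fps_one : fps := fun n => (n == 0%N)%:R.

Definition fps_mul (a b : fps) : fps :=
  fun n => \sum_(k < n.+1) a k * b (n - k)%N.

Definition fps_exp (a : fps) (N : nat) : fps := iter N (fps_mul a) fps_one.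

(* The first n coefficients of 1/a, meaningful only if a 0 = 1: they solve
   b_m = [m = 0] - \sum_(k < m) a_(m-k) b_k. *)
Fixpoint fps_inv_seq (a : fps) (n : nat) : seq int :=
  if n is m.+1 then
    let s := fps_inv_seq a m in
    rcons s ((m == 0%N)%:R - \sum_(k < m) a (m - k)%N * s`_k)
  else [::].

Definition fps_inv (a : fps) : fps := fun n => (fps_inv_seq a n.+1)`_n.

Definition fps_div (a b : fps) : fps := fps_mul a (fps_inv b).

(* (q;q)_oo; the factors 1 - q^i with i > n do not affect the coefficient
   of q^n. *)
Definition qpochhammer : fps :=
  fun n => (\prod_(1 <= i < n.+1) (1 - 'X^i) : {poly int})`_n.

Definition theta (m : nat) (x : 'rV[int]_m) : int :=
  \sum_(i < m) x 0 i ^+ 2 + \sum_(i < m) \sum_(j < m | (i < j)%N) x 0 i * x 0 j.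

(* The coefficient of q^n in f_(theta_m) is the number of x in Z^m with
   theta x = n; these sets are finite by finite_theta_fiber, so fset_set never
   takes its default value. *)
Definition f_theta (m : nat) : fps :=
  fun n => #|` fset_set [set x : 'rV[int]_m | theta x = n%:Z]|%:Z.

(* c\phi_N(n) = [q^n] f_(theta_(N-1)) / (q;q)_oo^N, for N > 0. *)
Definition cphi (N : nat) : fps :=
  fps_div (f_theta N.-1) (fps_exp qpochhammer N).

(* A partition of n is encoded by the multiplicities f i of its parts i.+1. *)
Definition partition_number (n : nat) : nat :=
  #|[set f : {ffun 'I_n -> 'I_n.+1} | (\sum_(i < n) f i * i.+1)%N == n]%SET|.

Definition P (x : rat) : nat :=
  if x \is a Num.nat then partition_number (Num.truncn x) else 0%N.

Lemma size_fps_inv_seq a n : size (fps_inv_seq a n) = n.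
Proof. by elim: n => //= n IH; rewrite size_rcons IH. Qed.

Lemma nth_fps_inv_seq a n k : (k < n)%N -> (fps_inv_seq a n)`_k = fps_inv a k.
Proof.
rewrite /fps_inv; elim: n => // n IH; rewrite ltnS leq_eqVlt => /orP[/eqP->//|kn].
by rewrite -IH //= nth_rcons size_fps_inv_seq kn.
Qed.

Lemma fps_mul_inv a : a 0%N = 1 -> fps_mul a (fps_inv a) =1 fps_one.
Proof.
move=> a0 n; rewrite /fps_mul /fps_one (reindex_inj rev_ord_inj) /=.
rewrite big_ord_recr /= subSS subnn a0 mul1r subn0.
rewrite {2}/fps_inv /= nth_rcons size_fps_inv_seq ltnn eqxx.
rewrite (eq_bigr (fun k : 'I_n => a (n - k)%N * (fps_inv_seq a n)`_k)).
  by rewrite addrC subrK.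
move=> k _; rewrite nth_fps_inv_seq // subSS subKn //; exact: ltnW.
Qed.

Lemma theta_double m (x : 'rV[int]_m) :
  theta x *+ 2 = \sum_(i < m) x 0 i ^+ 2 + (\sum_(i < m) x 0 i) ^+ 2.
Proof.
have -> : (\sum_(i < m) x 0 i) ^+ 2 =
    \sum_(i < m) x 0 i ^+ 2 +
    (\sum_(i < m) \sum_(j < m | (i < j)%N) x 0 i * x 0 j) *+ 2.
  rewrite expr2 mulr_suml.
  under eq_bigr do rewrite mulr_sumr.
  have -> : \sum_(i < m) \sum_(j < m) x 0 i * x 0 j =
      \sum_(i < m) (x 0 i ^+ 2 + (\sum_(j < m | (i < j)%N) x 0 i * x 0 j +
                     \sum_(j < m | (j < i)%N) x 0 i * x 0 j)).
    apply: eq_bigr => i _; rewrite (bigD1 i) //= -expr2; congr (_ + _).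
    rewrite (bigID (fun j : 'I_m => (i < j)%N)) /=; congr (_ + _).
      by apply: eq_bigl => j; rewrite -val_eqE /=; lia.
    by apply: eq_bigl => j; rewrite -val_eqE /=; lia.
  rewrite !big_split /= mulr2n; congr (_ + (_ + _)).
  rewrite (exchange_big_dep xpredT) //=.
  by apply: eq_bigr => i _; apply: eq_bigr => j _; rewrite mulrC.
by rewrite /theta mulrnDl [RHS]addrA; congr (_ + _); rewrite mulr2n.
Qed.

Lemma finite_theta_fiber m (n : nat) :
  finite_set [set x : 'rV[int]_m | theta x = n%:Z].
Proof.
pose B (f : {ffun 'I_m -> 'I_(4 * n).+1}) : 'rV[int]_m :=
  \row_i ((f i)%:Z - (2 * n)%:Z).
apply: (@sub_finite_set _ _ (B @` [set: {ffun 'I_m -> 'I_(4 * n).+1}])); last first.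
  exact/finite_image/finite_finset.
move=> x /= tx.
have xb i : `|x 0 i| <= (2 * n)%:Z.
  have : x 0 i ^+ 2 <= (2 * n)%:Z.
    have := theta_double x; rewrite tx (bigD1 i) //=.
    have : 0 <= \sum_(j < m | j != i) x 0 j ^+ 2.
      by apply: sumr_ge0 => j _; exact: sqr_ge0.
    have := sqr_ge0 (\sum_(j < m) x 0 j).
    move: (\sum_(j < m) x 0 j) (\sum_(j < m | j != i) _) (x 0 i ^+ 2) => u v w.
    move: (u ^+ 2) => t; rewrite mulr2n PoszM; lia.
  rewrite expr2; nia.
pose g i : nat := absz (x 0 i + (2 * n)%:Z).
exists [ffun i => inord (g i)] => //.
apply/rowP => i; rewrite mxE ffunE; have := xb i => xi.
by rewrite inordK /g; lia.
Qed.

(* Main.v *)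
(** The generating functions are truncated to polynomials: [c\phi_N(n)] and [p(n)] are the
    coefficients of ['X^n] in [A_N = Theta_(N-1) * E ^ N] and in [A_1 = E], where [E] is the truncated
    partition product and [Theta_m] the theta polynomial of a large box. Tilting [A_N] by
    [r = exp (- t)] turns its coefficients into the weights of a sum of independent geometric
    variables (and a theta variable of smaller order). With [c] the integral of [x / (e^x - 1)] over
    [x > 0] and [t = sqrt (N c / (n + delta))], a Lindeberg estimate of the characteristic function and
    Fourier inversion give a local limit theorem, and Euler-Maclaurin sums for [E(r)] (the constant
    being Stirling's) and Gaussian sums for [Theta(r)] give the normalisation. The result is
      [N * A_N`_n * exp (- (n t + N c / t)) / t ^ 2 --> 1 / (2 pi sqrt (2 c))],
    with a limit independent of [N] and [delta]. Comparing [(N, 0)] at [n] with [(1, delta)] at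
    [N n - delta], [delta = (N^2 - 1) / 24], where the two saddle points differ exactly by the factor
    [N], yields [c\phi_N(n) ~ N p(N n - delta)], which is the term [d = 1]. The terms [d > 1]
    involve [p(k)] with [4 k <= N n] and are exponentially smaller. *)
Require Import Defs.
From mathcomp Require Import all_boot all_order all_algebra finmap.
From mathcomp Require Import all_classical all_reals all_analysis.
From mathcomp Require Import ring lra zify complex.
Set Implicit Arguments.
Unset Strict Implicit.
Unset Printing Implicit Defensive.
Import Order.TTheory GRing.Theory Num.Theory.
Import numFieldNormedType.Exports.
Local Open Scope classical_set_scope.
Local Open Scope ring_scope.

(** * Derivatives, comparison of increments, existence of primitives *)

Section Derivatives.
Context {R : realType}.
Implicit Types (f g F G : R -> R) (a b x y : R).

(** The estimate is probabilistic rather than modular: away from the positive axis the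
    characteristic function of the geometric sum is exponentially small, so only q near 1 counts.
    The delicate point is that leading constants must match exactly. Write g for the Gaussian
    integral. Each factor [E] contributes 1 / (sqrt 2 g), each coordinate of [Theta] contributes
    sqrt 2 g up to ratios that telescope to 1 / sqrt N, and the standard deviation sqrt (2 N c) /
    t^(3/2) supplies another 1 / sqrt N together with the last g. Thus g cancels and c occurs
    identically on both sides; for this Stirling's constant has to be identified with ln (sqrt 2 g),
    which is done through Wallis integrals. Putting [delta] inside the saddle point makes the
    comparison algebraic, the only leftover being exp (delta t / N), which tends to 1. Working with
    polynomials makes Fourier inversion a finite sum with an explicit primitive; the price is a
    product of factors 1 - z^(k(n+1)), close to 1 because |z|^n is exponentially small. *)

Lemma der_id x : is_derive x 1 (fun y : R => y) 1.
Proof. exact: is_derive_id. Qed.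

Lemma der_cst x a : is_derive x 1 (fun _ : R => a) 0.
Proof. exact: is_derive_cst. Qed.

Lemma derD f g x a b : is_derive x 1 f a -> is_derive x 1 g b ->
  is_derive x 1 (fun y => f y + g y) (a + b).
Proof. by move=> df dg; exact: (is_deriveD df dg). Qed.

Lemma derN f x a : is_derive x 1 f a -> is_derive x 1 (fun y => - f y) (- a).
Proof. by move=> df; exact: (is_deriveN df). Qed.

Lemma derM f g x a b : is_derive x 1 f a -> is_derive x 1 g b ->
  is_derive x 1 (fun y => f y * g y) (a * g x + f x * b).
Proof.
move=> df dg; apply: (is_derive_eq (is_deriveM df dg)).
by rewrite /GRing.scale /=; ring.
Qed.

Lemma derX f x a n : is_derive x 1 f a ->
  is_derive x 1 (fun y => f y ^+ n) (n%:R * f x ^+ n.-1 * a).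
Proof.
move=> df; elim: n => [|n IHn].
  by apply: (is_derive_eq (der_cst _ _)); rewrite mul0r mul0r.
under eq_fun do rewrite exprS.
apply: (is_derive_eq (derM df IHn)) => /=.
by case: n {IHn} => [|n] /=; rewrite ?exprS -?natr1; ring.
Qed.

Lemma der_comp f g x a b : is_derive (f x) 1 g b -> is_derive x 1 f a ->
  is_derive x 1 (fun y => g (f y)) (b * a).
Proof. by move=> dg df; exact: (is_derive1_comp dg df). Qed.

Lemma derV f x a : is_derive x 1 f a -> f x != 0 ->
  is_derive x 1 (fun y => (f y)^-1) (- a / f x ^+ 2).
Proof.
move=> df fx0; apply: (is_derive_eq (is_deriveV fx0 df)).
by rewrite /GRing.scale /= mulrC mulNr mulrN -exprVn.
Qed.

Lemma der_expR f x a : is_derive x 1 f a ->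
  is_derive x 1 (fun y => expR (f y)) (expR (f x) * a).
Proof. by apply: der_comp; exact: is_derive_expR. Qed.

Lemma der_ln f x a : is_derive x 1 f a -> 0 < f x ->
  is_derive x 1 (fun y => ln (f y)) ((f x)^-1 * a).
Proof. by move=> df fx0; apply: der_comp df; exact: is_derive1_ln. Qed.

Lemma der_sin f x a : is_derive x 1 f a ->
  is_derive x 1 (fun y => sin (f y)) (cos (f x) * a).
Proof. by apply: der_comp; exact: is_derive_sin. Qed.

Lemma der_sum (I : Type) (r : seq I) (F : I -> R -> R) (dF : I -> R) x :
  (forall i, is_derive x 1 (F i) (dF i)) ->
  is_derive x 1 (fun y => \sum_(i <- r) F i y) (\sum_(i <- r) dF i).
Proof.
move=> dFi; elim: r => [|i r IHr].
  by under eq_fun do rewrite big_nil; rewrite big_nil; exact: der_cst.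
by under eq_fun do rewrite big_cons; rewrite big_cons; exact: derD.
Qed.

Lemma der_continuous F x a : is_derive x 1 F a -> {for x, continuous F}.
Proof.
by move=> dF; apply/differentiable_continuous/derivable1_diffP; exact: ex_derive.
Qed.

Lemma mvt F f a b : a < b ->
  (forall x, a < x < b -> is_derive x 1 F (f x)) ->
  (forall x, a <= x <= b -> {for x, continuous F}) ->
  exists2 x, a < x < b & F b - F a = f x * (b - a).
Proof.
move=> ab dF cF; have dF' x : x \in `]a, b[ -> is_derive x 1 F (f x) by rewrite in_itv => /dF.
have cF' : {within `[a, b], continuous F}.
  apply: continuous_in_subspaceT => x.
  by rewrite inE /= in_itv /= => /cF.
have [x] := MVT ab dF' cF'.
by rewrite in_itv /= => xab E; exists x.
Qed.

(** The mean value theorem for [G - F]. With [der_abs_le] it stands in for monotonicity of the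
    integral: integrals appear below as increments of primitives. Derivatives are asked only inside
    the interval, so that an endpoint may be singular. *)
Lemma der_le F f G g a b : a <= b ->
  (forall x, a < x < b -> is_derive x 1 F (f x)) ->
  (forall x, a < x < b -> is_derive x 1 G (g x)) ->
  (forall x, a <= x <= b -> {for x, continuous F}) ->
  (forall x, a <= x <= b -> {for x, continuous G}) ->
  (forall x, a < x < b -> f x <= g x) -> F b - F a <= G b - G a.
Proof.
rewrite le_eqVlt => /predU1P[-> *|ab dF dG cF cG fg]; first by rewrite !subrr.
have [|||x xab E] := @mvt (fun x => G x + - F x) (fun x => g x + - f x) a b.
- exact: ab.
- by move=> x xab; apply: derD; [exact: dG | apply: derN; exact: dF].
- by move=> x xab; apply: continuousD; [exact: cG | apply: continuousN; exact: cF].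
rewrite -subr_ge0.
have -> : G b - G a - (F b - F a) = G b - F b - (G a - F a) by ring.
by rewrite E mulr_ge0 // subr_ge0 ?fg // ltW.
Qed.

Lemma der_abs_le F f G g a b : a <= b ->
  (forall x, a < x < b -> is_derive x 1 F (f x)) ->
  (forall x, a < x < b -> is_derive x 1 G (g x)) ->
  (forall x, a <= x <= b -> {for x, continuous F}) ->
  (forall x, a <= x <= b -> {for x, continuous G}) ->
  (forall x, a < x < b -> `|f x| <= g x) -> `|F b - F a| <= G b - G a.
Proof.
move=> ab dF dG cF cG fg; rewrite ler_norml; apply/andP; split.
  rewrite lerNl opprB.
  suff: - F b - - F a <= G b - G a by rewrite opprK addrC.
  apply: (@der_le (fun x => - F x) (fun x => - f x) G g) => // x xab.
  - by apply: derN; exact: dF.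
  - by apply: continuousN; exact: cF.
  - by rewrite (le_trans _ (fg x xab)) // -normrN ler_norm.
apply: (@der_le F f G g) => // x xab.
by rewrite (le_trans _ (fg x xab)) // ler_norm.
Qed.

(** The fundamental theorem differentiates an integral taken from a fixed left endpoint [a < x]. The
    signed integral from 0 serves all [x] at once, and between [- M] and [M] it differs from the
    integral from [- M] by a constant. *)
Lemma primitive f : continuous f -> exists F, forall x, is_derive x 1 F (f x).
Proof.
move=> cf.
have intf a b : lebesgue_measure.-integrable `[a, b] (EFin \o f).
  by apply: continuous_compact_integrable; [exact: segment_compact
    | exact: continuous_subspaceT].
pose I a b := (\int[lebesgue_measure]_(t in `[a, b]) f t)%R.
have dI a x : a < x -> is_derive x 1 (I a) (f x).
  move=> ax; have [||||dx Ex] := @continuous_FTC1_closed R f a x (x + 1).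
  - by rewrite ltrDl.
  - exact: intf.
  - exact: ax.
  - exact: cf.
  by apply: (DeriveDef dx); rewrite -derive1E Ex.
pose F x := (\int[lebesgue_measure]_(t in `]0, x]) f t)%R -
            (\int[lebesgue_measure]_(t in `]x, 0]) f t)%R.
have FE M x : - M < x < M -> F x = I (- M) x - I (- M) 0.
  move=> /andP[Mx xM]; rewrite /F /I.
  have [x0|x0] := leP 0 x.
    rewrite (@Rintegral_itvB R f (BLeft (- M)) (BRight x) 0); last 3 first.
    - exact: intf.
    - by rewrite bnd_simp; lra.
    - by rewrite bnd_simp; lra.
    by rewrite [X in _ - X](_ : _ = 0) ?subr0 // set_itv_ge ?Rintegral_set0 // bnd_simp -leNgt.
  rewrite -[RHS]opprB (@Rintegral_itvB R f (BLeft (- M)) (BRight 0) x); last 3 first.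
  - exact: intf.
  - by rewrite bnd_simp; lra.
  - by rewrite bnd_simp; lra.
  by rewrite [X in X - _](_ : _ = 0) ?sub0r // set_itv_ge ?Rintegral_set0 // bnd_simp -leNgt; lra.
exists F => x; pose M := `|x| + 1.
have Mx : - M < x < M.
  by rewrite /M; have := ler_norm x; have := ler_norm (- x); rewrite normrN; lra.
apply: (@near_eq_is_derive _ _ _ (fun y => I (- M) y + - I (- M) 0)).
  near=> y; apply/esym/FE; apply/andP; split; near: y.
    by apply: lt_nbhsr; case/andP: Mx.
  by apply: lt_nbhsl; case/andP: Mx.
rewrite -[f x]addr0; apply: (derD _ (der_cst _ _)).
by apply: dI; case/andP: Mx.
Unshelve. all: end_near. Qed.

End Derivatives.

(** * Bounds and monotonicity for x / (e^x - 1) and its companions *)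

Section BoseFunctions.
Context {R : realType}.
Implicit Types (x y t : R) (n k : nat).

(** [bose x / x] and [bosevar x / x ^+ 2] are the mean and variance of a geometric variable of ratio
    exp (- x); [lnbose x] is - ln (1 - exp (- x)) with its singularity - ln x at 0 removed. The
    derivative of [lnbose] is (1 - bose) / x, and that of [bose] is (bose - bosevar) / x. *)
Definition lnbose x : R := ln (x / (1 - expR (- x))).
Definition bose x : R := x / (expR x - 1).
Definition bosevar x : R := bose x * (bose x + x).

Lemma expRm1_gt0 x : 0 < x -> 0 < expR x - 1.
Proof. by move=> x0; rewrite subr_gt0 expR_gt1. Qed.

Lemma oneBexpR_gt0 x : 0 < x -> 0 < 1 - expR (- x).
Proof. by move=> x0; rewrite subr_gt0 expR_lt1 oppr_lt0. Qed.

Lemma bose_gt0 x : 0 < x -> 0 < bose x.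
Proof. by move=> x0; rewrite divr_gt0 // expRm1_gt0. Qed.

Lemma bose_le1 x : 0 < x -> bose x <= 1.
Proof.
by move=> x0; rewrite ler_pdivrMr ?expRm1_gt0 // mul1r lerBrDl expR_ge1Dx.
Qed.

Lemma boseDx x : 0 < x -> bose x + x = x / (1 - expR (- x)).
Proof.
move=> x0; rewrite /bose expRN.
have /lt0r_neq0 e0 := expR_gt0 x; have /lt0r_neq0 e1 := expRm1_gt0 x0.
by field; rewrite e0 e1.
Qed.

Lemma boseDx_ge1 x : 0 < x -> 1 <= bose x + x.
Proof.
move=> x0; rewrite boseDx // ler_pdivlMr ?oneBexpR_gt0 // mul1r.
by have := expR_ge1Dx (- x); lra.
Qed.

Lemma der_lnbose x : 0 < x -> is_derive x 1 lnbose ((1 - bose x) / x).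
Proof.
move=> x0; have e1 := oneBexpR_gt0 x0.
have d1 : is_derive x 1 (fun y => 1 - expR (- y)) (expR (- x)).
  by apply: (is_derive_eq (derD (der_cst _ _) (derN (der_expR (derN (der_id _)))))); ring.
have n1 : 1 - expR (- x) != 0 by rewrite gt_eqF.
have p1 : 0 < x / (1 - expR (- x)) by rewrite divr_gt0.
change (is_derive x 1 (fun y => ln (y / (1 - expR (- y)))) ((1 - bose x) / x)).
apply: (is_derive_eq (der_ln (derM (der_id _) (derV d1 n1)) p1)).
rewrite -[1 - bose x](_ : 1 + x - (bose x + x) = _); last by ring.
by rewrite boseDx //; field; rewrite n1 gt_eqF.
Qed.

Lemma der_bose x : 0 < x -> is_derive x 1 bose ((bose x - bosevar x) / x).
Proof.
move=> x0; have e1 := expRm1_gt0 x0.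
have n1 : expR x - 1 != 0 by rewrite gt_eqF.
have d1 : is_derive x 1 (fun y => expR y - 1) (expR x).
  by apply: (is_derive_eq (derD (der_expR (der_id _)) (der_cst _ _))); ring.
change (is_derive x 1 (fun y => y / (expR y - 1)) ((bose x - bosevar x) / x)).
apply: (is_derive_eq (derM (der_id _) (derV d1 n1))).
by rewrite /bosevar /bose; field; rewrite n1 gt_eqF.
Qed.

Lemma bosevar_gt0 x : 0 < x -> 0 < bosevar x.
Proof. by move=> x0; have b0 := bose_gt0 x0; rewrite mulr_gt0 // addr_gt0. Qed.

Lemma le_bose_bosevar x : 0 < x -> bose x <= bosevar x.
Proof.
move=> x0; rewrite /bosevar ler_peMr ?boseDx_ge1 //; exact: (ltW (bose_gt0 x0)).
Qed.

(** This is x / 2 <= sinh (x / 2). The left side has derivative e^(x/2) (1 + x/2) <= e^(x/2)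
    e^(x/2). It gives both [bosevar <= 1] and the exponential decay of [bose]. *)
Lemma x_expR_half_le x : 0 <= x -> x * expR (x / 2) <= expR x - 1.
Proof.
move=> x0; have dL y : is_derive y 1 (fun y => y * expR (y / 2))
    (expR (y / 2) + y / 2 * expR (y / 2)).
  apply: (is_derive_eq (derM (der_id _) (der_expR (derM (der_id _) (der_cst _ _))))).
  by ring.
have dR y : is_derive y 1 (fun y => expR y - 1) (expR y).
  by apply: (is_derive_eq (derD (der_expR (der_id _)) (der_cst _ _))); ring.
have := @der_le R _ _ _ _ 0 x x0 (fun y _ => dL y) (fun y _ => dR y)
  (fun y _ => der_continuous (dL y)) (fun y _ => der_continuous (dR y)).
rewrite mul0r subr0 expR0 subrr subr0; apply => y /andP[y0 _].
have -> : expR y = expR (y / 2) * expR (y / 2) by rewrite -expRD -splitr.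
 have := expR_gt0 (y / 2); have := expR_ge1Dx (y / 2).
by move: (expR _) => e; nra.
Qed.

Lemma bosevar_le1 x : 0 < x -> bosevar x <= 1.
Proof.
move=> x0; have e1 := expRm1_gt0 x0.
have -> : bosevar x = (x * expR (x / 2)) ^+ 2 / (expR x - 1) ^+ 2.
  have -> : (x * expR (x / 2)) ^+ 2 = x ^+ 2 * expR x.
    by rewrite exprMn [expR (x / 2) ^+ 2]expr2 -expRD -splitr.
  by rewrite /bosevar /bose; field; rewrite gt_eqF.
rewrite ler_pdivrMr ?exprn_gt0 // mul1r lerXn2r ?nnegrE //.
- by rewrite mulr_ge0 ?expR_ge0 ?ltW.
- exact: ltW.
- by apply: x_expR_half_le; exact: ltW.
Qed.

Lemma bose_le_expR x : 0 < x -> bose x <= expR (- (x / 2)).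
Proof.
move=> x0; rewrite ler_pdivrMr ?expRm1_gt0 // mulrC expRN.
rewrite ler_pdivlMr ?expR_gt0 //; exact: (x_expR_half_le (ltW x0)).
Qed.

Lemma bose_ge_expRN x : 0 < x -> expR (- x) <= bose x.
Proof.
move=> x0; rewrite ler_pdivlMr ?expRm1_gt0 // mulrBr -expRD addNr expR0 mulr1.
by have := expR_ge1Dx (- x); lra.
Qed.

(** Clearing denominators leaves e^x (1 - x/2) <= 1 + x/2, proved by comparing derivatives. The
    bound 1/2 is the limit at 0, that is, the slope of [lnbose] there. *)
Lemma oneBbose_le_half x : 0 < x -> (1 - bose x) / x <= 2^-1.
Proof.
move=> x0.
have dL y : is_derive y 1 (fun y => expR y * (1 - y / 2)) (expR y * (1 - y) / 2).
  have -> : expR y * (1 - y) / 2 = expR y * 1 * (1 - y / 2) + expR y * (0 + - (1 / 2 + y * 0)).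
    by field.
  apply: (derM (der_expR (der_id _)) (derD (der_cst _ _) (derN (derM (der_id _) (der_cst _ _))))).
have dR y : is_derive y 1 (fun y => y / 2) (2^-1).
  by apply: (is_derive_eq (derM (der_id _) (der_cst _ _))); ring.
have := @der_le R _ _ _ _ 0 x (ltW x0) (fun y _ => dL y) (fun y _ => dR y)
  (fun y _ => der_continuous (dL y)) (fun y _ => der_continuous (dR y)).
rewrite mul0r expR0 => /(_ _) H.
have {H} : expR x * (1 - x / 2) - 1 * (1 - 0) <= x / 2 - 0.
  apply: H => y /andP[y0 _].
  have : expR y * (1 - y) <= 1.
    rewrite -[leRHS](expRxMexpNx_1 y) ler_wpM2l ?expR_ge0 //.
    by have := expR_ge1Dx (- y).
  lra.
have e1 := expRm1_gt0 x0.
have bx : bose x * (expR x - 1) = x by rewrite divfK // gt_eqF.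
move=> H; rewrite ler_pdivrMr // -subr_ge0 -(pmulr_lge0 _ e1).
have -> : (2^-1 * x - (1 - bose x)) * (expR x - 1) =
  2^-1 * x * (expR x - 1) - (expR x - 1) + bose x * (expR x - 1) by ring.
by rewrite bx; lra.
Qed.

(** The quotient is the derivative of [lnbose] and has derivative (bosevar - 1) / x^2 <= 0: [lnbose]
    is concave. *)
Lemma le_oneBbose x y : 0 < x -> x <= y -> (1 - bose y) / y <= (1 - bose x) / x.
Proof.
move=> x0 xy.
have d (z : R) : 0 < z -> is_derive z 1 (fun z => - ((1 - bose z) / z)) ((1 - bosevar z) / z ^+ 2).
  move=> z0; have nz : z != 0 by rewrite gt_eqF.
  apply: (is_derive_eq (derN (derM (derD (der_cst _ _) (derN (der_bose z0))) (derV (der_id _) nz)))).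
  by field.
have p z : x <= z <= y -> 0 < z by case/andP => xz _; exact: lt_le_trans xz.
have p' z : x < z < y -> 0 < z by case/andP => xz _; exact: lt_trans xz.
have := @der_le R _ _ _ _ x y xy (fun z _ => der_cst z 0) (fun z zxy => d z (p' z zxy))
  (fun z _ => der_continuous (der_cst z 0)) (fun z zxy => der_continuous (d z (p z zxy))).
rewrite subr0 opprK => H.
rewrite -subr_ge0 addrC; apply: H => z zxy.
by rewrite divr_ge0 ?sqr_ge0 // subr_ge0 bosevar_le1 // p'.
Qed.

Lemma oneBbose_ge0 x : 0 < x -> 0 <= (1 - bose x) / x.
Proof. by move=> x0; rewrite divr_ge0 ?(ltW x0) // subr_ge0 bose_le1. Qed.

Lemma le_bose x y : 0 < x -> x <= y -> bose y <= bose x.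
Proof.
move=> x0 xy.
have p z : x <= z <= y -> 0 < z by case/andP => xz _; exact: lt_le_trans xz.
have p' z : x < z < y -> 0 < z by case/andP => xz _; exact: lt_trans xz.
have := @der_le R _ _ _ _ x y xy (fun z zxy => der_bose (p' z zxy)) (fun z _ => der_cst z 0)
  (fun z zxy => der_continuous (der_bose (p z zxy))) (fun z _ => der_continuous (der_cst z 0)).
rewrite subr0 subr_le0; apply => z zxy; have z0 := p' z zxy.
by rewrite pmulr_lle0 ?invr_gt0 // subr_le0 le_bose_bosevar.
Qed.

Lemma der_bosevar x : 0 < x ->
  is_derive x 1 bosevar (bose x * (bose x + x) * (2 - 2 * bose x - x) / x).
Proof.
move=> x0.
change (is_derive x 1 (fun y => bose y * (bose y + y)) (bose x * (bose x + x) * (2 - 2 * bose x - x) / x)).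
apply: (is_derive_eq (derM (der_bose x0) (derD (der_bose x0) (der_id _)))).
by rewrite /bosevar; field; rewrite gt_eqF.
Qed.

(** The derivative has the sign of 2 (1 - bose x) - x, which [oneBbose_le_half] makes
    nonpositive. *)
Lemma le_bosevar x y : 0 < x -> x <= y -> bosevar y <= bosevar x.
Proof.
move=> x0 xy.
have p z : x <= z <= y -> 0 < z by case/andP => xz _; exact: lt_le_trans xz.
have p' z : x < z < y -> 0 < z by case/andP => xz _; exact: lt_trans xz.
have := @der_le R _ _ _ _ x y xy (fun z zxy => der_bosevar (p' z zxy)) (fun z _ => der_cst z 0)
  (fun z zxy => der_continuous (der_bosevar (p z zxy))) (fun z _ => der_continuous (der_cst z 0)).
rewrite subr0 subr_le0; apply => z zxy; have z0 := p' z zxy.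
rewrite pmulr_lle0 ?invr_gt0 // pmulr_rle0 ?bosevar_gt0 //.
have := oneBbose_le_half z0; rewrite ler_pdivrMr //; lra.
Qed.

Lemma lnbose_ge0 x : 0 < x -> 0 <= lnbose x.
Proof. by move=> x0; rewrite ln_ge0 // -boseDx // boseDx_ge1. Qed.

Lemma lnbose_le x : 0 < x -> lnbose x <= x.
Proof.
move=> x0; rewrite -ler_expR lnK ?posrE ?divr_gt0 ?oneBexpR_gt0 //.
rewrite ler_pdivrMr ?oneBexpR_gt0 // mulrBr mulr1 -expRD subrr expR0.
by have := expR_ge1Dx x; lra.
Qed.

Lemma lnboseE x : 0 < x -> lnbose x = ln x - ln (1 - expR (- x)).
Proof. by move=> x0; rewrite /lnbose ln_div ?posrE ?oneBexpR_gt0. Qed.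

(** The default value ln 0 = 0 agrees with the limit at 0, so composition with the absolute value is
    continuous on the whole line, as [primitive] requires. *)
Lemma lnbose0 : lnbose 0 = 0.
Proof. by rewrite /lnbose mul0r ln0. Qed.

Lemma continuous_lnbose_norm : continuous (fun x => lnbose `|x|).
Proof.
move=> x; have [->|x0] := eqVneq x 0.
  rewrite /continuous_at normr0 lnbose0.
  apply: (@squeeze_cvgr _ _ _ _ (fun=> 0) (fun y : R => `|y|)); last 2 first.
  - exact: cvg_cst.
  - by rewrite -[X in _ --> X](normr0 R); exact: norm_continuous.
  near=> y; have [->|y0] := eqVneq y 0; first by rewrite normr0 lnbose0 lexx.
  by rewrite lnbose_ge0 ?lnbose_le ?normr_gt0.
apply: (@continuous_comp _ _ _ (fun x => `|x|) lnbose); first exact: norm_continuous.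
by apply: der_continuous; apply: der_lnbose; rewrite normr_gt0.
Unshelve. all: end_near. Qed.

End BoseFunctions.

(** * Riemann sums and the trapezoidal rule *)

Section RiemannSums.
Context {R : realType}.
Implicit Types (e E : R -> R) (x y t : R) (n k : nat).

(** On each cell the increment of [E] lies between [t] times the two end values of [e], so the
    defect telescopes. The cell from 0 to [t] is left out, [e] being controlled on positive
    arguments only. *)
Lemma riemann_sum_nonincreasing e E t n : 0 < t -> (0 < n)%N ->
  (forall x, 0 < x -> is_derive x 1 E (e x)) ->
  (forall x y, 0 < x -> x <= y -> e y <= e x) ->
  (forall x, 0 < x -> 0 <= e x) ->
  0 <= t * (\sum_(1 <= k < n.+1) e (k%:R * t)) - (E (n%:R * t) - E t) <= t * e t.
Proof.
move=> t0 n0 dE de e0.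
(* Keeping the last value of [e] in the lower bound makes the induction close. *)
suff : t * e (n%:R * t) <=
    t * (\sum_(1 <= k < n.+1) e (k%:R * t)) - (E (n%:R * t) - E t) <= t * e t.
  case/andP=> H ->; rewrite andbT; apply: le_trans H.
  by rewrite mulr_ge0 ?(ltW t0) // e0 // mulr_gt0 ?ltr0n.
elim: n n0 => // -[|n] IHn _.
  by rewrite big_nat1 mul1r subrr subr0 !lexx.
have {IHn} /andP[IH1 IH2] := IHn isT.
rewrite big_nat_recr //= mulrDr.
set S := t * \sum_(_ <= _ < _) _ in IH1 IH2 *.
have n1 : 0 < n.+1%:R * t by rewrite mulr_gt0 ?ltr0n.
have lt12 : n.+1%:R * t < n.+2%:R * t by rewrite ltr_pM2r // ltr_nat.
have [x /andP[xl xr] ->] : exists2 x, n.+1%:R * t < x < n.+2%:R * t &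
    E (n.+2%:R * t) = E (n.+1%:R * t) + e x * t.
  have [x||x xI Ex] := @mvt R E e (n.+1%:R * t) (n.+2%:R * t) lt12.
  - by case/andP => ? _; apply: dE; exact: lt_trans n1 _.
  - move=> x /andP[? _]; apply: der_continuous; apply: dE; exact: lt_le_trans n1 _.
  - exists x => //; apply/eqP; rewrite -subr_eq0 opprD addrA Ex -mulrBl -natrB // subSnn mul1r subrr //.
have x0 : 0 < x by exact: lt_trans xl.
have := de _ _ n1 (ltW xl); have := de _ _ x0 (ltW xr).
rewrite -(ler_pM2l t0) -[_ <= e (n.+1%:R * t)](ler_pM2l t0) => H1 H2.
apply/andP; split; lra.
Qed.

(** The defect on [a, x] has derivative (x - a) (p x - p y) / 2 for some y between a and x. The
    bounds [pa] and [pb] replace values of [p] at the ends, where [h] may fail to be differentiable;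
    when [p] is monotone, the errors of consecutive cells telescope. *)
Lemma trapezoid (h H p : R -> R) (a b pa pb : R) : a <= b ->
  (forall x, a <= x <= b -> is_derive x 1 H (h x)) ->
  (forall x, a <= x <= b -> {for x, continuous h}) ->
  (forall x, a < x < b -> is_derive x 1 h (p x)) ->
  (forall x, a < x < b -> pb <= p x <= pa) ->
  `|(b - a) * (h a + h b) / 2 - (H b - H a)| <= (b - a) ^+ 2 * (pa - pb).
Proof.
move=> ab dH ch dh bp.
pose F x := (x - a) * (h a + h x) / 2 - (H x - H a).
pose f x := (h a - h x) / 2 + (x - a) * p x / 2.
pose G x := x * ((b - a) * (pa - pb)).
have dF x : a < x < b -> is_derive x 1 F (f x).
  move=> xab.
  have dHx : is_derive x 1 H (h x) by apply: dH; case/andP: xab => /ltW -> /ltW ->.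
  have d1 : is_derive x 1 (fun y => y - a) 1.
    by apply: (is_derive_eq (derD (der_id _) (der_cst _ _))); rewrite addr0.
  have d2 : is_derive x 1 (fun y => h a + h y) (p x).
    by apply: (is_derive_eq (derD (der_cst _ _) (dh _ xab))); rewrite add0r.
  apply: (is_derive_eq (derD (derM (derM d1 d2) (der_cst _ _)) (derN (derD dHx (der_cst _ _))))).
  by rewrite /f; field.
have dG x : is_derive x 1 G ((b - a) * (pa - pb)).
  by apply: (is_derive_eq (derM (der_id _) (der_cst _ _))); ring.
have -> : (b - a) * (h a + h b) / 2 - (H b - H a) = F b - F a.
  by rewrite /F; ring.
have -> : (b - a) ^+ 2 * (pa - pb) = G b - G a by rewrite /G; ring.
apply: (@der_abs_le R F f G (fun=> (b - a) * (pa - pb)) a b ab) => //.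
- move=> x xab; apply: continuousB; last first.
    by apply: continuousB; [exact: der_continuous (dH _ xab) | exact: cvg_cst].
  apply: continuousM; last exact: cvg_cst.
  apply: continuousM; first by apply: continuousB; [exact: cvg_id | exact: cvg_cst].
  by apply: continuousD; [exact: cvg_cst | exact: ch].
- by move=> x _; exact: der_continuous (dG x).
move=> x /andP[ax xb].
have [||y /andP[ay yx] Ey] := @mvt R h p a x ax.
- by move=> y /andP[ay yx]; apply: dh; rewrite ay (lt_trans yx).
- by move=> y /andP[ay yx]; apply: ch; rewrite ay (le_trans yx) // ltW.
have := bp x; rewrite ax xb => /(_ isT)/andP[p1 p2].
have := bp y; rewrite ay (lt_trans yx xb) => /(_ isT)/andP[p3 p4].
have -> : f x = (x - a) * ((p x - p y) / 2).
  by rewrite /f -[h a - h x]opprB Ey; field.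
rewrite normrM ger0_norm ?subr_ge0 ?(ltW ax) // ler_pM ?normr_ge0 ?subr_ge0 ?(ltW ax) //.
  by rewrite lerD2r ltW.
by rewrite ler_norml; apply/andP; split; lra.
Qed.

End RiemannSums.

(** * Sums over the grid k t and the constant [boseint] *)

Section BoseSums.
Context {R : realType}.
Implicit Types (x y t : R) (n k : nat).

Lemma primitive_lnbose_ex : exists H : R -> R,
  (forall x, is_derive x 1 H (lnbose `|x|)) /\ H 0 = 0.
Proof.
have [H dH] := primitive (@continuous_lnbose_norm R).
exists (fun x => H x - H 0); split => [x|]; last by rewrite subrr.
by apply: (is_derive_eq (derD (dH x) (der_cst _ _))); rewrite addr0.
Qed.

Definition Lnbose : R -> R := sval (cid primitive_lnbose_ex).

Lemma der_Lnbose x : is_derive x 1 Lnbose (lnbose `|x|).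
Proof. by case: (svalP (cid primitive_lnbose_ex)). Qed.

Lemma Lnbose0 : Lnbose 0 = 0.
Proof. by case: (svalP (cid primitive_lnbose_ex)). Qed.

(** Integration by parts: [bose] is 1 minus x times the derivative of [lnbose], so this is the
    primitive of [bose] vanishing at 0. It makes the integrals of [lnbose], [bose] and [bosevar]
    depend on a single constant. *)
Definition Bose x : R := Lnbose x - x * lnbose `|x| + x.

Lemma Bose0 : Bose 0 = 0.
Proof. by rewrite /Bose Lnbose0 mul0r subr0 addr0. Qed.

Lemma der_Bose x : 0 < x -> is_derive x 1 Bose (bose x).
Proof.
move=> x0; have dn : is_derive x 1 (fun y : R => lnbose `|y|) ((1 - bose x) / x).
  apply: (@near_eq_is_derive _ _ _ lnbose); last exact: der_lnbose.
  near=> y; rewrite ger0_norm //; near: y; exact: lt_le_nbhsr.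
change (is_derive x 1 (fun x => Lnbose x - x * lnbose `|x| + x) (bose x)).
apply: (is_derive_eq (derD (derD (der_Lnbose x) (derN (derM (der_id _) dn))) (der_id _))).
by rewrite ger0_norm ?(ltW x0) //; field; rewrite gt_eqF.
Unshelve. all: end_near. Qed.

Lemma continuous_Bose x : {for x, continuous Bose}.
Proof.
apply: continuousD; last exact: cvg_id.
apply: continuousB; first exact: der_continuous (der_Lnbose x).
by apply: continuousM; [exact: cvg_id | exact: continuous_lnbose_norm].
Qed.

Lemma le_Bose x y : 0 <= x -> x <= y -> 0 <= Bose y - Bose x <= 2 * expR (- (x / 2)).
Proof.
move=> x0 xy.
have p z : x < z < y -> 0 < z by case/andP => xz _; exact: le_lt_trans xz.
have dB z : x < z < y -> is_derive z 1 Bose (bose z) by move=> /p; exact: der_Bose.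
have cB z : x <= z <= y -> {for z, continuous Bose} by move=> _; exact: continuous_Bose.
have dC (z : R) : is_derive z 1 (fun z : R => - 2 * expR (- (z / 2))) (expR (- (z / 2))).
  apply: (is_derive_eq (derM (der_cst _ _) (der_expR (derN (derM (der_id _) (der_cst _ _)))))).
  by field.
apply/andP; split.
  have := @der_le R _ _ _ _ x y xy (fun z _ => der_cst z 0) dB
    (fun z _ => der_continuous (der_cst z 0)) cB.
  by rewrite subrr; apply => z /p z0; exact/ltW/bose_gt0.
have := @der_le R _ _ _ _ x y xy dB (fun z _ => dC z) cB (fun z _ => der_continuous (dC z)).
move=> /(_ _) H; apply: le_trans (H _) _.
  by move=> z /p z0; exact: bose_le_expR.
by have := expR_gt0 (- (y / 2)); lra.
Qed.

(** The integral of [bose] over the positive half-line, as the supremum of its increasing primitive;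
    classically pi^2 / 6. *)
Definition boseint : R := sup [set Bose x | x in [set x | 0 <= x]].

Lemma boseint_near x : 0 <= x -> 0 <= boseint - Bose x <= 2 * expR (- (x / 2)).
Proof.
move=> x0; have ub : ubound [set Bose x | x in [set x | 0 <= x]] (Bose x + 2 * expR (- (x / 2))).
  move=> _ [y /= y0 <-]; have [xy|yx] := leP x y.
    by have /andP[_] := le_Bose x0 xy; lra.
  by have := expR_gt0 (- (x / 2)); have /andP[+ _] := le_Bose y0 (ltW yx); lra.
have ne : [set Bose x | x in [set x | 0 <= x]] !=set0 by exists (Bose x), x.
have := ge_sup ne ub; rewrite -/boseint => H.
have : Bose x <= boseint by apply: ub_le_sup; [by exists (Bose x + 2 * expR (- (x / 2))) | by exists x].
by lra.
Qed.

Lemma boseint_gt0 : 0 < boseint.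
Proof.
have /andP[+ _] := boseint_near ler01; rewrite subr_ge0; apply: lt_le_trans.
have dC (z : R) : is_derive z 1 (fun z : R => - expR (- z)) (expR (- z)).
  by apply: (is_derive_eq (derN (der_expR (derN (der_id _))))); ring.
have := @der_le R _ _ _ _ 0 1 ler01 (fun z _ => dC z) (fun z zI => @der_Bose z (proj1 (andP zI)))
    (fun z _ => der_continuous (dC z)) (fun z _ => continuous_Bose (x := z)).
rewrite Bose0 oppr0 expR0 addr0 => H; apply: lt_le_trans (H _).
  by rewrite opprK addrC subr_gt0 expR_lt1 oppr_lt0.
by move=> z /andP[z0 _]; exact: bose_ge_expRN.
Qed.

Lemma Bose_le x : 0 <= x -> 0 <= Bose x <= x.
Proof.
move=> x0; apply/andP; split.
  by have /andP[+ _] := le_Bose (lexx 0) x0; rewrite Bose0 subr0.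
have := @der_le R _ _ _ _ 0 x x0 (fun z zI => @der_Bose z (proj1 (andP zI))) (fun z _ => der_id z)
    (fun z _ => continuous_Bose (x := z)) (fun z _ => der_continuous (der_id z)).
by rewrite Bose0 !subr0; apply => z /andP[z0 _]; exact: bose_le1.
Qed.

Lemma sum_bose t n : 0 < t -> (0 < n)%N ->
  `|t * (\sum_(1 <= k < n.+1) bose (k%:R * t)) - boseint| <= t + 2 * expR (- (n%:R * t / 2)).
Proof.
move=> t0 n0.
have e0 x : 0 < x -> 0 <= bose x by move=> x0; exact: (ltW (bose_gt0 x0)).
have /andP[H1 H2] := riemann_sum_nonincreasing t0 n0 der_Bose (@le_bose R) e0.
have b1 := bose_le1 t0; have /andP[B1 B2] := Bose_le (ltW t0).
have nt : 0 <= n%:R * t by rewrite mulr_ge0 ?ler0n ?(ltW t0).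
have /andP[C1 C2] := boseint_near nt.
have tb : t * bose t <= t by rewrite ler_piMr // ltW.
by rewrite ler_norml; apply/andP; split; lra.
Qed.

(** Since x bose' = bose - bosevar, a primitive of [bosevar] is 2 Bose - x bose, whose limit at
    infinity is 2 [boseint]. *)
Lemma sum_bosevar t n : 0 < t -> (0 < n)%N ->
  `|t * (\sum_(1 <= k < n.+1) bosevar (k%:R * t)) - 2 * boseint| <=
    3 * t + 4 * expR (- (n%:R * t / 2)) + n%:R * t * expR (- (n%:R * t / 2)).
Proof.
move=> t0 n0.
have d x : 0 < x -> is_derive x 1 (fun x => 2 * Bose x - x * bose x) (bosevar x).
  move=> x0.
  apply: (is_derive_eq (derD (derM (der_cst _ _) (der_Bose x0)) (derN (derM (der_id _) (der_bose x0))))).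
  by field; rewrite gt_eqF.
have e0 x : 0 < x -> 0 <= bosevar x by move=> x0; exact: (ltW (bosevar_gt0 x0)).
have /andP[H1 H2] := riemann_sum_nonincreasing t0 n0 d (@le_bosevar R) e0.
have b1 := bose_le1 t0; have /andP[B1 B2] := Bose_le (ltW t0).
have nt : 0 < n%:R * t by rewrite mulr_gt0 ?ltr0n.
have /andP[C1 C2] := boseint_near (ltW nt).
have b0 := bose_gt0 t0.
have tb : 0 <= t * bose t <= t by apply/andP; split; nra.
have tv : t * bosevar t <= t by rewrite ler_piMr ?bosevar_le1 // ltW.
have nb : 0 <= n%:R * t * bose (n%:R * t) <= n%:R * t * expR (- (n%:R * t / 2)).
  by rewrite mulr_ge0 ?(ltW (bose_gt0 nt)) ?(ltW nt) // ler_pM2l // bose_le_expR.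
by rewrite ler_norml; apply/andP; split; lra.
Qed.

(** The trapezoidal rule on each cell; as [lnbose] is concave, the errors telescope and their total
    is at most t^2 times the slope 1/2 at 0. *)
Lemma sum_lnbose t n : 0 < t -> (0 < n)%N ->
  `|t * (\sum_(1 <= k < n.+1) lnbose (k%:R * t)) - t * lnbose (n%:R * t) / 2 - Lnbose (n%:R * t)|
     <= t ^+ 2.
Proof.
(* At k = 0 the formula for the slope degenerates, and its limit 1/2 is used instead. *)
move=> t0 n0; pose p k : R := if k is 0%N then 2^-1 else (1 - bose (k%:R * t)) / (k%:R * t).
have p0 k : 0 <= p k.
  by case: k => [|k]; rewrite /p ?invr_ge0 // oneBbose_ge0 // mulr_gt0 ?ltr0n.
suff : `|t * (\sum_(1 <= k < n.+1) lnbose (k%:R * t)) - t * lnbose (n%:R * t) / 2 -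
     Lnbose (n%:R * t)| <= t ^+ 2 * (p 0%N - p n).
  move=> H; apply: (le_trans H); rewrite ler_piMr ?sqr_ge0 //.
  by have := p0 n; have -> : p 0%N = 2^-1 by []; lra.
elim: n {n0} => [|n IHn].
  by rewrite big_geq // !mul0r !(lnbose0, Lnbose0) !(mulr0, mul0r, subrr, subr0) normr0.
rewrite big_nat_recr //.
set S := \sum_(_ <= _ < _) _ in IHn *.
have n1t : 0 <= n%:R * t by rewrite mulr_ge0 ?ler0n // ltW.
have step : n.+1%:R * t - n%:R * t = t by rewrite -mulrBl -natrB // subSnn mul1r.
have T : `|t * (lnbose (n%:R * t) + lnbose (n.+1%:R * t)) / 2 -
           (Lnbose (n.+1%:R * t) - Lnbose (n%:R * t))| <= t ^+ 2 * (p n - p n.+1).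
  have ab : n%:R * t <= n.+1%:R * t by rewrite -subr_ge0 step ltW.
  have := @trapezoid R (fun x => lnbose `|x|) Lnbose (fun x => (1 - bose x) / x)
    (n%:R * t) (n.+1%:R * t) (p n) (p n.+1) ab.
  rewrite step (ger0_norm n1t) (ger0_norm (le_trans n1t ab)).
  apply => x.
  - by move=> _; exact: der_Lnbose.
  - by move=> _; exact: continuous_lnbose_norm.
  - case/andP=> xl _; have x0 : 0 < x by exact: le_lt_trans xl.
    apply: (@near_eq_is_derive _ _ _ lnbose); last exact: der_lnbose.
    near=> y; rewrite ger0_norm //; near: y; exact: lt_le_nbhsr.
  - case/andP=> xl xr; have x0 : 0 < x by exact: le_lt_trans xl.
    apply/andP; split; first by apply: le_oneBbose => //; exact: ltW.
    case: n xl {IHn S n1t step ab xr} => [|n] xl; first exact: oneBbose_le_half.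
    by apply: le_oneBbose; rewrite ?mulr_gt0 ?ltr0n // ltW.
rewrite /=; have -> : t * (S + lnbose (n.+1%:R * t)) - t * lnbose (n.+1%:R * t) / 2 - Lnbose (n.+1%:R * t) =
  (t * S - t * lnbose (n%:R * t) / 2 - Lnbose (n%:R * t)) +
  (t * (lnbose (n%:R * t) + lnbose (n.+1%:R * t)) / 2 -
           (Lnbose (n.+1%:R * t) - Lnbose (n%:R * t))) by field.
apply: le_trans (ler_normD _ _) _; apply: le_trans (lerD IHn T) _.
rewrite -mulrDr; apply: ler_wpM2l; first exact: sqr_ge0.
by rewrite addrA subrK; exact: lexx.
Unshelve. all: end_near. Qed.

End BoseSums.

(** * Gaussian sums *)

Section GaussianSums.
Context {R : realType}.
Implicit Types (x y : R) (n k : nat).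

Definition gauss x : R := expR (- x ^+ 2).

Lemma gauss_gt0 x : 0 < gauss x. Proof. exact: expR_gt0. Qed.

Lemma gauss_le1 x : gauss x <= 1.
Proof. by rewrite expR_le1 oppr_le0 sqr_ge0. Qed.

Lemma gaussN x : gauss (- x) = gauss x.
Proof. by rewrite /gauss sqrrN. Qed.

Lemma le_gauss x y : 0 <= x -> x <= y -> gauss y <= gauss x.
Proof.
move=> x0 xy; rewrite ler_expR lerN2 lerXn2r ?nnegrE //; exact: le_trans xy.
Qed.

Lemma gauss_le_expR x : gauss x <= expR (1 - x).
Proof. by rewrite ler_expR; nra. Qed.

Lemma continuous_gauss : continuous gauss.
Proof.
move=> x; apply: (@der_continuous _ _ _ (gauss x * - (2%:R * x ^+ 1 * 1))).
exact: (der_expR (derN (derX 2 (der_id _)))).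
Qed.

Lemma primitive_gauss_ex : exists F : R -> R,
  (forall x, is_derive x 1 F (gauss x)) /\ F 0 = 0.
Proof.
have [H dH] := primitive continuous_gauss.
exists (fun x => H x - H 0); split => [x|]; last by rewrite subrr.
by apply: (is_derive_eq (derD (dH x) (der_cst _ _))); rewrite addr0.
Qed.

(** Unnormalised: the factor 2 / sqrt pi is absent. *)
Definition erf : R -> R := sval (cid primitive_gauss_ex).

Lemma der_erf x : is_derive x 1 erf (gauss x).
Proof. by case: (svalP (cid primitive_gauss_ex)). Qed.

Lemma erf0 : erf 0 = 0.
Proof. by case: (svalP (cid primitive_gauss_ex)). Qed.

Lemma erfN x : erf (- x) = - erf x.
Proof.
have d (y : R) : is_derive y 1 (fun y => erf y + erf (- y)) 0.
  apply: (is_derive_eq (derD (der_erf y) (der_comp (der_erf (- y)) (derN (der_id _))))).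
  by rewrite gaussN; ring.
have E a b : a <= b -> `|(erf b + erf (- b)) - (erf a + erf (- a))| <= 0 - 0.
  move=> ab; apply: (@der_abs_le R (fun y => erf y + erf (- y)) (fun=> 0) (fun=> 0) (fun=> 0)) => //.
  - by move=> y _; exact: der_continuous (d y).
  - by move=> y _; exact: cvg_cst.
  - by move=> y _; rewrite normr0.
have H : erf x + erf (- x) = 0.
  have [/E|/ltW/E] := leP 0 x; rewrite !oppr0 !erf0 !addr0 ?add0r normr_le0.
    by rewrite subr0 => /eqP.
  by rewrite oppr_eq0 => /eqP.
by apply/eqP; rewrite -addr_eq0 addrC H.
Qed.

Lemma le_erf x y : x <= y -> erf x <= erf y.
Proof.
move=> xy; have := @der_le R _ _ _ _ x y xy (fun z _ => der_cst z 0) (fun z _ => der_erf z)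
    (fun z _ => der_continuous (der_cst z 0)) (fun z _ => der_continuous (der_erf z)).
by rewrite subrr subr_ge0; apply => z _; exact/ltW/gauss_gt0.
Qed.

Lemma erf_tail x y : x <= y -> erf y - erf x <= expR (1 - x).
Proof.
move=> xy.
have dC (z : R) : is_derive z 1 (fun z : R => - expR (1 - z)) (expR (1 - z)).
  by apply: (is_derive_eq (derN (der_expR (derD (der_cst _ _) (derN (der_id _)))))); ring.
have := @der_le R _ _ _ _ x y xy (fun z _ => der_erf z) (fun z _ => dC z)
    (fun z _ => der_continuous (der_erf z)) (fun z _ => der_continuous (dC z)).
move=> H; apply: le_trans (H _) _; first by move=> z _; exact: gauss_le_expR.
by have := expR_gt0 (1 - y); lra.
Qed.

(** The integral of exp (- x^2) over the whole line, as twice the limit of its odd primitive;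
    classically sqrt pi. *)
Definition gaussint : R := 2 * sup (range erf).

Lemma gaussint_near x : 0 <= gaussint / 2 - erf x <= expR (1 - x).
Proof.
have ub : ubound (range erf) (erf x + expR (1 - x)).
  move=> _ [y _ <-]; have [xy|yx] := leP x y.
    by have := erf_tail xy; lra.
  by have := le_erf (ltW yx); have := expR_gt0 (1 - x); lra.
have ne : range erf !=set0 by exists (erf x), x.
have := ge_sup ne ub => H.
have : erf x <= sup (range erf).
  by apply: ub_le_sup; [by exists (erf x + expR (1 - x)) | by exists x].
by rewrite /gaussint; lra.
Qed.

Lemma gaussint_gt0 : 0 < gaussint.
Proof.
have /andP[+ _] := gaussint_near 1.
suff : 0 < erf 1 by lra.
have := @der_le R _ _ _ _ 0 1 ler01 (fun z _ => der_cst z 0) (fun z _ => der_erf z).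
have [||z zI Ez] := @mvt R erf gauss 0 1 ltr01.
- by move=> z _; exact: der_erf.
- by move=> z _; exact: der_continuous (der_erf z).
move: Ez; rewrite erf0 !subr0 mulr1 => -> _; exact: gauss_gt0.
Qed.

(* Increasing function whose increments bound the variation of [gauss]. *)
Let V x := if x <= 0 then gauss x else 2 - gauss x.

Let V_ge0 x : 0 <= V x <= 2.
Proof.
by rewrite /V; have := gauss_gt0 x; have := gauss_le1 x; case: ifP => _; lra.
Qed.

Let V_var x y : x <= y -> `|gauss x - gauss y| <= V y - V x.
Proof.
move=> xy; rewrite /V; have [y0|y0] := leP y 0; have [x0|x0] := leP x 0.
- have : gauss x <= gauss y.
    by rewrite -(gaussN x) -(gaussN y); apply: le_gauss; lra.
  by rewrite ler_norml => ?; apply/andP; split; lra.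
- by exfalso; lra.
- have := gauss_le1 x; have := gauss_le1 y; rewrite ler_norml => ? ?.
  by apply/andP; split; lra.
- have : gauss y <= gauss x by apply: le_gauss; lra.
  by rewrite ler_norml => ?; apply/andP; split; lra.
Qed.

(** The error of a Riemann sum is at most the step times the total variation, here 2. Uniformity in
    [x] and [n] is what the coordinate-by-coordinate treatment of theta sums relies on. *)
Lemma sum_gauss (a x : R) n : 0 < a ->
  `|a * (\sum_(i < n) gauss (x + i%:R * a)) - (erf (x + n%:R * a) - erf x)| <= 2 * a.
Proof.
move=> a0; suff H : `|a * (\sum_(i < n) gauss (x + i%:R * a)) -
    (erf (x + n%:R * a) - erf x)| <= a * (V (x + n%:R * a) - V x).
  apply: le_trans H _; rewrite mulrC; apply: ler_wpM2r; first exact: ltW.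
  by have := V_ge0 x; have := V_ge0 (x + n%:R * a); lra.
elim: n => [|n IHn]; first by rewrite big_ord0 mul0r addr0 !subrr mulr0 subrr normr0.
rewrite big_ord_recr /=.
have step : x + n.+1%:R * a = x + n%:R * a + a by rewrite -natr1; ring.
set y := x + n%:R * a in step IHn *; rewrite {}step.
have ya : y < y + a by rewrite ltrDl.
have [||z /andP[z1 z2]] := @mvt R erf gauss y (y + a) ya.
- by move=> z _; exact: der_erf.
- by move=> z _; exact: der_continuous (der_erf z).
rewrite [y + a - y]addrAC subrr add0r => Ez.
set S := \sum_(i < n) _ in IHn *.
have -> : a * (S + gauss y) - (erf (y + a) - erf x) =
   (a * S - (erf y - erf x)) + a * (gauss y - gauss z).
  have -> : erf (y + a) = erf y + gauss z * a by rewrite -Ez addrCA subrr addr0.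
  by ring.
apply: le_trans (ler_normD _ _) _.
have -> : a * (V (y + a) - V x) = a * (V y - V x) + a * (V (y + a) - V y) by ring.
apply: lerD => //; rewrite normrM (gtr0_norm a0); apply: ler_wpM2l; first exact: ltW.

apply: le_trans (V_var (ltW z1)) _; rewrite lerD2r -subr_ge0.
by apply: le_trans (normr_ge0 _) (V_var (ltW z2)).
Qed.

End GaussianSums.

(** * Stirling's constant through Wallis integrals *)

Section Stirling.
Context {R : realType}.
Implicit Types (x y : R) (n k M : nat).

Definition stirling_rem n : R := ln (n`!%:R) - (n%:R + 2^-1) * ln n%:R + n%:R.

(** The trapezoidal rule for ln on [n, n + 1], where the slope runs from 1/n to 1/(n + 1). *)
Lemma stirling_rem_step n : (0 < n)%N ->
  `|stirling_rem n.+1 - stirling_rem n| <= n%:R^-1 - n.+1%:R^-1.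
Proof.
move=> n0; have nR : 0 < n%:R :> R by rewrite ltr0n.
have n1R : 0 < n.+1%:R :> R by rewrite ltr0n.
have nn : n%:R <= n.+1%:R :> R by rewrite ler_nat.
have p z : n%:R <= z -> 0 < z :> R by exact: lt_le_trans.
have dl (z : R) : 0 < z -> is_derive z 1 (@ln R) z^-1 by exact: is_derive1_ln.
have dH (z : R) : 0 < z -> is_derive z 1 (fun z => z * ln z - z) (ln z).
  move=> z0; apply: (is_derive_eq (derD (derM (der_id _) (dl z z0)) (derN (der_id _)))).
  by field; rewrite gt_eqF.
have := @trapezoid R (@ln R) _ (fun z => z^-1) n%:R n.+1%:R n%:R^-1 n.+1%:R^-1 nn
  (fun z zI => dH z (p z (proj1 (andP zI))))
  (fun z zI => der_continuous (dl z (p z (proj1 (andP zI)))))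
  (fun z zI => dl z (p z (ltW (proj1 (andP zI))))).
have -> : n.+1%:R - n%:R = 1 :> R by rewrite -natrB // subSnn.
rewrite expr1n !mul1r => /(_ _) H.
have -> : stirling_rem n.+1 - stirling_rem n = (ln n%:R + ln n.+1%:R) / 2 -
    (n.+1%:R * ln n.+1%:R - n.+1%:R - (n%:R * ln n%:R - n%:R)).
  rewrite /stirling_rem factS natrM lnM ?posrE ?ltr0n ?fact_gt0 // -natr1.
  by field.
apply: H => z /andP[z1 z2]; have z0 : 0 < z by exact: p (ltW z1).
by rewrite !lef_pV2 ?posrE // !ltW.
Qed.

(** By the step bound, adding 1/n makes the sequence nonincreasing and subtracting 1/n makes it
    nondecreasing. *)
Lemma stirling_rem_cvg : cvgn stirling_rem.
Proof.
pose e n : R := stirling_rem n.+1 + n.+1%:R^-1.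
pose f n : R := stirling_rem n.+1 - n.+1%:R^-1.
have S n : `|stirling_rem n.+2 - stirling_rem n.+1| <= n.+1%:R^-1 - n.+2%:R^-1.
  exact: stirling_rem_step.
have ne : nonincreasing_seq e.
  apply/nonincreasing_seqP => n; rewrite /e; have := S n; rewrite ler_norml => /andP[].
  by move: (n.+1%:R^-1) (n.+2%:R^-1) => u v; lra.
have nf : nondecreasing_seq f.
  apply/nondecreasing_seqP => n; rewrite /f; have := S n; rewrite ler_norml => /andP[].
  by move: (n.+1%:R^-1) (n.+2%:R^-1) => u v; lra.
have ce : cvgn e.
  apply: nonincreasing_is_cvgn => //; exists (f 0%N) => _ [n _ <-].
  apply: le_trans (nf 0%N n _) _ => //; rewrite /f /e.
  have : 0 < n.+1%:R^-1 :> R by rewrite invr_gt0 ltr0n.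
  by move: (n.+1%:R^-1) => u; lra.
have ci : (fun n => n.+1%:R^-1 : R) @ \oo --> (0 : R) by exact: cvg_harmonic.
have : (fun n => e n - n.+1%:R^-1) @ \oo --> lim (e @ \oo) - 0.
  exact: cvgB.
move=> H; apply/cvg_ex; exists (lim (e @ \oo) - 0).
rewrite -cvg_shiftS; apply: cvg_trans H.
by apply: near_eq_cvg; near=> n; rewrite /e addrK.
Unshelve. all: end_near. Qed.

Definition stirling : R := lim (stirling_rem @ \oo).

Lemma cvg_stirling : stirling_rem @ \oo --> stirling.
Proof. exact: stirling_rem_cvg. Qed.

(* Primitive of [(1 - x ^ 2) ^ M]. *)
Fixpoint wallisP M x : R :=
  if M is M'.+1 then
    (x * (1 - x ^+ 2) ^+ M + 2 * M%:R * wallisP M' x) / (2 * M%:R + 1)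
  else x.

(** The integral of (1 - x^2)^M over [-1, 1], by its recursion. *)
Fixpoint wallis M : R :=
  if M is M'.+1 then 2 * M%:R * wallis M' / (2 * M%:R + 1) else 2.

Lemma wallisP_wallis M : wallisP M 1 - wallisP M (- 1) = wallis M.
Proof.
elim: M => [|M IHM] /=; first by ring.
by rewrite -IHM sqrrN expr1n subrr expr0n /=; ring.
Qed.

Lemma der_wallisP M x : is_derive x 1 (wallisP M) ((1 - x ^+ 2) ^+ M).
Proof.
elim: M x => [|M IHM] x; first by rewrite expr0; exact: der_id.
have d1 : is_derive x 1 (fun y : R => 1 - y ^+ 2) (- (2 * x)).
  by apply: (is_derive_eq (derD (der_cst _ _) (derN (derX 2 (der_id _))))) => /=; rewrite expr1; ring.
change (is_derive x 1 (fun x => (x * (1 - x ^+ 2) ^+ M.+1 +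
   2 * M.+1%:R * wallisP M x) / (2 * M.+1%:R + 1)) ((1 - x ^+ 2) ^+ M.+1)).
apply: (is_derive_eq (derM (derD (derM (der_id _) (derX M.+1 d1))
  (derM (der_cst _ _) (IHM x))) (der_cst _ _))) => /=.
have n0 : 2 * M.+1%:R + 1 != 0 :> R by rewrite -natrM natr1 pnatr_eq0.
rewrite exprS; move: n0; move: (M.+1%:R) ((1 - x ^+ 2) ^+ M) => m u n0.
by field.
Qed.

Lemma wallisE M : wallis M = 2 ^+ (2 * M).+1 * (M`!%:R) ^+ 2 / ((2 * M).+1)`!%:R.
Proof.
elim: M => [|M IHM]; first by rewrite muln0 fact0 expr1n mulr1 divr1 expr1.
have f0 k : k`!%:R != 0 :> R by rewrite pnatr_eq0 -lt0n fact_gt0.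
have E3 : (2 * M.+1).+1`! = ((2 * M).+3 * ((2 * M).+2 * ((2 * M).+1)`!))%N by rewrite mulnS.
move: IHM E3 (f0 (2 * M).+1); move: ((2 * M).+1)`! => F IHM E3 n2.
rewrite -[wallis M.+1]/(2 * M.+1%:R * wallis M / (2 * M.+1%:R + 1)) IHM E3.
rewrite (factS M) mulnS !addSn add0n !exprS !expr0 !natrM.
have -> : (2 * M).+2%:R = 2 * M.+1%:R :> R by rewrite -natrM mulnS.
have -> : (2 * M).+3%:R = 2 * M.+1%:R + 1 :> R by rewrite -natrM mulnS natr1.
have n0 : 2 * M.+1%:R + 1 != 0 :> R by rewrite -natrM natr1 pnatr_eq0.
have n1 : M.+1%:R != 0 :> R by rewrite pnatr_eq0.
move: n0 n1 n2; move: (M.+1%:R) (F%:R) (M`!%:R) (2 ^+ (2 * M)) => a b c d n0 n1 n2.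
by field; rewrite n0 n1 n2.
Qed.

(** In the factorial formula [wallisE] all powers of M and exponentials cancel once factorials are
    written through [stirling_rem]; the limit is therefore [stirling] - (ln 2) / 2. *)
Lemma ln_wallis M : (0 < M)%N ->
  ln (Num.sqrt M%:R * wallis M) = 2^-1 * ln 2 - ln (2 + M%:R^-1) +
    2 * stirling_rem M - stirling_rem (2 * M)%N.
Proof.
move=> M0; have MR : 0 < M%:R :> R by rewrite ltr0n.
have fR k : 0 < k`!%:R :> R by rewrite ltr0n fact_gt0.
have M1R : 0 < (2 * M).+1%:R :> R by rewrite ltr0n.
have p2 : 0 < (2 : R) by [].
have -> : ln (2 + M%:R^-1) = ln (2 * M).+1%:R - ln M%:R :> R.
  by rewrite -ln_div ?posrE //; congr ln; rewrite -[in RHS]natr1 natrM mulrDl mulfK ?mul1r // gt_eqF.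
have sq : ln (Num.sqrt M%:R) = 2^-1 * ln M%:R :> R.
  by rewrite -powR12_sqrt ?ler0n // ln_powR.
rewrite wallisE factS natrM.
have q1 : 0 < 2 ^+ (2 * M).+1 * M`!%:R ^+ 2 :> R by rewrite mulr_gt0 ?exprn_gt0.
have q2 : 0 < (2 * M).+1%:R * (2 * M)`!%:R :> R by rewrite mulr_gt0.
rewrite lnM ?posrE ?sqrtr_gt0 ?divr_gt0 //.
rewrite ln_div ?posrE ?mulr_gt0 ?exprn_gt0 //.
rewrite !lnM ?posrE ?exprn_gt0 // !lnXn //.
rewrite sq /stirling_rem natrM lnM ?posrE // -[_ *+ (2 * M).+1]mulr_natr.
have -> : (2 * M).+1%:R = 2 * M%:R + 1 :> R by rewrite -natrM natr1.
by field.
Qed.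

(** Substituting x / sqrt M turns the integrand into (1 - x^2 / M)^M, to be compared with exp (-
    x^2): from above by 1 - y <= exp (- y), from below on a fixed window. *)
Let scaledP M x := Num.sqrt M%:R * wallisP M (x / Num.sqrt M%:R).

Let der_scaledP M x : (0 < M)%N -> is_derive x 1 (scaledP M) ((1 - x ^+ 2 / M%:R) ^+ M).
Proof.
move=> M0; have s0 : 0 < Num.sqrt M%:R :> R by rewrite sqrtr_gt0 ltr0n.
have d1 := derM (der_id x) (der_cst x (Num.sqrt M%:R)^-1).
have d2 := @der_comp R (fun y => y / Num.sqrt M%:R) (wallisP M) x _ _ (der_wallisP M _) d1.
apply: (is_derive_eq (derM (der_cst x (Num.sqrt M%:R)) d2)).
rewrite exprMn exprVn sqr_sqrtr ?ler0n //.
by field; rewrite gt_eqF.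
Qed.

Let scaledP_wallis M : (0 < M)%N ->
  scaledP M (Num.sqrt M%:R) - scaledP M (- Num.sqrt M%:R) = Num.sqrt M%:R * wallis M.
Proof.
move=> M0; have s0 : Num.sqrt M%:R != 0 :> R by rewrite gt_eqF // sqrtr_gt0 ltr0n.
by rewrite /scaledP mulNr divff // -mulrBr wallisP_wallis.
Qed.

Let sqr_bound x a : - a <= x <= a -> x ^+ 2 <= a ^+ 2.
Proof. by case/andP => ? ?; nra. Qed.

Let scaledP_itv M x : (0 < M)%N -> x ^+ 2 <= M%:R -> 0 <= x ^+ 2 / M%:R <= 1.
Proof.
move=> M0 xM; have MR : 0 < M%:R :> R by rewrite ltr0n.
by rewrite divr_ge0 ?sqr_ge0 ?ler0n //= ler_pdivrMr // mul1r.
Qed.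

Lemma wallis_le_gaussint M : (0 < M)%N -> Num.sqrt M%:R * wallis M <= gaussint.
Proof.
move=> M0; have MR : 0 < M%:R :> R by rewrite ltr0n.
have s0 : - Num.sqrt M%:R <= Num.sqrt M%:R :> R by rewrite ge0_cp ?sqrtr_ge0.
rewrite -scaledP_wallis //.
have := @der_le R _ _ _ _ _ _ s0 (fun z _ => der_scaledP z M0) (fun z _ => der_erf z)
    (fun z _ => der_continuous (der_scaledP z M0)) (fun z _ => der_continuous (der_erf z)).
move=> H; apply: le_trans (H _) _.
  move=> z /andP[z1 z2]; have : z ^+ 2 <= M%:R.
    by rewrite -[leRHS](@sqr_sqrtr _ M%:R) ?ler0n // sqr_bound // !ltW.
  move=> /(scaledP_itv M0)/andP[y0 y1].
  have -> : gauss z = expR (- (z ^+ 2 / M%:R)) ^+ M.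
    by rewrite -expRM_natl mulrN mulrC divfK // gt_eqF.
  rewrite lerXn2r ?nnegrE ?expR_ge0 ?subr_ge0 //.
  exact: expR_ge1Dx.
by rewrite erfN; have /andP[+ _] := gaussint_near (Num.sqrt M%:R : R); lra.
Qed.

Let bernoulli_ineq y n : 0 <= y <= 1 -> 1 - n%:R * y <= (1 - y) ^+ n.
Proof.
move=> /andP[y0 y1]; elim: n => [|n IHn]; first by rewrite mul0r subr0 expr0.
rewrite exprS -natr1; apply: le_trans (_ : (1 - y) * (1 - n%:R * y) <= _); last first.
  by rewrite ler_wpM2l // subr_ge0.
have : 0 <= n%:R * y * y by rewrite !mulr_ge0 ?ler0n.
lra.
Qed.

(** With y = z^2 / M, the bound (1 + y) exp (- y) <= 1 gives (1 - y^2) exp (- y) <= 1 - y, and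
    Bernoulli's inequality gives (1 - y^2)^M >= 1 - M y^2 >= 1 - Y^4 / M. *)
Lemma wallis_ge M (Y : R) : (0 < M)%N -> 0 <= Y -> Y ^+ 2 <= M%:R ->
  2 * erf Y * (1 - Y ^+ 4 / M%:R) <= Num.sqrt M%:R * wallis M.
Proof.
move=> M0 Y0 YM; have MR : 0 < M%:R :> R by rewrite ltr0n.
have Ys : Y <= Num.sqrt M%:R by rewrite -(ger0_norm Y0) -sqrtr_sqr ler_wsqrtr.
have NY : - Y <= Y by rewrite ge0_cp.
have Ns : - Num.sqrt M%:R <= - Y by rewrite lerN2.
have mono x y : - Num.sqrt M%:R <= x -> x <= y -> y <= Num.sqrt M%:R -> scaledP M x <= scaledP M y.
  move=> xl xy yr; rewrite -subr_ge0.
  have := @der_le R _ _ _ _ _ _ xy (fun z _ => der_cst z 0) (fun z _ => der_scaledP z M0)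
    (fun z _ => der_continuous (der_cst z 0)) (fun z _ => der_continuous (der_scaledP z M0)).
  rewrite subrr; apply => z /andP[z1 z2]; apply: exprn_ge0; rewrite subr_ge0.
  have : z ^+ 2 <= M%:R.
    rewrite -[leRHS](@sqr_sqrtr _ M%:R) ?ler0n // sqr_bound //.
    by rewrite (le_trans xl (ltW z1)) (le_trans (ltW z2) yr).
  by move=> /(scaledP_itv M0)/andP[].
rewrite -scaledP_wallis //.
apply: (@le_trans _ _ (scaledP M Y - scaledP M (- Y))); last first.
  by apply: lerB; apply: mono => //; lra.
have d (z : R) : is_derive z 1 (fun z => (1 - Y ^+ 4 / M%:R) * erf z) ((1 - Y ^+ 4 / M%:R) * gauss z).
  by apply: (is_derive_eq (derM (der_cst _ _) (der_erf z))); rewrite mul0r add0r.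
have := @der_le R _ _ _ _ _ _ NY (fun z _ => d z) (fun z _ => der_scaledP z M0)
    (fun z _ => der_continuous (d z)) (fun z _ => der_continuous (der_scaledP z M0)).
rewrite erfN => H; apply: le_trans (H _); first by rewrite le_eqVlt; apply/orP; left; apply/eqP; ring.
move=> z /andP[z1 z2]; have zY : z ^+ 2 <= Y ^+ 2 by rewrite sqr_bound // !ltW.
have zM := le_trans zY YM.
have yI := scaledP_itv M0 zM; have /andP[y0 y1] := yI.
have -> : gauss z = expR (- (z ^+ 2 / M%:R)) ^+ M.
  by rewrite -expRM_natl mulrN mulrC divfK // gt_eqF.
set y := z ^+ 2 / M%:R in yI y0 y1 *.
have yy : 0 <= y ^+ 2 <= 1 by rewrite sqr_ge0 expr_le1.
apply: (@le_trans _ _ ((1 - y ^+ 2) ^+ M * expR (- y) ^+ M)).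
  rewrite ler_wpM2r ?exprn_ge0 ?expR_ge0 //; apply: le_trans (bernoulli_ineq _ yy).
  rewrite lerD2l lerN2.
  have -> : M%:R * y ^+ 2 = (z ^+ 2) ^+ 2 / M%:R by rewrite /y; field; rewrite gt_eqF.
  rewrite ler_pM2r ?invr_gt0 // -exprM -[4%N]/(2 * 2)%N exprM exprM.
  by rewrite lerXn2r ?nnegrE ?sqr_ge0.
rewrite -exprMn lerXn2r ?nnegrE ?mulr_ge0 ?expR_ge0 ?subr_ge0 //; first by case/andP: yy.
have : (1 + y) * expR (- y) <= 1.
  by rewrite -[leRHS](expRxMexpNx_1 y) ler_wpM2r ?expR_ge0 // expR_ge1Dx.
have : 0 <= 1 - y by rewrite subr_ge0.
move: (expR _) => e; nra.
Qed.

Lemma cvg_wallis : (fun M => Num.sqrt M%:R * wallis M) @ \oo --> expR (stirling - 2^-1 * ln 2).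
Proof.
have w0 M : 0 < wallis M.
  by rewrite wallisE divr_gt0 ?mulr_gt0 ?exprn_gt0 ?ltr0n ?fact_gt0.
have c2 : (fun M => stirling_rem (2 * M)%N) @ \oo --> stirling.
  apply: cvg_comp cvg_stirling; apply/cvgnyPge => A; near=> M.
  by rewrite (@leq_trans M) //; [near: M; exact: nbhs_infty_ge | rewrite leq_pmull].
have ci : (fun M => M%:R^-1 : R) @ \oo --> (0 : R) by rewrite -cvg_shiftS; exact: cvg_harmonic.
have cl : (fun M => ln (2 + M%:R^-1 : R)) @ \oo --> ln (2 : R).
  have c2i : (fun M => 2 + M%:R^-1 : R) @ \oo --> (2 : R).
    by rewrite -[X in _ --> X]addr0; apply: cvgD => //; exact: cvg_cst.
  by apply: continuous_cvg => //; apply: continuous_ln.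
have H : (fun M => expR (2^-1 * ln 2 - ln (2 + M%:R^-1) + 2 * stirling_rem M -
    stirling_rem (2 * M)%N)) @ \oo --> expR (stirling - 2^-1 * ln 2).
  apply: continuous_cvg; first exact: continuous_expR.
  have -> : stirling - 2^-1 * ln 2 = 2^-1 * ln 2 - ln 2 + 2 * stirling - stirling by field.
  apply: cvgB => //; apply: cvgD; first by apply: cvgB => //; exact: cvg_cst.
  by apply: cvgM; [exact: cvg_cst | exact: cvg_stirling].
apply: cvg_trans H; apply: near_eq_cvg; near=> M.
have M0 : (0 < M)%N by near: M; exact: nbhs_infty_gt.
by rewrite -ln_wallis // lnK // posrE mulr_gt0 // sqrtr_gt0 ltr0n.
Unshelve. all: end_near. Qed.

(** Both sides are the limit of sqrt M times the M-th Wallis integral. This is what lets Stirling's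
    constant cancel against the theta sums. *)
Lemma stirling_gauss : stirling = 2^-1 * ln 2 + ln gaussint.
Proof.
suff E : expR (stirling - 2^-1 * ln 2) = gaussint.
  by rewrite -E expRK; ring.
apply/eqP; rewrite eq_le; apply/andP; split.
  apply: (cvgr_to_le cvg_wallis); near=> M.
  by apply: wallis_le_gaussint; near: M; exact: nbhs_infty_gt.
(* The window [Y] stays fixed while M tends to infinity; only afterwards does [Y] grow. *)
have H Y : 0 <= Y -> 2 * erf Y <= expR (stirling - 2^-1 * ln 2).
  move=> Y0.
  have ci : (fun M => M%:R^-1 : R) @ \oo --> (0 : R) by rewrite -cvg_shiftS; exact: cvg_harmonic.
  have c1 : (fun M => 2 * erf Y * (1 - Y ^+ 4 / M%:R) : R) @ \oo --> 2 * erf Y * (1 - Y ^+ 4 * 0).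
    apply: cvgM; first exact: cvg_cst.
    by apply: cvgB; [exact: cvg_cst | apply: cvgM => //; exact: cvg_cst].
  rewrite mulr0 subr0 mulr1 in c1.
  apply: ler_cvg_to c1 cvg_wallis _; near=> M; apply: wallis_ge => //.
    by near: M; exact: nbhs_infty_gt.
  by near: M; exact: nbhs_infty_ger.
have c0 : (fun n => gaussint - 2 * expR (1 - n%:R) : R) @ \oo --> gaussint - 2 * (expR 1 * 0).
  apply: cvgB; first exact: cvg_cst.
  apply: cvgM; first exact: cvg_cst.
  under eq_fun do rewrite expRD.
  by apply: cvgM; [exact: cvg_cst | exact: cvgn_expR].
rewrite !mulr0 subr0 in c0.
apply: (cvgr_to_le c0); near=> n.
apply: le_trans (H n%:R (ler0n _ _)).
by have /andP[_] := gaussint_near (n%:R : R); lra.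
Unshelve. all: end_near. Qed.

End Stirling.

(** * Truncated partition products *)

Section PartitionPolynomials.
Implicit Types (p q : {poly int}) (a b : fps) (n m k N : nat).

(** Both the parts and their multiplicities stop at n, matching the encoding in
    [partition_number]. *)
Definition pgen n : {poly int} := \prod_(1 <= k < n.+1) \sum_(j < n.+1) 'X^(k * j).

Lemma partition_number_coef n : (partition_number n)%:Z = (pgen n)`_n.
Proof.
rewrite /pgen big_add1 /= big_mkord bigA_distr_bigA /= coef_sum.
rewrite (eq_bigr (fun f : {ffun 'I_n -> 'I_n.+1} => ((\sum_(i < n) f i * i.+1)%N == n)%:R)).
  rewrite /partition_number -sum1_card big_mkcond /= -natz natr_sum.
  by apply: eq_bigr => f _; rewrite inE; case: eqP.
move=> f _; rewrite -(big_morph _ (exprD ('X : {poly int})) (expr0 _)) coefXn eq_sym.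
by congr (_ == _)%:R; apply: eq_bigr => i _; rewrite mulnC.
Qed.

Definition eqtrunc n p q := forall k, (k <= n)%N -> p`_k = q`_k.

Lemma eqtruncM n p p' q q' : eqtrunc n p p' -> eqtrunc n q q' -> eqtrunc n (p * q) (p' * q').
Proof.
move=> pp qq k kn; rewrite !coefM; apply: eq_bigr => i _.
rewrite pp ?qq //; first by rewrite (leq_trans _ kn) // leq_subr.
by rewrite (leq_trans _ kn) // -ltnS.
Qed.

Lemma eqtruncX n p p' N : eqtrunc n p p' -> eqtrunc n (p ^+ N) (p' ^+ N).
Proof. by move=> pp; elim: N => [//|N IHN]; rewrite !exprS; exact: eqtruncM. Qed.

Lemma eqtrunc_sym n p q : eqtrunc n p q -> eqtrunc n q p.
Proof. by move=> pq k kn; rewrite pq. Qed.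

Lemma eqtrunc_oneBXn n k : (n < k)%N -> eqtrunc n (1 - 'X^k) 1.
Proof.
move=> nk j jn; rewrite coefB coefXn [j == k]ltn_eqF ?subr0 //.
exact: leq_ltn_trans nk.
Qed.

Definition qpoch_poly n : {poly int} := \prod_(1 <= i < n.+1) (1 - 'X^i).

Lemma qpochhammer_poly n k : (k <= n)%N -> qpochhammer k = (qpoch_poly n)`_k.
Proof.
move=> kn; rewrite -(subnKC kn); elim: (n - k)%N => [|j IHj]; first by rewrite addn0.
rewrite addnS /qpoch_poly big_nat_recr //= IHj -/(qpoch_poly _).
have := @eqtruncM k _ _ _ _ (fun _ _ => erefl) (@eqtrunc_oneBXn k (k + j).+1 _).
by rewrite ltnS leq_addr => /(_ (qpoch_poly (k + j)) isT k (leqnn _)) ->; rewrite mulr1.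
Qed.

(** Finite geometric series. The leftover factors are invisible up to degree n; evaluated on a
    circle they become the correction [trunc]. *)
Lemma pgenM_qpoch n : pgen n * qpoch_poly n = \prod_(1 <= k < n.+1) (1 - 'X^(k * n.+1)).
Proof.
rewrite -big_split /=; apply: eq_bigr => k _.
rewrite mulrC exprM -[X in _ = X - _](expr1n _ n.+1) subrXX; congr (_ * _).
by apply: eq_bigr => i _; rewrite expr1n mul1r exprM.
Qed.

Lemma eqtrunc_pgenM n : eqtrunc n (pgen n * qpoch_poly n) 1.
Proof.
rewrite pgenM_qpoch big_add1 /= big_mkord.
apply: (big_ind (fun p => eqtrunc n p 1)) => [//|p q pn qn|i _].
  by rewrite -[1]mulr1; exact: eqtruncM.
by apply: eqtrunc_oneBXn; rewrite mulSn leq_addr.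
Qed.

Lemma fps_mul_eqtrunc n a b p q : (forall k, (k <= n)%N -> a k = p`_k) ->
  (forall k, (k <= n)%N -> b k = q`_k) -> forall k, (k <= n)%N -> fps_mul a b k = (p * q)`_k.
Proof.
move=> pp qq k kn; rewrite coefM; apply: eq_bigr => i _.
rewrite pp ?qq //; first by rewrite (leq_trans _ kn) // leq_subr.
by rewrite (leq_trans _ kn) // -ltnS.
Qed.

Lemma fps_exp_qpochhammer N n k : (k <= n)%N ->
  fps_exp qpochhammer N k = (qpoch_poly n ^+ N)`_k.
Proof.
elim: N k => [|N IHN] k kn; first by rewrite expr0 coef1.
rewrite exprS; apply: (fps_mul_eqtrunc _ _ kn) => j jn; last exact: IHN.
exact: qpochhammer_poly.
Qed.

(** Uniqueness of the inverse modulo 'X^n.+1: both sides invert [qpoch_poly n ^+ N]. *)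
Lemma fps_inv_qpochhammer N n k : (k <= n)%N ->
  fps_inv (fps_exp qpochhammer N) k = (pgen n ^+ N)`_k.
Proof.
set I := fps_inv _ => kn; pose PI : {poly int} := \poly_(i < n.+1) I i.
have PIE j : (j <= n)%N -> I j = PI`_j by move=> jn; rewrite coef_poly ltnS jn.
rewrite PIE //.
have E1 : eqtrunc n (qpoch_poly n ^+ N * PI) 1.
  move=> j jn; rewrite coef1 -(fps_mul_eqtrunc (fps_exp_qpochhammer N (n := n)) PIE) //.
  rewrite fps_mul_inv // (@fps_exp_qpochhammer _ 0) //.
  by rewrite /qpoch_poly big_nil expr1n coef1.
have E2 : eqtrunc n (pgen n ^+ N * qpoch_poly n ^+ N) 1.
  by rewrite -exprMn -(expr1n _ N); apply: eqtruncX; exact: eqtrunc_pgenM.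
have E3 : eqtrunc n (1 * PI) (pgen n ^+ N * qpoch_poly n ^+ N * PI).
  by apply: eqtruncM => //; exact: eqtrunc_sym.
have E4 : eqtrunc n (pgen n ^+ N * (qpoch_poly n ^+ N * PI)) (pgen n ^+ N * 1).
  exact: eqtruncM.
by rewrite -[PI]mul1r E3 // -mulrA E4 // mulr1.
Qed.

Lemma cphi_coef N n p : (forall k, (k <= n)%N -> f_theta N.-1 k = p`_k) ->
  cphi N n = (p * pgen n ^+ N)`_n.
Proof.
move=> fp; apply: (@fps_mul_eqtrunc n) => // k kn; exact: fps_inv_qpochhammer.
Qed.

End PartitionPolynomials.

(** * The theta series as a finite sum over a box *)

Section ThetaBox.
Implicit Types (s : seq int) (m n L : nat).

Definition zrange (M : nat) : seq int := [seq i%:Z - M%:Z | i <- iota 0 (2 * M).+1].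

(* Vectors of [Z ^ m]; the last coordinate is the head of the list. The ranges double at
   each step so that shifting a coordinate by the sum of the previous ones keeps a window of
   size [L] inside its range. *)
Fixpoint box L m : seq (seq int) :=
  if m is m'.+1 then [seq j :: s | s <- box L m', j <- zrange (L * 2 ^ m')] else [:: [::]].

Definition sumz s : int := \sum_(x <- s) x.
Definition sumsq s : int := \sum_(x <- s) x ^+ 2.

(** By [theta_double] the sum is even, so the division is exact; the absolute value only serves to
    obtain a natural exponent. *)
Definition thetas s : nat := `|((sumsq s + sumz s ^+ 2) %/ 2)%Z|%N.

Definition row_of_seq m s : 'rV[int]_m := \row_i s`_i.

Definition theta_poly L m : {poly int} := \sum_(s <- box L m) 'X^(thetas s).

Lemma mem_zrange M (x : int) : (x \in zrange M) = (`|x| <= M%:Z).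
Proof.
apply/mapP/idP => [ [k] |xM]; first by rewrite mem_iota add0n => kM ->; lia.
by exists (absz (x + M%:Z)); [rewrite mem_iota|]; lia.
Qed.

Lemma zrange_uniq M : uniq (zrange M).
Proof. by rewrite map_inj_uniq ?iota_uniq // => i j; lia. Qed.

Lemma boxS L m : box L m.+1 = [seq j :: s | s <- box L m, j <- zrange (L * 2 ^ m)].
Proof. by []. Qed.

Lemma box_size L m s : s \in box L m -> size s = m.
Proof.
elim: m s => [|m IHm] s; first by rewrite inE => /eqP ->.
by rewrite boxS => /allpairsP[ [s' j] /= [/IHm <- _ ->] ].
Qed.

Lemma box_uniq L m : uniq (box L m).
Proof.
elim: m => [//|m IHm]; rewrite boxS; apply: allpairs_uniq => //; first exact: zrange_uniq.
by move=> [s i] [s' i'] _ _ /= [-> ->].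
Qed.

Lemma mem_box L m s : size s = m -> all (fun x : int => `|x| <= L%:Z) s -> s \in box L m.
Proof.
elim: m s => [|m IHm] [|x s] // [sm] /andP[xL sL].
rewrite boxS; apply/allpairsP; exists (s, x); split => //=; first exact: IHm.
rewrite mem_zrange; apply: le_trans xL _; rewrite lez_nat leq_pmulr // expn_gt0 //.
Qed.

Lemma thetasE m s : size s = m -> (thetas s)%:Z = theta (row_of_seq m s).
Proof.
move=> sm; have := theta_double (row_of_seq m s).
have -> : \sum_(i < m) row_of_seq m s 0 i ^+ 2 = sumsq s.
  by rewrite /sumsq -sm (big_nth 0) big_mkord; apply: eq_bigr => i _; rewrite mxE.
have -> : \sum_(i < m) row_of_seq m s 0 i = sumz s.
  by rewrite /sumz -sm (big_nth 0) big_mkord; apply: eq_bigr => i _; rewrite mxE.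
have th0 : 0 <= theta (row_of_seq m s) *+ 2.
  rewrite theta_double addr_ge0 ?sqr_ge0 //.
  by apply: sumr_ge0 => i _; exact: sqr_ge0.
rewrite /thetas => <-; rewrite -[theta _ *+ 2]mulr_natr mulzK //.
by rewrite gez0_abs // -(@pmulrn_lge0 _ _ 2).
Qed.

Lemma theta_coord_le m (x : 'rV[int]_m) n i : theta x = n%:Z -> `|x 0 i| <= (2 * n)%:Z.
Proof.
move=> tx; have : x 0 i ^+ 2 <= (2 * n)%:Z.
  have := theta_double x; rewrite tx (bigD1 i) //=.
  have : 0 <= \sum_(j < m | j != i) x 0 j ^+ 2.
    by apply: sumr_ge0 => j _; exact: sqr_ge0.
  have := sqr_ge0 (\sum_(j < m) x 0 j).
  move: (\sum_(j < m) x 0 j) (\sum_(j < m | j != i) _) (x 0 i ^+ 2) => u v w.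
  by move: (u ^+ 2) => t; rewrite mulr2n PoszM; lia.
by rewrite expr2; nia.
Qed.

(** A vector with theta value n has coordinates at most 2 n in absolute value ([theta_coord_le]), so
    the box contains the whole fibre. *)
Lemma theta_poly_coef L m n : (2 * n <= L)%N -> f_theta m n = (theta_poly L m)`_n.
Proof.
move=> nL; rewrite /theta_poly coef_sum.
pose l := [seq row_of_seq m s | s <- [seq s <- box L m | thetas s == n] ].
have inj : {in box L m &, injective (row_of_seq m)}.
  move=> s s' /box_size sm /box_size sm' /rowP E.
  apply: (@eq_from_nth _ 0) => [|i]; first by rewrite sm sm'.
  by rewrite sm => im; have := E (Ordinal im); rewrite !mxE.
have ul : uniq l.
  rewrite map_inj_in_uniq ?filter_uniq ?box_uniq // => s s'.
  by rewrite !mem_filter => /andP[_ sb] /andP[_ s'b]; exact: inj.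
have El : [set x : 'rV[int]_m | theta x = n%:Z] = [set` [fset x in l]%fset ].
  apply/seteqP; split => x /=; rewrite in_fset /=.
    move=> tx; pose s := [seq x 0 i | i <- enum 'I_m].
    have sz : size s = m by rewrite size_map size_enum_ord.
    have xE : x = row_of_seq m s.
      apply/rowP => i; rewrite mxE (nth_map i) ?size_enum_ord //.
      by rewrite nth_ord_enum.
    apply/mapP; exists s => //; rewrite mem_filter; apply/andP; split.
      by rewrite -eqz_nat (thetasE sz) -xE tx.
    apply: mem_box => //; apply/allP => _ /mapP[i _ ->].
    apply: le_trans (theta_coord_le i tx) _; rewrite lez_nat //.
  case/mapP => s; rewrite mem_filter => /andP[/eqP sn /box_size sz] ->.
  by rewrite -(thetasE sz) sn.
rewrite /f_theta El set_fsetK card_fseq undup_id // size_map size_filter.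
rewrite -sum1_count big_mkcond /= -natz natr_sum; apply: eq_bigr => s _.
by rewrite coefXn eq_sym; case: eqP.
Qed.

End ThetaBox.

(** * Asymptotics of theta sums near q = 1 *)

Section ThetaAsymptotics.
Context {R : realType}.
Implicit Types (t lam c : R) (s : seq int) (m n L M j : nat).

(** The parameter [lam] makes the family stable under summing out a coordinate: [lam] becomes lam /
    (1 + lam), so 1/j becomes 1/(j + 1). The theta form itself is [lam = 1]. *)
Definition thsum t lam L m : R :=
  \sum_(s <- box L m) expR (- (t / 2 * ((sumsq s)%:~R + lam * (sumz s)%:~R ^+ 2))).

Lemma thsum_gt0 t lam L m : 0 < thsum t lam L m.
Proof.
have : [::] \in box L m \/ exists s, s \in box L m.
  by right; exists (nseq m 0); apply: mem_box; rewrite ?size_nseq // all_nseq normr0 orbT.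
move=> H; have [s sb] : exists s, s \in box L m by case: H => // ?; exists [::].
rewrite /thsum (big_rem s) //= ltr_pwDl ?expR_gt0 //.
by apply: sumr_ge0 => i _; exact: expR_ge0.
Qed.

Lemma box_sumz L m s : s \in box L m -> `|sumz s| <= (L * (2 ^ m - 1))%:Z.
Proof.
elim: m s => [|m IHm] s; first by rewrite inE => /eqP ->; rewrite /sumz big_nil normr0.
rewrite boxS => /allpairsP[ [s' k] /= [/IHm sb] ]; rewrite mem_zrange => kM ->.
rewrite /sumz big_cons -/(sumz s'); apply: le_trans (ler_normD _ _) _.
apply: le_trans (lerD kM sb) _; rewrite -PoszD lez_nat expnS.
have : (0 < 2 ^ m)%N by rewrite expn_gt0.
by nia.
Qed.

(** The shift [c] must leave a window of length [L] on both sides of the centre, so that the missing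
    Gaussian tails start beyond a L. *)
Lemma sum_zrange_gauss M L c (a : R) : 0 < a -> `|c| <= M%:R - L%:R ->
  gaussint - 2 * a - 2 * expR (1 - a * L%:R) <=
    a * (\sum_(k <- zrange M) gauss (a * (k%:~R + c))) <= gaussint + 2 * a.
Proof.
move=> a0; rewrite ler_norml => /andP[c1 c2].
have -> : \sum_(k <- zrange M) gauss (a * (k%:~R + c)) =
    \sum_(i < (2 * M).+1) gauss (a * (c - M%:R) + i%:R * a).
  rewrite big_map -[X in iota _ X]subn0 -/(index_iota _ _) big_mkord.
  by apply: eq_bigr => i _; congr gauss; rewrite intrB !pmulrn; ring.
have := sum_gauss (a * (c - M%:R)) (2 * M).+1 a0.
have -> : a * (c - M%:R) + (2 * M).+1%:R * a = a * (c + M%:R + 1).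
  by rewrite -natr1 natrM; ring.
rewrite ler_norml => /andP[H1 H2].
have E1 : erf (a * L%:R) <= erf (a * (c + M%:R + 1)).
  by apply: le_erf; rewrite ler_pM2l //; lra.
have E2 : erf (a * (c - M%:R)) <= - erf (a * L%:R).
  by rewrite -erfN -mulrN; apply: le_erf; rewrite ler_pM2l //; lra.
have /andP[G1 G2] := gaussint_near (a * L%:R).
have /andP[G3 G4] := gaussint_near (a * (c + M%:R + 1)).
have /andP[G5 G6] := gaussint_near (- (a * (c - M%:R))).
rewrite erfN in G5; apply/andP; split; lra.
Qed.

(** Completing the square in the last coordinate: k^2 + lam (k + z)^2 = (1 + lam) (k + lam z / (1 +
    lam))^2 + lam z^2 / (1 + lam), with z the sum of the others. *)
Lemma thsumS t lam a L m : 0 < t -> 0 <= lam -> a ^+ 2 = t * (1 + lam) / 2 ->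
  thsum t lam L m.+1 = \sum_(s <- box L m)
     expR (- (t / 2 * ((sumsq s)%:~R + lam / (1 + lam) * (sumz s)%:~R ^+ 2))) *
     \sum_(k <- zrange (L * 2 ^ m)) gauss (a * (k%:~R + lam / (1 + lam) * (sumz s)%:~R)).
Proof.
move=> t0 l0 aE; rewrite /thsum boxS big_allpairs_dep.
apply: eq_bigr => s _; rewrite mulr_sumr; apply: eq_bigr => k _.
have l1 : 1 + lam != 0 by rewrite gt_eqF // ltr_pwDl.
rewrite -expRD; congr expR.
rewrite exprMn aE /sumsq /sumz !big_cons -/(sumsq s) -/(sumz s) !intrD rmorphXn /=.
by field.
Qed.

Lemma thsumS_bounds t lam a L m : 0 < t -> 0 <= lam -> 0 < a -> a ^+ 2 = t * (1 + lam) / 2 ->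
  (gaussint - 2 * a - 2 * expR (1 - a * L%:R)) * thsum t (lam / (1 + lam)) L m
    <= a * thsum t lam L m.+1 <= (gaussint + 2 * a) * thsum t (lam / (1 + lam)) L m.
Proof.
move=> t0 l0 a0 aE; rewrite (thsumS _ _ t0 l0 aE) /thsum !mulr_sumr.
have H s : s \in box L m -> `|lam / (1 + lam) * (sumz s)%:~R| <= (L * 2 ^ m)%:R - L%:R.
  move=> /box_sumz sb; rewrite normrM.
  have l1 : `|lam / (1 + lam)| <= 1.
    rewrite ger0_norm ?divr_ge0 ?addr_ge0 //.
    by rewrite ler_pdivrMr ?mul1r ?ltr_pwDl // lerDr.
  apply: (@le_trans _ _ `|(sumz s)%:~R|); first by rewrite ler_piMl.
  rewrite -natrB ?leq_pmulr ?expn_gt0 // -intr_norm -[in leRHS]mulrz_nat ler_int.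
  by apply: le_trans sb _; rewrite natz lez_nat mulnBr muln1.
rewrite !big_seq; apply/andP; split; apply: ler_sum => s sb;
  have /andP[S1 S2] := sum_zrange_gauss a0 (H s sb).
  by rewrite [leLHS]mulrC [leRHS]mulrCA ler_wpM2l ?expR_ge0.
by rewrite [leRHS]mulrC [leLHS]mulrCA ler_wpM2l ?expR_ge0.
Qed.

Lemma cvgny_mulr (f : nat -> R) (M : R) : 0 < M -> f @ \oo --> +oo ->
  (fun n => f n * M) @ \oo --> +oo.
Proof.
move=> M0 cf; apply: (cvg_comp f (fun x => x * M) cf).
by apply: gt0_cvgMly => //; exact: cvg_id.
Qed.

Lemma sqrt_divM (x y : R) : 0 <= x -> 0 <= y -> Num.sqrt (x / y) = Num.sqrt x / Num.sqrt y.
Proof. by move=> x0 y0; rewrite sqrtrM // sqrtrV. Qed.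

(** Summing out one coordinate gives the factor sqrt 2 [gaussint] sqrt (j / (j + 1)), and the ratios
    telescope. For j = 1 and m = N - 1 the square root is 1 / sqrt N, which reflects the determinant
    N of the form. *)
Lemma thsum_cvg (t : nat -> R) (L : nat -> nat) m j :
  (forall n, 0 < t n) -> t @ \oo --> (0 : R) ->
  (fun n => Num.sqrt (t n) * (L n)%:R) @ \oo --> +oo -> (0 < j)%N ->
  (fun n => Num.sqrt (t n) ^+ m * thsum (t n) j%:R^-1 (L n) m) @ \oo -->
    ((Num.sqrt 2 * gaussint) ^+ m * Num.sqrt (j%:R / (j + m)%:R) : R).
Proof.
move=> t0 ct cL; elim: m j => [|m IHm] j j0.
  have jR : j%:R != 0 :> R by rewrite pnatr_eq0 -lt0n.
  rewrite addn0 expr0 mul1r divff // sqrtr1.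
  apply: (@cvg_trans _ ((fun=> 1 : R) @ \oo)); last exact: cvg_cst.
  apply: near_eq_cvg; near=> n.
  rewrite expr0 mul1r /thsum big_seq1 /sumsq /sumz !big_nil expr0n /= mulr0 addr0 mulr0.
  by rewrite oppr0 expR0.
have jR : 0 < j%:R :> R by rewrite ltr0n.
have j1R : 0 < j.+1%:R :> R by rewrite ltr0n.
pose lam : R := j%:R^-1; have l0 : 0 <= lam by rewrite invr_ge0 ltW.
have l1 : lam / (1 + lam) = j.+1%:R^-1.
  by rewrite /lam -natr1; field; rewrite natr1 !gt_eqF.
pose b : R := Num.sqrt ((1 + lam) / 2).
have b0 : 0 < b by rewrite sqrtr_gt0 divr_gt0 ?ltr_pwDl.
pose a n : R := Num.sqrt (t n) * b.
have a0 n : 0 < a n by apply: mulr_gt0 => //; rewrite sqrtr_gt0.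
have aE n : a n ^+ 2 = t n * (1 + lam) / 2.
  by rewrite exprMn !sqr_sqrtr ?(ltW (t0 n)) ?divr_ge0 ?addr_ge0 // mulrA.
have cs : (fun n => Num.sqrt (t n)) @ \oo --> (0 : R).
  by rewrite -[X in _ --> X]sqrtr0; apply: continuous_cvg => //; exact: sqrt_continuous.
have ca : a @ \oo --> (0 : R).
  by rewrite -[X in _ --> X](mul0r b); apply: cvgM => //; exact: cvg_cst.
have ce : (fun n => expR (1 - a n * (L n)%:R)) @ \oo --> (0 : R).
  have ce' : (fun n => expR 1 * expR (- (a n * (L n)%:R))) @ \oo --> (expR 1 * 0 : R).
    apply: cvgM; first exact: cvg_cst.
    apply: (cvg_comp (fun n => a n * (L n)%:R) (fun x : R => expR (- x))); last exact: cvgr_expR.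
    have -> : (fun n => a n * (L n)%:R) = (fun n => Num.sqrt (t n) * (L n)%:R * b).
      by apply/funext => n; rewrite /a mulrAC.
    exact: cvgny_mulr.
  rewrite mulr0 in ce'; apply: cvg_trans ce'; apply: near_eq_cvg; near=> n.
  by rewrite expRD.
have -> : (Num.sqrt 2 * gaussint) ^+ m.+1 * Num.sqrt (j%:R / (j + m.+1)%:R) =
  gaussint / b * ((Num.sqrt 2 * gaussint) ^+ m * Num.sqrt (j.+1%:R / (j.+1 + m)%:R)) :> R.
  have jm : 0 < (j.+1 + m)%:R :> R by rewrite ltr0n.
  have bE : b = Num.sqrt (j.+1%:R / j%:R / 2).
    by rewrite /b; congr Num.sqrt; rewrite /lam -natr1; field; rewrite gt_eqF.
  rewrite addnS -addSn bE !sqrt_divM ?divr_ge0 ?ler0n // exprS.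
  have nz (x : R) : 0 < x -> Num.sqrt x != 0 by move=> x0; rewrite gt_eqF // sqrtr_gt0.
  by field; rewrite !nz.
have {}IHm := IHm j.+1 isT.
have lowc : (fun n => (gaussint - 2 * a n - 2 * expR (1 - a n * (L n)%:R)) / b *
    (Num.sqrt (t n) ^+ m * thsum (t n) j.+1%:R^-1 (L n) m)) @ \oo -->
   (gaussint / b * ((Num.sqrt 2 * gaussint) ^+ m * Num.sqrt (j.+1%:R / (j.+1 + m)%:R)) : R).
  apply: cvgM => //; apply: cvgM; last exact: cvg_cst.
  rewrite -[X in _ --> X](_ : gaussint - 2 * 0 - 2 * 0 = _); last by ring.
  by apply: cvgB; [apply: cvgB|]; rewrite ?mulr0; try exact: cvg_cst;
     rewrite -[X in _ --> X](mulr0 2); apply: cvgM => //; exact: cvg_cst.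
have upc : (fun n => (gaussint + 2 * a n) / b *
    (Num.sqrt (t n) ^+ m * thsum (t n) j.+1%:R^-1 (L n) m)) @ \oo -->
   (gaussint / b * ((Num.sqrt 2 * gaussint) ^+ m * Num.sqrt (j.+1%:R / (j.+1 + m)%:R)) : R).
  apply: cvgM => //; apply: cvgM; last exact: cvg_cst.
  rewrite -[X in _ --> X](_ : gaussint + 2 * 0 = _); last by ring.
  by apply: cvgD; [exact: cvg_cst | apply: cvgM => //; exact: cvg_cst].
apply: squeeze_cvgr lowc upc; near=> n.
have := thsumS_bounds (L n) m (t0 n) l0 (a0 n) (aE n); rewrite l1.
set X := thsum _ _ _ m; set Y := thsum _ _ _ m.+1.
have q0 : 0 <= Num.sqrt (t n) ^+ m / b by rewrite divr_ge0 ?exprn_ge0 ?sqrtr_ge0 // ltW.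
have -> : Num.sqrt (t n) ^+ m.+1 * Y = Num.sqrt (t n) ^+ m / b * (a n * Y).
  by rewrite /a exprS; field; rewrite gt_eqF.
case/andP => B1 B2; apply/andP; split.
  apply: le_trans (ler_wpM2l q0 B1); rewrite le_eqVlt; apply/orP; left; apply/eqP; ring.
apply: le_trans (ler_wpM2l q0 B2) _; rewrite le_eqVlt; apply/orP; left; apply/eqP; ring.
Unshelve. all: end_near. Qed.

Lemma thetas_double s : (thetas s)%:R * 2 = (sumsq s)%:~R + (sumz s)%:~R ^+ 2 :> R.
Proof.
have := theta_double (row_of_seq (size s) s); rewrite -(thetasE (erefl _)).
have -> : \sum_(i < size s) row_of_seq (size s) s 0 i ^+ 2 = sumsq s.
  by rewrite /sumsq (big_nth 0) big_mkord; apply: eq_bigr => i _; rewrite mxE.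
have -> : \sum_(i < size s) row_of_seq (size s) s 0 i = sumz s.
  by rewrite /sumz (big_nth 0) big_mkord; apply: eq_bigr => i _; rewrite mxE.
move=> E; have -> : (sumz s)%:~R ^+ 2 = (sumz s ^+ 2)%:~R :> R by rewrite rmorphXn.
by rewrite -intrD -E mulr2n intrD; ring.
Qed.

Lemma expR_thetas t s :
  expR (- t) ^+ thetas s = expR (- (t / 2 * ((sumsq s)%:~R + 1 * (sumz s)%:~R ^+ 2))).
Proof. by rewrite mul1r -thetas_double -expRM_natl; congr expR; field. Qed.

Lemma theta_poly_horner t L m : (map_poly intr (theta_poly L m)).[expR (- t)] = thsum t 1 L m.
Proof.
rewrite /theta_poly rmorph_sum horner_sum; apply: eq_bigr => s _.
by rewrite /= map_polyXn hornerXn expR_thetas.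
Qed.

(* [x e^-x <= 2 e^(-x/2)], applied to each term with [x = t * thetas s]. *)
Lemma theta_moment_le t L m : 0 < t ->
  t * (\sum_(s <- box L m) (thetas s)%:R * expR (- t) ^+ thetas s) <= 2 * thsum (t / 2) 1 L m.
Proof.
move=> t0; rewrite /thsum !mulr_sumr; apply: ler_sum => s _.
rewrite -expR_thetas -!expRM_natl; set k := (thetas s)%:R : R.
have -> : expR (k * - t) = expR (- (k * t / 2)) * expR (k * - (t / 2)).
  by rewrite -expRD; congr expR; field.
rewrite mulrA mulrA ler_wpM2r ?expR_ge0 // expRN ler_pdivrMr ?expR_gt0 //.
by have := expR_ge1Dx (k * t / 2); lra.
Qed.

(** The theta variable has mean O(1 / t), because by [thsum_cvg] the sums at t / 2 and at t have the
    same order. *)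
Lemma theta_moment (t : nat -> R) (L : nat -> nat) m :
  (forall n, 0 < t n) -> t @ \oo --> (0 : R) ->
  (fun n => Num.sqrt (t n) * (L n)%:R) @ \oo --> +oo ->
  exists C : R, \forall n \near \oo,
    t n * (\sum_(s <- box (L n) m) (thetas s)%:R * expR (- t n) ^+ thetas s) <=
      C * thsum (t n) 1 (L n) m.
Proof.
move=> t0 ct cL.
have t20 n : 0 < t n / 2 by rewrite divr_gt0.
have ct2 : (fun n => t n / 2) @ \oo --> (0 : R).
  by rewrite -[X in _ --> X](mul0r 2^-1); apply: cvgM => //; exact: cvg_cst.
have s2 : 0 < Num.sqrt (2^-1) :> R by rewrite sqrtr_gt0 invr_gt0.
have cL2 : (fun n => Num.sqrt (t n / 2) * (L n)%:R) @ \oo --> +oo.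
  have -> : (fun n => Num.sqrt (t n / 2) * (L n)%:R) = (fun n => Num.sqrt (t n) * (L n)%:R * Num.sqrt (2^-1)).
    by apply/funext => n; rewrite sqrtrM ?(ltW (t0 n)) // mulrAC.
  exact: cvgny_mulr.
have c1 := @thsum_cvg _ _ m 1 t0 ct cL isT; have c2 := @thsum_cvg _ _ m 1 t20 ct2 cL2 isT.
set l := (X in _ --> X) in c1; rewrite -/l in c2.
have l0 : 0 < l.
  apply: mulr_gt0; last by rewrite sqrtr_gt0 divr_gt0 ?ltr0n.
  by apply: exprn_gt0; apply: mulr_gt0; [rewrite sqrtr_gt0 | exact: gaussint_gt0].
move: l c1 c2 l0 => l c1 c2 l0.
have q0 : 0 < Num.sqrt (2^-1) ^+ m :> R by rewrite exprn_gt0.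
(* The 8 is the 2 of [theta_moment_le] times the 4 lost by comparing the two sums with l / 2 and 2
   l. *)
exists (8 / Num.sqrt (2^-1) ^+ m); near=> n.
apply: le_trans (theta_moment_le _ _ (t0 n)) _.
have B1 : l / 2 <= Num.sqrt (t n) ^+ m * thsum (t n) 1%:R^-1 (L n) m.
  by near: n; apply: (cvgr_ge _ c1); lra.
have B2 : Num.sqrt (t n / 2) ^+ m * thsum (t n / 2) 1%:R^-1 (L n) m <= 2 * l.
  by near: n; apply: (cvgr_le _ c2); lra.
move: B1 B2; rewrite invr1 sqrtrM ?(ltW (t0 n)) // exprMn.
have st : 0 < Num.sqrt (t n) ^+ m by rewrite exprn_gt0 // sqrtr_gt0.
move: (thsum _ _ _ _) (thsum (t n / 2) _ _ _) => X Y B1 B2.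
by rewrite mulrAC ler_pdivlMr // -(ler_pM2l st); lra.
Unshelve. all: end_near. Qed.

End ThetaAsymptotics.

(** * Trigonometric inequalities *)

Section TrigBounds.
Context {R : realType}.
Implicit Types (x y z : R).

Lemma sin_norm_le x : `|sin x| <= `|x|.
Proof.
have H y : 0 <= y -> `|sin y| <= y.
  move=> y0; have := @der_abs_le R (@sin R) (@cos R) (fun z => z) (fun=> 1) 0 y y0.
  rewrite sin0 !subr0; apply.
  - by move=> z _; exact: continuous_sin.
  - by move=> z _; exact: cvg_id.
  - by move=> z _; exact: cos_max.
have [x0|x0] := leP 0 x; first by rewrite (ger0_norm x0) H.
by rewrite -normrN -sinN (ltr0_norm x0) H // oppr_ge0 ltW.
Qed.

Let der_Ncos (z : R) : is_derive z 1 (fun z => - cos z) (sin z).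
Proof. by apply: (is_derive_eq (derN (is_derive_cos z))); rewrite opprK. Qed.

Lemma oneBcos_le x : 0 <= 1 - cos x <= x ^+ 2 / 2.
Proof.
rewrite subr_ge0 cos_le1 /=.
have H y : 0 <= y -> 1 - cos y <= y ^+ 2 / 2.
  move=> y0.
  have dR (z : R) : is_derive z 1 (fun z => z ^+ 2 / 2) z.
    by apply: (is_derive_eq (derM (derX 2 (der_id _)) (der_cst _ _))) => /=; field.
  have := @der_le R _ _ _ _ 0 y y0 (fun z _ => der_Ncos z) (fun z _ => dR z)
    (fun z _ => der_continuous (der_Ncos z)) (fun z _ => der_continuous (dR z)).
  rewrite cos0 opprK expr0n /= mul0r subr0 addrC; apply => z /andP[z0 _].
  by apply: le_trans (ler_norm _) _; rewrite -[leRHS]ger0_norm ?(ltW z0) // sin_norm_le.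
by rewrite -cos_norm -[x ^+ 2]real_normK ?num_real // H.
Qed.

Lemma oneBcos_le_norm x : 1 - cos x <= `|x|.
Proof.
have H y : 0 <= y -> 1 - cos y <= y.
  move=> y0.
  have := @der_le R _ _ _ _ 0 y y0 (fun z _ => der_Ncos z) (fun z _ => der_id z)
    (fun z _ => der_continuous (der_Ncos z)) (fun z _ => der_continuous (der_id z)).
  rewrite cos0 opprK subr0 addrC; apply => z _; exact: sin_le1.
by rewrite -cos_norm H.
Qed.

Let der_sinB (z : R) : is_derive z 1 (fun z => sin z - z) (cos z - 1).
Proof. exact: (derD (is_derive_sin z) (derN (der_id _))). Qed.

Let norm_sinBN x : `|sin (- x) - (- x)| = `|sin x - x|.
Proof. by rewrite sinN -opprD normrN. Qed.

Lemma sin_taylor x : `|sin x - x| <= `|x| ^+ 3 / 6.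
Proof.
have H y : 0 <= y -> `|sin y - y| <= y ^+ 3 / 6.
  move=> y0.
  have dR (z : R) : is_derive z 1 (fun z => z ^+ 3 / 6) (z ^+ 2 / 2).
    by apply: (is_derive_eq (derM (derX 3 (der_id _)) (der_cst _ _))) => /=; field.
  have := @der_abs_le R _ _ _ _ 0 y y0 (fun z _ => der_sinB z) (fun z _ => dR z)
    (fun z _ => der_continuous (der_sinB z)) (fun z _ => der_continuous (dR z)).
  rewrite sin0 subrr expr0n /= mul0r !subr0; apply => z _.
  by rewrite -normrN opprB ger0_norm; have /andP[] := oneBcos_le z.
have [x0|x0] := leP 0 x; first by rewrite [in leRHS](ger0_norm x0) H.
by rewrite -norm_sinBN (ltr0_norm x0) H // oppr_ge0 ltW.
Qed.

Let sin_taylor2 x : `|sin x - x| <= x ^+ 2 / 2.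
Proof.
have H y : 0 <= y -> `|sin y - y| <= y ^+ 2 / 2.
  move=> y0.
  have dR (z : R) : is_derive z 1 (fun z => z ^+ 2 / 2) z.
    by apply: (is_derive_eq (derM (derX 2 (der_id _)) (der_cst _ _))) => /=; field.
  have := @der_abs_le R _ _ _ _ 0 y y0 (fun z _ => der_sinB z) (fun z _ => dR z)
    (fun z _ => der_continuous (der_sinB z)) (fun z _ => der_continuous (dR z)).
  rewrite sin0 subrr expr0n /= mul0r !subr0; apply => z /andP[z0 _].
  rewrite -normrN opprB ger0_norm; last by have /andP[] := oneBcos_le z.
  by apply: le_trans (oneBcos_le_norm z) _; rewrite (gtr0_norm z0).
have [x0|x0] := leP 0 x; first exact: H.
by rewrite -norm_sinBN -sqrrN H // oppr_ge0 ltW.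
Qed.

Lemma cos_taylor x : `|cos x - 1 + x ^+ 2 / 2| <= `|x| ^+ 3 / 6.
Proof.
have H y : 0 <= y -> `|cos y - 1 + y ^+ 2 / 2| <= y ^+ 3 / 6.
  move=> y0.
  have dL (z : R) : is_derive z 1 (fun z => cos z - 1 + z ^+ 2 / 2) (- sin z + z).
    apply: (is_derive_eq (derD (derD (is_derive_cos z) (der_cst _ _))
      (derM (derX 2 (der_id _)) (der_cst _ _)))) => /=.
    by field.
  have dR (z : R) : is_derive z 1 (fun z => z ^+ 3 / 6) (z ^+ 2 / 2).
    by apply: (is_derive_eq (derM (derX 3 (der_id _)) (der_cst _ _))) => /=; field.
  have := @der_abs_le R _ _ _ _ 0 y y0 (fun z _ => dL z) (fun z _ => dR z)
    (fun z _ => der_continuous (dL z)) (fun z _ => der_continuous (dR z)).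
  rewrite cos0 subrr !expr0n /= !mul0r addr0 !subr0; apply => z _.
  by rewrite -normrN opprD opprK; exact: sin_taylor2.
by rewrite -cos_norm -[x ^+ 2]real_normK ?num_real // H.
Qed.

Lemma sin_ge_third x : 0 <= x <= 2 -> x / 3 <= sin x.
Proof.
move=> /andP[x0 x2]; have := sin_taylor x; rewrite ler_norml (ger0_norm x0) => /andP[+ _].
have : x ^+ 3 <= 4 * x by rewrite exprS; nra.
lra.
Qed.

(** 1 - cos x = 2 sin^2 (x / 2), and sin (x / 2) >= x / 6 for x in [0, 4]. *)
Lemma oneBcos_ge x : `|x| <= 4 -> x ^+ 2 / 18 <= 1 - cos x.
Proof.
move=> x4; rewrite -cos_norm -[x ^+ 2]real_normK ?num_real //.
have : 0 <= `|x| / 2 <= 2 by have := normr_ge0 x; lra.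
move: `|x| x4 => y y4 yI; have := sin_ge_third yI.
have -> : cos y = cos (y / 2 + y / 2) by rewrite -splitr.
rewrite cosD; have := cos2Dsin2 (y / 2).
have : 0 <= y / 2 / 3 by case/andP: yI => *; lra.
nra.
Qed.

Lemma sum_cos_dirichlet x n :
  2 * sin (x / 2) * (\sum_(1 <= k < n.+1) cos (k%:R * x)) =
    sin (n%:R * x + x / 2) - sin (x / 2).
Proof.
elim: n => [|n IHn]; first by rewrite big_geq // mulr0 mul0r add0r subrr.
rewrite big_nat_recr //= mulrDr IHn.
have -> : n%:R * x + x / 2 = n.+1%:R * x - x / 2 by rewrite -natr1; field.
rewrite sinB sinD; ring.
Qed.

(** The Dirichlet kernel bounds the sum of cosines by 1 / (2 sin (x / 2)) <= 3 / x, hence by n / 2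
    once n x >= 6. It controls frequencies too large for the quadratic bound on 1 - cos. *)
Lemma sum_oneBcos_ge x n : 0 < x <= 4 -> 6 <= n%:R * x ->
  n%:R / 2 <= \sum_(1 <= k < n.+1) (1 - cos (k%:R * x)).
Proof.
move=> /andP[x0 x4] nx.
rewrite sumrB big_const_nat iter_addr addr0 subn1 /=.
have s0 : x / 2 / 3 <= sin (x / 2) by apply: sin_ge_third; lra.
have := sum_cos_dirichlet x n; have := sin_le1 (n%:R * x + x / 2).
set C := \sum_(_ <= _ < _) _ => H1 H2.
suff : C <= n%:R / 2 by lra.
have [C0|C0] := leP C 0; first by apply: le_trans C0 _; rewrite divr_ge0.
have H3 : x / 3 * C <= 1.
  apply: le_trans (_ : 2 * sin (x / 2) * C <= _); last by lra.
  by rewrite ler_pM2r //; lra.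
rewrite -(ler_pM2l x0); lra.
Qed.

End TrigBounds.

(** * Complex moduli and the unit circle *)

Section ComplexTools.
Context {R : realType}.
Local Open Scope complex_scope.
Implicit Types (x y th : R) (n : nat).

Local Notation nrm := (@Normc.normc R).

Lemma nrm_ge0 (z : R[i]) : 0 <= nrm z.
Proof. by case: z => a b; rewrite sqrtr_ge0. Qed.

Lemma nrmD (z w : R[i]) : nrm (z + w) <= nrm z + nrm w.
Proof. exact: le_normcD. Qed.

Lemma nrmN (z : R[i]) : nrm (- z) = nrm z.
Proof. exact: normcN. Qed.

Lemma nrmB (z w : R[i]) : nrm (z - w) <= nrm z + nrm w.
Proof. by rewrite -(nrmN w); exact: nrmD. Qed.

Lemma nrmM (z w : R[i]) : nrm (z * w) = nrm z * nrm w.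
Proof. exact: Normc.normcM. Qed.

Lemma nrmV (z : R[i]) : nrm z^-1 = (nrm z)^-1.
Proof. exact: Normc.normcV. Qed.

Lemma nrm_real x : nrm x%:C = `|x|.
Proof. by rewrite /= expr0n /= addr0 sqrtr_sqr. Qed.

Lemma nrm1 : nrm 1 = 1.
Proof. by rewrite Normc.normc1. Qed.

Lemma nrm0 : nrm 0 = 0.
Proof. by rewrite Normc.normc0. Qed.

Lemma nrm_imag x : nrm (0 +i* x) = `|x|.
Proof. by rewrite /= expr0n /= add0r sqrtr_sqr. Qed.

Lemma nrmX (z : R[i]) n : nrm (z ^+ n) = nrm z ^+ n.
Proof. by elim: n => [|n IHn]; rewrite ?expr0 ?nrm1 // !exprS nrmM IHn. Qed.

Lemma nrm_prod (I : Type) (s : seq I) (F : I -> R[i]) :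
  nrm (\prod_(k <- s) F k) = \prod_(k <- s) nrm (F k).
Proof. exact: (big_morph _ nrmM nrm1). Qed.

Lemma nrm_sum (I : Type) (s : seq I) (F : I -> R[i]) :
  nrm (\sum_(k <- s) F k) <= \sum_(k <- s) nrm (F k).
Proof.
elim: s => [|i s IHs]; first by rewrite !big_nil nrm0.
by rewrite !big_cons; apply: le_trans (nrmD _ _) _; rewrite lerD2l.
Qed.

Lemma nrm_sqr (z : R[i]) : nrm z ^+ 2 = complex.Re z ^+ 2 + complex.Im z ^+ 2.
Proof. by case: z => a b; rewrite sqr_sqrtr //= addr_ge0 ?sqr_ge0. Qed.

Lemma Re_le_nrm (z : R[i]) : `|complex.Re z| <= nrm z.
Proof.
case: z => a b /=; rewrite -sqrtr_sqr; apply: ler_wsqrtr.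
by rewrite lerDl sqr_ge0.
Qed.

Lemma nrm_le_ReIm x y : nrm (x +i* y) <= `|x| + `|y|.
Proof.
have -> : x +i* y = x%:C + (0 +i* y) by apply/eqP; rewrite eq_complex /= addr0 add0r !eqxx.
by apply: le_trans (nrmD _ _) _; rewrite nrm_real nrm_imag.
Qed.

(** Factors are exchanged one at a time; all of them lying in the unit disc, the errors add up. This
    is Lindeberg's replacement argument. *)
Lemma nrm_prodB_le (I : eqType) (s : seq I) (F G : I -> R[i]) :
  (forall k, k \in s -> nrm (F k) <= 1) -> (forall k, k \in s -> nrm (G k) <= 1) ->
  nrm (\prod_(k <- s) F k - \prod_(k <- s) G k) <= \sum_(k <- s) nrm (F k - G k).
Proof.
elim: s => [|i s IHs] F1 G1; first by rewrite !big_nil subrr nrm0.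
rewrite !big_cons.
set f := \prod_(k <- s) F k; set g := \prod_(k <- s) G k.
have -> : F i * f - G i * g = F i * (f - g) + (F i - G i) * g by ring.
apply: le_trans (nrmD _ _) _; rewrite !nrmM addrC; apply: lerD.
  rewrite ler_piMr ?nrm_ge0 // /g nrm_prod.
  rewrite -[leRHS](@big1_eq R 1 *%R _ s (fun=> true)) big_seq [leRHS]big_seq.
  by apply: ler_prod => k ks; rewrite nrm_ge0 G1 // inE ks orbT.
apply: le_trans (IHs _ _); last 2 first.
- by move=> k ks; apply: F1; rewrite inE ks orbT.
- by move=> k ks; apply: G1; rewrite inE ks orbT.
by rewrite ler_piMl ?nrm_ge0 // F1 // inE eqxx.
Qed.

Lemma nrm_expB_le (z w : R[i]) n : nrm z <= 1 -> nrm w <= 1 -> nrm (z ^+ n - w ^+ n) <= n%:R * nrm (z - w).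
Proof.
move=> z1 w1; elim: n => [|n IHn]; first by rewrite !expr0 subrr nrm0 mul0r.
have -> : z ^+ n.+1 - w ^+ n.+1 = z * (z ^+ n - w ^+ n) + (z - w) * w ^+ n.
  by rewrite !exprS; ring.
apply: le_trans (nrmD _ _) _; rewrite !nrmM nrmX -natr1 mulrDl mul1r; apply: lerD.
  by apply: le_trans IHn; rewrite ler_piMl ?nrm_ge0.
by rewrite ler_piMr ?nrm_ge0 // exprn_ile1 ?nrm_ge0.
Qed.

Definition cis th : R[i] := cos th +i* sin th.

Lemma cis0 : cis 0 = 1.
Proof. by rewrite /cis cos0 sin0. Qed.

Lemma cisD x y : cis (x + y) = cis x * cis y.
Proof.
by apply/eqP; rewrite eq_complex /= cosD sinD addrC [sin x * _ + _]addrC eqxx addrC eqxx.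
Qed.

Lemma cisX n x : cis x ^+ n = cis (n%:R * x).
Proof.
elim: n => [|n IHn]; first by rewrite expr0 mul0r cis0.
by rewrite exprS IHn -cisD -[in RHS]natr1; congr cis; ring.
Qed.

Lemma nrm_cis x : nrm (cis x) = 1.
Proof. by rewrite /= cos2Dsin2 sqrtr1. Qed.

Lemma cis_taylor x : nrm (cis x - ((1 - x ^+ 2 / 2) +i* x)) <= `|x| ^+ 3.
Proof.
have -> : cis x - ((1 - x ^+ 2 / 2) +i* x) = (cos x - 1 + x ^+ 2 / 2) +i* (sin x - x).
  by apply/eqP; rewrite eq_complex /=; apply/andP; split; apply/eqP; ring.
apply: le_trans (nrm_le_ReIm _ _) _; have := sin_taylor x; have := cos_taylor x.
have : 0 <= `|x| ^+ 3 by rewrite exprn_ge0.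
lra.
Qed.

Lemma cis_lipschitz x : nrm (cis x - 1) <= 2 * `|x|.
Proof.
have -> : cis x - 1 = (cos x - 1) +i* sin x.
  by apply/eqP; rewrite eq_complex /= oppr0 addr0 !eqxx.
apply: le_trans (nrm_le_ReIm _ _) _; have := sin_norm_le x.
suff : `|cos x - 1| <= `|x| by lra.
rewrite -normrN opprB ger0_norm; last by have /andP[] := oneBcos_le x.
exact: oneBcos_le_norm.
Qed.

End ComplexTools.

(** * Gaussian approximation of one geometric variable *)

Section Lindeberg.
Context {R : realType}.
Local Open Scope complex_scope.
Local Notation nrm := (@Normc.normc R).
Implicit Types (u th x : R).

(* Inverse characteristic function of a geometric variable of mean [u]. *)
Definition geomz u th : R[i] := 1 + u%:C * (1 - cis th).

Lemma nrm_geomz_sqr u th : nrm (geomz u th) ^+ 2 = 1 + 2 * (u + u ^+ 2) * (1 - cos th).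
Proof.
rewrite nrm_sqr /geomz /= !(mul0r, mulr0, subr0, addr0, add0r, oppr0, sub0r).
have := cos2Dsin2 th; move: (cos th) (sin th) => c s H.
have : s ^+ 2 = 1 - c ^+ 2 by rewrite -H; ring.
move=> Hs.
transitivity (1 + 2 * u * (1 - c) + u ^+ 2 * ((1 - c) ^+ 2 + s ^+ 2)); first by ring.
by rewrite Hs; ring.
Qed.

Lemma nrm_geomz_ge1 u th : 0 <= u -> 1 <= nrm (geomz u th).
Proof.
move=> u0; rewrite -(@ler_pXn2r _ 2) ?nnegrE ?nrm_ge0 // expr1n nrm_geomz_sqr.
have /andP[c0 _] := oneBcos_le th.
by rewrite lerDl; apply: mulr_ge0 => //; rewrite mulr_ge0 ?addr_ge0 ?sqr_ge0.
Qed.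

Lemma geomz_neq0 u th : 0 <= u -> geomz u th != 0.
Proof.
move=> u0; apply/eqP => E; have := nrm_geomz_ge1 th u0.
by rewrite E nrm0 ler10.
Qed.

(** As |geomz| >= 1, it suffices to bound 1 - geomz cis(u th) exp (- w), with w half the variance
    times th^2. The product geomz cis(u th) is 1 + w up to third-order terms, and (1 + w) exp (- w)
    is 1 up to w^2. The condition u |th| <= 1 absorbs all higher powers. *)
Lemma geomz_lindeberg u th : 0 <= u -> u * `|th| <= 1 ->
  nrm ((geomz u th)^-1 * cis (- (u * th)) - (expR (- ((u + u ^+ 2) * th ^+ 2 / 2)))%:C)
    <= 8 * `|th| ^+ 3 * (u + u ^+ 3).
Proof.
move=> u0 a1; set w := (u + u ^+ 2) * th ^+ 2 / 2; set al := u * th.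
pose x : R := `|th|; have x0 : 0 <= x by exact: normr_ge0.
have xx : th ^+ 2 = x ^+ 2 by rewrite real_normK // num_real.
have w0 : 0 <= w.
  by apply: divr_ge0 => //; apply: mulr_ge0; rewrite ?addr_ge0 ?sqr_ge0.
(* Every error reduces to these three monomials, and 2 q2 <= q1 + q3 since q1 (1 - u)^2 >= 0. *)
pose q1 := u * x ^+ 3; pose q2 := u ^+ 2 * x ^+ 3; pose q3 := u ^+ 3 * x ^+ 3.
have q10 : 0 <= q1 by rewrite mulr_ge0 ?exprn_ge0.
have q20 : 0 <= q2 by rewrite mulr_ge0 ?exprn_ge0.
have q30 : 0 <= q3 by rewrite mulr_ge0 ?exprn_ge0.
have q13 : 2 * q2 <= q1 + q3.
  have : 0 <= q1 * (1 - u) ^+ 2 by rewrite mulr_ge0 ?sqr_ge0.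
  by rewrite /q1 /q2 /q3; lra.
have ux0 : 0 <= u * x by rewrite mulr_ge0.
have qm q : 0 <= q -> q * (u * x) <= q by move=> ?; rewrite ler_piMr.
have alx : `|al| = u * x by rewrite normrM (ger0_norm u0).
pose r1 := cis th - ((1 - th ^+ 2 / 2) +i* th).
pose r2 := cis al - ((1 - al ^+ 2 / 2) +i* al).
have n1 : nrm r1 <= x ^+ 3 by exact: cis_taylor.
have n2 : nrm r2 <= (u * x) ^+ 3 by rewrite -alx; exact: cis_taylor.
(* What remains when both factors are replaced by their second-order Taylor polynomials: the
   quadratic terms add up to w, the linear ones cancel. *)
pose E : R[i] := ((u * th ^+ 2 / 2) * (- al ^+ 2 / 2)) +i* (al ^+ 3 / 2 + (u * th ^+ 2 / 2) * al)
   + ((1 + u * th ^+ 2 / 2) +i* (- al)) * r2 - u%:C * r1 * cis al.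
have zE : geomz u th * cis al = (1 + w)%:C + E.
  rewrite /E /r1 /r2 /geomz; move: (cis th) (cis al) => [a b] [c d].
  by apply/eqP; rewrite eq_complex /=; apply/andP; split; apply/eqP; rewrite /w /al; field.
have nE : nrm E <= 7 * x ^+ 3 * (u + u ^+ 3).
  apply: le_trans (nrmB _ _) _; rewrite !nrmM nrm_cis nrm_real (ger0_norm u0) mulr1.
  apply: le_trans (lerD (nrmD _ _) (ler_wpM2l u0 n1)) _; rewrite nrmM.
  have h1 := nrm_le_ReIm (u * th ^+ 2 / 2 * (- al ^+ 2 / 2)) (al ^+ 3 / 2 + u * th ^+ 2 / 2 * al).
  have h2 : nrm ((1 + u * th ^+ 2 / 2) +i* (- al)) <= 1 + u * x ^+ 2 / 2 + u * x.
    apply: le_trans (nrm_le_ReIm _ _) _; rewrite normrN alx -xx ger0_norm //.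
    by apply: addr_ge0 => //; apply: divr_ge0 => //; apply: mulr_ge0 => //; exact: sqr_ge0.
  have h3 := ler_pM (nrm_ge0 _) (nrm_ge0 _) h2 n2.
  have h4 : `|u * th ^+ 2 / 2 * (- al ^+ 2 / 2)| <= q2.
    have -> : u * th ^+ 2 / 2 * (- al ^+ 2 / 2) = - (q2 * (u * x) / 4).
      by rewrite /al exprMn xx /q2; field.
    rewrite normrN ger0_norm; first by have := qm _ q20; lra.
    by apply: divr_ge0 => //; apply: mulr_ge0.
  have h5 : `|al ^+ 3 / 2 + u * th ^+ 2 / 2 * al| <= q3 / 2 + q2 / 2.
    have -> : al ^+ 3 / 2 + u * th ^+ 2 / 2 * al = al * ((u ^+ 2 * x ^+ 2 + u * x ^+ 2) / 2).
      by rewrite -xx /al; field.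
    rewrite normrM alx ger0_norm.
      by rewrite /q3 /q2 le_eqVlt; apply/orP; left; apply/eqP; field.
    by apply: divr_ge0 => //; apply: addr_ge0; apply: mulr_ge0; rewrite ?sqr_ge0.
  have h6 : (1 + u * x ^+ 2 / 2 + u * x) * (u * x) ^+ 3 = q3 + q2 * (u * x) * (u * x) / 2 + q3 * (u * x).
    by rewrite /q3 /q2; field.
  have h7 := qm _ q30; have h8 := qm _ q20; have h9 := qm _ (mulr_ge0 q20 ux0).
  rewrite h6 in h3.
  have -> : 7 * x ^+ 3 * (u + u ^+ 3) = 7 * (q1 + q3) by rewrite /q1 /q3; ring.
  rewrite -/q1; lra.
have -> : (geomz u th)^-1 * cis (- al) - (expR (- w))%:C =
  (geomz u th)^-1 * cis (- al) * (1 - geomz u th * cis al * (expR (- w))%:C).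
  have c1 : cis (- al) * cis al = 1 by rewrite -cisD addNr cis0.
  rewrite mulrBr mulr1; congr (_ - _).
  by rewrite mulrA mulrACA mulVf ?geomz_neq0 // mul1r c1 mul1r.
rewrite !nrmM nrmV nrm_cis mulr1.
have gz := nrm_geomz_ge1 th u0.
apply: (@le_trans _ _ (nrm (1 - geomz u th * cis al * (expR (- w))%:C))).
  by rewrite ler_piMl ?nrm_ge0 // invf_le1 // (lt_le_trans ltr01).
rewrite zE.
have -> : 1 - ((1 + w)%:C + E) * (expR (- w))%:C =
   (1 - (1 + w) * expR (- w))%:C - E * (expR (- w))%:C.
  by rewrite rmorphB rmorphM /= rmorph1; ring.
apply: le_trans (nrmB _ _) _; rewrite nrmM !nrm_real.
have e0 := expR_gt0 (- w); rewrite (gtr0_norm e0).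
have e1 : expR (- w) <= 1 by rewrite expR_le1 oppr_le0.
have ew : 0 <= 1 - (1 + w) * expR (- w) <= w ^+ 2.
  apply/andP; split.
    by rewrite subr_ge0 -[leRHS](expRxMexpNx_1 w) ler_wpM2r ?expR_ge0 // expR_ge1Dx.
  have := expR_ge1Dx (- w); nra.
have ww : w ^+ 2 <= x ^+ 3 * (u + u ^+ 3).
  have -> : w ^+ 2 = (q1 * (u * x) + 2 * (q2 * (u * x)) + q3 * (u * x)) / 4.
    by rewrite /w xx /q1 /q2 /q3; field.
  have -> : x ^+ 3 * (u + u ^+ 3) = q1 + q3 by rewrite /q1 /q3; ring.
  have := qm _ q10; have := qm _ q20; have := qm _ q30; lra.
have : nrm E * expR (- w) <= nrm E by rewrite ler_piMr ?nrm_ge0.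
rewrite ger0_norm; last by case/andP: ew.
by case/andP: ew => _ ew; rewrite -/x; lra.
Qed.

End Lindeberg.

(** * Evaluation of integer polynomials *)

Section Evaluation.
Variable F : comNzRingType.
Implicit Types (p q : {poly int}) (z : F).

Definition evalz z p : F := (map_poly intr p).[z].

Lemma evalzM z p q : evalz z (p * q) = evalz z p * evalz z q.
Proof. by rewrite /evalz rmorphM hornerM. Qed.

Lemma evalz1 z : evalz z 1 = 1.
Proof. by rewrite /evalz rmorph1 hornerC. Qed.

Lemma evalzX z p n : evalz z (p ^+ n) = evalz z p ^+ n.
Proof. by rewrite /evalz rmorphXn horner_exp. Qed.

Lemma evalzXn z n : evalz z 'X^n = z ^+ n.
Proof. by rewrite /evalz map_polyXn hornerXn. Qed.

Lemma evalzB z p q : evalz z (p - q) = evalz z p - evalz z q.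
Proof. by rewrite /evalz rmorphB hornerD hornerN. Qed.

Lemma evalz_prod (I : Type) (s : seq I) (G : I -> {poly int}) z :
  evalz z (\prod_(k <- s) G k) = \prod_(k <- s) evalz z (G k).
Proof. exact: (big_morph _ (evalzM z) (evalz1 z)). Qed.

Lemma evalz_sum (I : Type) (s : seq I) (G : I -> {poly int}) z :
  evalz z (\sum_(k <- s) G k) = \sum_(k <- s) evalz z (G k).
Proof.
rewrite /evalz rmorph_sum horner_sum //.
Qed.

Lemma evalz_coef z p n : (size p <= n)%N -> evalz z p = \sum_(j < n) (p`_j)%:~R * z ^+ j.
Proof.
move=> pn; rewrite /evalz (@horner_coef_wide _ n).
  by apply: eq_bigr => j _; rewrite coef_map.
by apply: leq_trans pn; exact: size_poly.
Qed.

Lemma evalz_pgen z n :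
  evalz z (pgen n) * \prod_(1 <= k < n.+1) (1 - z ^+ k) =
    \prod_(1 <= k < n.+1) (1 - z ^+ (k * n.+1)).
Proof.
have E m : evalz z (1 - 'X^m) = 1 - z ^+ m by rewrite evalzB evalz1 evalzXn.
have := congr1 (evalz z) (pgenM_qpoch n).
rewrite evalzM /qpoch_poly [X in _ * X]evalz_prod [X in _ = X]evalz_prod.
rewrite (eq_bigr (fun k => 1 - z ^+ k)); last by move=> k _; exact: E.
by move->; apply: eq_bigr => k _; exact: E.
Qed.

End Evaluation.

(** * Factorisation of the tilted generating function *)

Section CharacteristicFunction.
Context {R : realType}.
Local Open Scope complex_scope.
Local Notation nrm := (@Normc.normc R).
Local Notation toC := (real_complex R).
Implicit Types (t ph : R) (k n N L : nat).

(** The mean r / (1 - r) of a geometric variable of ratio r = exp (- k t), written through [bose] so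
    that the grid sums apply. *)
Definition geomu t k : R := bose (k%:R * t) / (k%:R * t).

Lemma geomuE t k : 0 < t -> (0 < k)%N ->
  geomu t k = expR (- t) ^+ k / (1 - expR (- t) ^+ k).
Proof.
move=> t0 k0; have x0 : 0 < k%:R * t by rewrite mulr_gt0 ?ltr0n.
rewrite -expRM_natl mulrN /geomu /bose expRN; move: (k%:R * t) x0 => x x0.
have /lt0r_neq0 e1 := expRm1_gt0 x0; have /lt0r_neq0 e0 := expR_gt0 x.
by field; rewrite e0 e1 gt_eqF.
Qed.

Lemma geomu_ge0 t k : 0 < t -> 0 <= geomu t k.
Proof.
move=> t0; case: k => [|k]; first by rewrite /geomu mul0r invr0 mulr0.
have x0 : 0 < k.+1%:R * t by rewrite mulr_gt0 ?ltr0n.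
by rewrite divr_ge0 ?ltW // bose_gt0.
Qed.

(** For a ratio r and u = r / (1 - r), one has 1 - r z = (1 - r) (1 + u (1 - z)). *)
Lemma polar_factor t ph k : 0 < t -> (0 < k)%N ->
  1 - (toC (expR (- t)) * cis ph) ^+ k =
    toC (1 - expR (- t) ^+ k) * geomz (geomu t k) (k%:R * ph).
Proof.
move=> t0 k0; rewrite exprMn cisX -rmorphXn /geomz geomuE //=.
have d0 : 1 - expR (- t) ^+ k != 0.
  by rewrite gt_eqF // subr_gt0 exprn_ilt1 ?expR_ge0 ?expR_lt1 ?oppr_lt0 // -lt0n.
move: (expR (- t) ^+ k) (cis _) d0 => e c d0.
have -> : toC (1 - e) * (1 + toC (e / (1 - e)) * (1 - c)) =
  toC (1 - e) + toC (e / (1 - e) * (1 - e)) * (1 - c) by rewrite rmorphM /=; ring.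
by rewrite divfK // rmorphB rmorph1 /=; ring.
Qed.

Lemma nrm_prod_oneB_le (I : Type) (s : seq I) (x : I -> R[i]) :
  nrm (\prod_(k <- s) (1 - x k) - 1) <= expR (\sum_(k <- s) nrm (x k)) - 1.
Proof.
elim: s => [|i s IHs]; first by rewrite !big_nil subrr nrm0 expR0 subrr.
rewrite !big_cons expRD.
set P := \prod_(k <- s) _ in IHs *; set S := \sum_(k <- s) _ in IHs *.
have P1 : nrm P <= expR S.
  rewrite -[P](subrK 1); apply: le_trans (nrmD _ _) _; rewrite nrm1; lra.
have -> : (1 - x i) * P - 1 = (P - 1) - x i * P by ring.
apply: le_trans (nrmB _ _) _; rewrite nrmM.
have := ler_wpM2l (nrm_ge0 (x i)) P1; have := expR_ge1Dx (nrm (x i)).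
have := expR_gt0 S; nra.
Qed.

Lemma nrm_expB1_le (P : R[i]) (S : R) n :
  nrm (P - 1) <= expR S - 1 -> nrm (P ^+ n - 1) <= expR (n%:R * S) - 1.
Proof.
move=> PS; elim: n => [|n IHn]; first by rewrite expr0 mul0r subrr nrm0 expR0 subrr.
rewrite exprS -natr1 mulrDl mul1r expRD.
have P1 : nrm P <= expR S.
  rewrite -[P](subrK 1); apply: le_trans (nrmD _ _) _; rewrite nrm1; lra.
have -> : P * P ^+ n - 1 = (P ^+ n - 1) * P + (P - 1) by ring.
apply: le_trans (nrmD _ _) _; rewrite nrmM.
have := ler_pM (nrm_ge0 _) (nrm_ge0 _) IHn P1; lra.
Qed.

Definition polar t ph : R[i] := toC (expR (- t)) * cis ph.

Lemma nrm_polar t ph : nrm (polar t ph) = expR (- t).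
Proof. by rewrite nrmM nrm_cis mulr1 nrm_real ger0_norm ?expR_ge0. Qed.

Lemma polar0 t : polar t 0 = toC (expR (- t)).
Proof. by rewrite /polar cis0 mulr1. Qed.

(** The product of the leftover factors of the truncation; it is near 1 since every modulus
    |z|^(k(n+1)) is at most exp (- t (n + 1)). *)
Definition trunc t n ph : R[i] := \prod_(1 <= k < n.+1) (1 - polar t ph ^+ (k * n.+1)).

Lemma nrm_trunc t n ph : 0 < t ->
  nrm (trunc t n ph - 1) <= expR (n%:R * expR (- t) ^+ n.+1) - 1.
Proof.
move=> t0; apply: le_trans (nrm_prod_oneB_le _ _) _.
rewrite lerD2r ler_expR.
under eq_bigr do rewrite nrmX nrm_polar.
have -> : n%:R * expR (- t) ^+ n.+1 = \sum_(1 <= k < n.+1) expR (- t) ^+ n.+1.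
  by rewrite big_const_nat iter_addr addr0 subn1 /= mulr_natl.
rewrite !big_nat; apply: ler_sum => k /andP[k1 _].
rewrite ler_wiXn2l ?expR_ge0 ?expR_le1 ?oppr_le0 ?(ltW t0) //.
by rewrite leq_pmull.
Qed.

Definition geomprod t n ph : R[i] :=
  \prod_(1 <= k < n.+1) (geomz (geomu t k) (k%:R * ph))^-1.

Lemma geomz0 (u : R) : geomz u 0 = 1.
Proof. by rewrite /geomz cis0 subrr mulr0 addr0. Qed.

Lemma evalz_pgen_polar t n ph : 0 < t ->
  evalz (polar t ph) (pgen n) * trunc t n 0 =
    evalz (polar t 0) (pgen n) * geomprod t n ph * trunc t n ph.
Proof.
move=> t0; rewrite /trunc -!evalz_pgen /geomprod.
have E q : \prod_(1 <= k < n.+1) (1 - polar t q ^+ k) =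
  \prod_(1 <= k < n.+1) toC (1 - expR (- t) ^+ k) *
  \prod_(1 <= k < n.+1) geomz (geomu t k) (k%:R * q).
  by rewrite -big_split /= !big_nat; apply: eq_bigr => k /andP[k1 _]; rewrite polar_factor.
rewrite (E 0) (E ph).
move: (\prod_(1 <= k < n.+1) toC (1 - expR (- t) ^+ k)) => P.
have -> : \prod_(1 <= k < n.+1) geomz (geomu t k) (k%:R * 0) = 1.
  by rewrite big1 // => k _; rewrite mulr0 geomz0.
rewrite prodfV; set G := \prod_(_ <= _ < _) geomz _ _.
have G0 : G != 0 by rewrite prodf_seq_neq0; apply/allP => k _; rewrite geomz_neq0 ?geomu_ge0.
by field.
Qed.

End CharacteristicFunction.

(** * Approximation of the characteristic function *)

Section CharacteristicApprox.
Context {R : realType}.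
Local Open Scope complex_scope.
Local Notation nrm := (@Normc.normc R).
Local Notation toC := (real_complex R).
Implicit Types (t ph C : R) (k n N L : nat).

Lemma evalz_toC (x : R) p : evalz (toC x) p = toC (evalz x p).
Proof.
rewrite /evalz -horner_map -map_poly_comp /=; congr (horner _ _).
by apply/polyP => i; rewrite !coef_map_id0 //= rmorph_int.
Qed.

Lemma evalz_pgen_gt0 t n : 0 < evalz (expR (- t)) (pgen n).
Proof.
rewrite /pgen evalz_prod prodr_gt0 // => k _; rewrite evalz_sum.
rewrite big_ord_recl /= ltr_pwDl //; first by rewrite muln0 evalzXn expr0.
by apply: sumr_ge0 => j _; rewrite evalzXn exprn_ge0 ?expR_ge0.
Qed.

Lemma evalz_theta t L m : evalz (expR (- t)) (theta_poly L m) = thsum t 1 L m.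
Proof. exact: theta_poly_horner. Qed.

Lemma evalz_thetaE (F : comNzRingType) (z : F) L m :
  evalz z (theta_poly L m) = \sum_(s <- box L m) z ^+ thetas s.
Proof. by rewrite evalz_sum; apply: eq_bigr => s _; rewrite evalzXn. Qed.

Definition Apoly N n L : {poly int} := theta_poly L N.-1 * pgen n ^+ N.

(** The characteristic function of X - n, where X takes the value k with probability proportional to
    the k-th coefficient times exp (- t k). *)
Definition charf t N n L ph : R[i] :=
  evalz (polar t ph) (Apoly N n L) * cis (- (n%:R * ph)) /
    toC (evalz (expR (- t)) (Apoly N n L)).

Definition thetaf t L m ph : R[i] :=
  evalz (polar t ph) (theta_poly L m) / toC (thsum t 1 L m).

Lemma charfE t N n L ph : 0 < t -> trunc t n 0 != 0 ->
  charf t N n L ph = (geomprod t n ph ^+ N * cis (- (n%:R * ph))) * thetaf t L N.-1 ph *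
     (trunc t n ph ^+ N / trunc t n 0 ^+ N).
Proof.
move=> t0 T0; rewrite /charf /thetaf /Apoly !evalzM !evalzX evalz_theta.
have := evalz_pgen_polar n ph t0; rewrite polar0 evalz_toC.
have p0 := evalz_pgen_gt0 t n; have th0 := thsum_gt0 t 1 L N.-1.
have p0C : toC (evalz (expR (- t)) (pgen n)) != 0.
  by rewrite fmorph_eq0 gt_eqF.
have th0C : toC (thsum t 1 L N.-1) != 0 by rewrite fmorph_eq0 gt_eqF.
rewrite rmorphM rmorphXn /=.
move: (evalz (polar t ph) (pgen n)) (toC (evalz _ _)) (toC (thsum _ _ _ _)) p0C th0C => P Q T p0C th0C.
move: (trunc t n 0) (trunc t n ph) T0 (geomprod t n ph) => a b a0 g E.
have -> : P = Q * g * b / a by rewrite -E mulfK.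
have aN : a ^+ N != 0 by rewrite expf_neq0.
have QN : Q ^+ N != 0 by rewrite expf_neq0.
rewrite !exprMn exprVn.
by field; rewrite aN QN th0C.
Qed.

Lemma nrm_thetaf_le1 t L m ph : nrm (thetaf t L m ph) <= 1.
Proof.
rewrite nrmM nrmV nrm_real ger0_norm ?(ltW (thsum_gt0 _ _ _ _)) //.
rewrite ler_pdivrMr ?thsum_gt0 // mul1r evalz_thetaE -evalz_theta evalz_thetaE.
apply: le_trans (nrm_sum _ _) _; apply: ler_sum => s _.
by rewrite nrmX nrm_polar.
Qed.

(** |E exp (i ph X) - 1| <= 2 |ph| E X. With mean at most C / t and ph of order t^(3/2), the theta
    variable disappears in the limit. *)
Lemma nrm_thetafB1 t L m ph C : 0 < t ->
  t * (\sum_(s <- box L m) (thetas s)%:R * expR (- t) ^+ thetas s) <= C * thsum t 1 L m ->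
  nrm (thetaf t L m ph - 1) <= 2 * `|ph| * C / t.
Proof.
move=> t0 HC; have th0 := thsum_gt0 t 1 L m.
have -> : thetaf t L m ph - 1 = (evalz (polar t ph) (theta_poly L m) - toC (thsum t 1 L m)) /
    toC (thsum t 1 L m).
  by rewrite /thetaf mulrBl divff // fmorph_eq0 gt_eqF.
rewrite nrmM nrmV nrm_real (gtr0_norm th0) ler_pdivrMr //.
rewrite -evalz_theta !evalz_thetaE rmorph_sum /= -sumrB.
apply: le_trans (nrm_sum _ _) _.
apply: (@le_trans _ _ (\sum_(s <- box L m) 2 * `|ph| * ((thetas s)%:R * expR (- t) ^+ thetas s))).
  apply: ler_sum => s _.
  have r0 : 0 <= expR (- t) ^+ thetas s by rewrite exprn_ge0 ?expR_ge0.
  have -> : polar t ph ^+ thetas s - toC (expR (- t) ^+ thetas s) =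
      toC (expR (- t) ^+ thetas s) * (cis ((thetas s)%:R * ph) - 1).
    by rewrite /polar exprMn cisX rmorphXn /= mulrBr mulr1.
  rewrite nrmM nrm_real (ger0_norm r0) mulrCA mulrA.
  rewrite [leRHS]mulrC ler_wpM2l //.
  apply: le_trans (cis_lipschitz _) _; rewrite normrM ger0_norm ?ler0n //.
  by rewrite le_eqVlt; apply/orP; left; apply/eqP; ring.
rewrite -mulr_sumr -evalz_thetaE evalz_theta.
rewrite -!mulrA ler_pM2l // ler_wpM2l ?normr_ge0 //.
by rewrite mulrCA ler_pdivlMl.
Qed.

Lemma nrm_truncN t N n ph : 0 < t ->
  nrm (trunc t n ph ^+ N - 1) <= expR (N%:R * (n%:R * expR (- t) ^+ n.+1)) - 1.
Proof. by move=> t0; apply: nrm_expB1_le; exact: nrm_trunc. Qed.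

Lemma trunc_ratio t N n ph : 0 < t -> (0 < N)%N ->
  let e := expR (N%:R * (n%:R * expR (- t) ^+ n.+1)) - 1 in
  e <= 2^-1 -> trunc t n 0 != 0 /\
    nrm (trunc t n ph ^+ N / trunc t n 0 ^+ N - 1) <= 4 * e.
Proof.
move=> t0 N0 e e2.
have := nrm_truncN N n ph t0; have := nrm_truncN N n 0 t0; rewrite -/e.
move: (trunc t n ph ^+ N) => x; have -> : (trunc t n 0 != 0) = (trunc t n 0 ^+ N != 0).
  by rewrite expf_eq0 N0.
move: (trunc t n 0 ^+ N) => y y1 x1.
have yn : 2^-1 <= nrm y.
  have := nrmB 1 (1 - y); rewrite opprB addrC subrK -[nrm (1 - y)]nrmN opprB nrm1.
  have : nrm 1 <= nrm y + nrm (1 - y) by rewrite -{1}[1](subrK y) addrC nrmD.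
  by rewrite nrm1 -[nrm (1 - y)]nrmN opprB => *; lra.
have y0 : y != 0 by apply/eqP => E; move: yn; rewrite E nrm0; lra.
split => //.
have -> : x / y - 1 = ((x - 1) - (y - 1)) / y by field.
rewrite nrmM nrmV ler_pdivrMr; last by lra.
apply: le_trans (nrmB _ _) _; have e0 : 0 <= e by apply: le_trans x1; exact: nrm_ge0.
by nra.
Qed.

Lemma nrm_geomprod_le1 t n ph : 0 < t -> nrm (geomprod t n ph) <= 1.
Proof.
move=> t0; rewrite nrm_prod -[leRHS](@big1_eq R 1 *%R _ (index_iota 1 n.+1) (fun=> true)).
apply: ler_prod => k _; rewrite nrm_ge0 nrmV invf_le1 ?nrm_geomz_ge1 ?geomu_ge0 //.
by rewrite (lt_le_trans ltr01) // nrm_geomz_ge1 // geomu_ge0.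
Qed.

(** Mean, variance and third-order Lindeberg sum of one copy of the geometric sum, in which the k-th
    variable is multiplied by k. *)
Definition gmean t n : R := \sum_(1 <= k < n.+1) k%:R * geomu t k.
Definition gvar t n : R := \sum_(1 <= k < n.+1) k%:R ^+ 2 * (geomu t k + geomu t k ^+ 2).
Definition gthird t n : R := \sum_(1 <= k < n.+1) k%:R ^+ 3 * (geomu t k + geomu t k ^+ 3).

Lemma gvar_ge0 t n : 0 < t -> 0 <= gvar t n.
Proof.
move=> t0; apply: sumr_ge0 => k _; apply: mulr_ge0; first exact: sqr_ge0.
by rewrite addr_ge0 ?sqr_ge0 ?geomu_ge0.
Qed.

Lemma k_geomu t k : 0 < t -> (0 < k)%N -> k%:R * geomu t k = bose (k%:R * t) / t.
Proof. by move=> t0 k0; rewrite /geomu; field; rewrite !gt_eqF // ltr0n. Qed.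

Lemma geomprod_approx t n ph : 0 < t -> `|ph| <= t ->
  nrm (geomprod t n ph * cis (- (gmean t n * ph)) - toC (expR (- (ph ^+ 2 / 2 * gvar t n))))
    <= 8 * `|ph| ^+ 3 * gthird t n.
Proof.
move=> t0 pt.
have -> : geomprod t n ph * cis (- (gmean t n * ph)) = \prod_(1 <= k < n.+1)
    ((geomz (geomu t k) (k%:R * ph))^-1 * cis (- (geomu t k * (k%:R * ph)))).
  rewrite big_split /=; congr (_ * _).
  rewrite /gmean mulr_suml -sumrN (big_morph _ cisD cis0).
  by apply: eq_bigr => k _; congr cis; ring.
have -> : toC (expR (- (ph ^+ 2 / 2 * gvar t n))) = \prod_(1 <= k < n.+1)
    toC (expR (- ((geomu t k + geomu t k ^+ 2) * (k%:R * ph) ^+ 2 / 2))).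
  rewrite -rmorph_prod /= -expR_sum; congr toC; congr expR.
  by rewrite /gvar mulr_sumr -sumrN; apply: eq_bigr => k _; field.
apply: le_trans (nrm_prodB_le _ _) _.
- move=> k _; rewrite nrmM nrm_cis mulr1 nrmV invf_le1 ?nrm_geomz_ge1 ?geomu_ge0 //.
  by rewrite (lt_le_trans ltr01) // nrm_geomz_ge1 // geomu_ge0.
- move=> k _; rewrite nrm_real ger0_norm ?expR_ge0 // expR_le1 oppr_le0.
  apply: divr_ge0 => //; apply: mulr_ge0; last exact: sqr_ge0.
  by rewrite addr_ge0 ?sqr_ge0 ?geomu_ge0.
rewrite /gthird mulr_sumr !big_nat; apply: ler_sum => k /andP[k1 _].
apply: le_trans (geomz_lindeberg _ _) _.
- exact: geomu_ge0.
- rewrite normrM ger0_norm ?ler0n // mulrA [geomu t k * _]mulrC k_geomu //.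
  rewrite mulrAC ler_pdivrMr // mul1r; apply: le_trans pt.
  by rewrite ler_piMl ?normr_ge0 // bose_le1 // mulr_gt0 ?ltr0n.
by rewrite normrM (ger0_norm (ler0n _ _)) le_eqVlt; apply/orP; left; apply/eqP; ring.
Qed.

(** The four error terms come, in order, from Lindeberg's exchange, the distance of the mean from n,
    the theta variable and the truncation. *)
Lemma charf_approx t N n L ph C : 0 < t -> (0 < N)%N -> `|ph| <= t ->
  t * (\sum_(s <- box L N.-1) (thetas s)%:R * expR (- t) ^+ thetas s) <= C * thsum t 1 L N.-1 ->
  let e := expR (N%:R * (n%:R * expR (- t) ^+ n.+1)) - 1 in e <= 2^-1 ->
  nrm (charf t N n L ph - toC (expR (- (N%:R * (ph ^+ 2 / 2 * gvar t n))))) <=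
    N%:R * (8 * `|ph| ^+ 3 * gthird t n) + 2 * `|N%:R * gmean t n - n%:R| * `|ph| +
      2 * `|ph| * C / t + 4 * e.
Proof.
move=> t0 N0 pt HC e e2; have [T0 Tr] := trunc_ratio ph t0 N0 e2.
rewrite charfE //; move: (_ / _) Tr => tr Tr.
have thB := nrm_thetafB1 ph t0 HC; have th1 := nrm_thetaf_le1 t L N.-1 ph.
move: (thetaf _ _ _ _) thB th1 => f fB f1.
pose X := (geomprod t n ph * cis (- (gmean t n * ph))) ^+ N.
pose c := cis ((N%:R * gmean t n - n%:R) * ph).
have -> : geomprod t n ph ^+ N * cis (- (n%:R * ph)) = X * c.
  by rewrite /X /c exprMn cisX -mulrA -cisD; congr (_ * cis _); ring.
have g1 : nrm (geomprod t n ph * cis (- (gmean t n * ph))) <= 1.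
  by rewrite nrmM nrm_cis mulr1 nrm_geomprod_le1.
have X1 : nrm X <= 1 by rewrite nrmX exprn_ile1 ?nrm_ge0.
have c1 : nrm c = 1 by exact: nrm_cis.
have cB : nrm (c - 1) <= 2 * `|N%:R * gmean t n - n%:R| * `|ph|.
  by apply: le_trans (cis_lipschitz _) _; rewrite normrM mulrA.
have gv0 : 0 <= gvar t n by exact: gvar_ge0.
have XB : nrm (X - toC (expR (- (N%:R * (ph ^+ 2 / 2 * gvar t n))))) <=
    N%:R * (8 * `|ph| ^+ 3 * gthird t n).
  rewrite -mulrN expRM_natl rmorphXn /=.
  apply: le_trans (nrm_expB_le _ _ _) _ => //.
    rewrite nrm_real ger0_norm ?expR_ge0 // expR_le1 oppr_le0.
    by apply: mulr_ge0 => //; apply: divr_ge0 => //; exact: sqr_ge0.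
  by rewrite ler_wpM2l ?ler0n // geomprod_approx.
set Y := toC _ in XB *.
have -> : X * c * f * tr - Y = X * c * f * (tr - 1) + X * c * (f - 1) + X * (c - 1) + (X - Y) by ring.
have T1 : nrm (X * c * f * (tr - 1)) <= nrm (tr - 1).
  rewrite nrmM ler_piMl ?nrm_ge0 // nrmM mulr_ile1 ?nrm_ge0 //.
  by rewrite nrmM c1 mulr1.
have T2 : nrm (X * c * (f - 1)) <= nrm (f - 1).
  by rewrite nrmM ler_piMl ?nrm_ge0 // nrmM c1 mulr1.
have T3 : nrm (X * (c - 1)) <= nrm (c - 1) by rewrite nrmM ler_piMl ?nrm_ge0.
have D1 := nrmD (X * c * f * (tr - 1) + X * c * (f - 1) + X * (c - 1)) (X - Y).
have D2 := nrmD (X * c * f * (tr - 1) + X * c * (f - 1)) (X * (c - 1)).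
have D3 := nrmD (X * c * f * (tr - 1)) (X * c * (f - 1)).
rewrite -/e in Tr; lra.
Qed.

Lemma nrm_charf_le t N n L ph : 0 < t -> (0 < N)%N ->
  expR (N%:R * (n%:R * expR (- t) ^+ n.+1)) - 1 <= 2^-1 ->
  nrm (charf t N n L ph) <= 3 * nrm (geomprod t n ph) ^+ N.
Proof.
move=> t0 N0 e2; have [T0 Tr] := trunc_ratio ph t0 N0 e2.
rewrite charfE //; have th1 := nrm_thetaf_le1 t L N.-1 ph.
move: (trunc _ _ _ ^+ N / _) Tr (thetaf _ _ _ _) th1 => tr Tr f th1.
rewrite !nrmM nrm_cis mulr1 nrmX mulrC.
have tr3 : nrm tr <= 3.
  by rewrite -[tr](subrK 1); apply: le_trans (nrmD _ _) _; rewrite nrm1; lra.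
have G0 : 0 <= nrm (geomprod t n ph) ^+ N by rewrite exprn_ge0 ?nrm_ge0.
apply: ler_pM => //; rewrite ?nrm_ge0 //; first by apply: mulr_ge0; rewrite ?nrm_ge0.
by rewrite ler_piMr.
Qed.

End CharacteristicApprox.

(** * Moments of the geometric sum and decay away from frequency 0 *)

Section GeometricMoments.
Context {R : realType}.
Local Notation nrm := (@Normc.normc R).
Implicit Types (t ph : R) (k n N m : nat).

Lemma gmean_near t n : 0 < t -> (0 < n)%N ->
  `|gmean t n - boseint / t ^+ 2| <= (t + 2 * expR (- (n%:R * t / 2))) / t ^+ 2.
Proof.
move=> t0 n0; have t20 : 0 < t ^+ 2 by rewrite exprn_gt0.
have -> : gmean t n - boseint / t ^+ 2 =
    (t * (\sum_(1 <= k < n.+1) bose (k%:R * t)) - boseint) / t ^+ 2.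
  have -> : gmean t n = (\sum_(1 <= k < n.+1) bose (k%:R * t)) / t.
    rewrite mulr_suml /gmean !big_nat; apply: eq_bigr => k /andP[k1 _].
    exact: k_geomu.
  by field; rewrite gt_eqF.
rewrite normrM normfV (gtr0_norm t20) ler_pM2r ?invr_gt0 //.
exact: sum_bose.
Qed.

Lemma gvar_near t n : 0 < t -> (0 < n)%N ->
  `|t ^+ 3 * gvar t n - 2 * boseint| <=
    3 * t + 4 * expR (- (n%:R * t / 2)) + n%:R * t * expR (- (n%:R * t / 2)).
Proof.
move=> t0 n0; have -> : t ^+ 3 * gvar t n = t * (\sum_(1 <= k < n.+1) bosevar (k%:R * t)).
  rewrite /gvar !mulr_sumr !big_nat; apply: eq_bigr => k /andP[k1 _].
  rewrite /bosevar /geomu; field; rewrite !gt_eqF // ltr0n //.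
exact: sum_bosevar.
Qed.

Lemma sum_bose_le t n : 0 < t -> t * (\sum_(1 <= k < n.+1) bose (k%:R * t)) <= boseint + t + 2.
Proof.
move=> t0; case: n => [|n]; first by rewrite big_geq // mulr0; have := boseint_gt0 (R := R); lra.
have := sum_bose t0 (ltn0Sn n); rewrite ler_norml => /andP[_].
have : expR (- (n.+1%:R * t / 2)) <= 1.
  by rewrite expR_le1 oppr_le0; apply: divr_ge0 => //; rewrite mulr_ge0 ?ler0n // ltW.
lra.
Qed.

(** bose x = 2 bose (x / 2) / (e^(x/2) + 1), and e^y >= y^2 / 2 absorbs the square. A third moment
    thus reduces to a sum of [bose] at t / 2. *)
Lemma sqr_bose_le (x : R) : 0 < x -> x ^+ 2 * bose x <= 16 * bose (x / 2).
Proof.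
move=> x0; have x2 : 0 < x / 2 by rewrite divr_gt0.
have E : expR x = expR (x / 2) * expR (x / 2) by rewrite -expRD -splitr.
have e1 := expRm1_gt0 x2; have b0 := bose_gt0 x2.
have -> : bose x = 2 * bose (x / 2) / (expR (x / 2) + 1).
  have e2 : 0 < expR (x / 2) + 1 by lra.
  rewrite /bose E; have -> : expR (x / 2) * expR (x / 2) - 1 = (expR (x / 2) - 1) * (expR (x / 2) + 1) by ring.
  by field; rewrite !gt_eqF.
have := @expR_ge1Dxn R (x / 2) 1 (ltW x2); rewrite !factS fact0 /= => H.
rewrite mulrA ler_pdivrMr; last by lra.
rewrite mulrCA mulrA [leRHS]mulrAC ler_pM2r //.
have -> : x ^+ 2 = 4 * (x / 2) ^+ 2 by field.
by move: H; rewrite !mul1n /=; lra.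
Qed.

Lemma gthird_le t n : 0 < t <= 1 -> gthird t n <= 33 * (boseint + 3) / t ^+ 4.
Proof.
move=> /andP[t0 t1]; have t20 : 0 < t / 2 by rewrite divr_gt0.
have S1 := sum_bose_le n t0; have S2 := sum_bose_le n t20.
rewrite ler_pdivlMr ?exprn_gt0 //.
apply: (@le_trans _ _ (t * (\sum_(1 <= k < n.+1) bose (k%:R * t)) +
  32 * (t / 2 * (\sum_(1 <= k < n.+1) bose (k%:R * (t / 2)))))); last by lra.
rewrite /gthird !mulr_sumr mulr_suml -big_split /= !big_nat.
apply: ler_sum => k /andP[k1 _]; have kR : 0 < k%:R :> R by rewrite ltr0n.
have x0 : 0 < k%:R * t by rewrite mulr_gt0.
have := sqr_bose_le x0; rewrite -[k%:R * t / 2]mulrA.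
have b0 := bose_gt0 x0; have b1 := bose_le1 x0.
have -> : k%:R ^+ 3 * (geomu t k + geomu t k ^+ 3) * t ^+ 4 =
   t * ((k%:R * t) ^+ 2 * bose (k%:R * t)) + t * bose (k%:R * t) ^+ 3.
  by rewrite /geomu; field; rewrite !gt_eqF.
move: (bose (k%:R * (t / 2))) ((k%:R * t) ^+ 2 * _) => B X XB.
have : bose (k%:R * t) ^+ 3 <= bose (k%:R * t).
  by rewrite exprS ler_piMr ?exprn_ile1 // ltW.
move: (bose (k%:R * t) ^+ 3) (bose (k%:R * t)) => Y Z YZ.
have -> : 32 * (t / 2 * B) = t * (16 * B) by field.
rewrite addrC -!mulrDr; apply: ler_wpM2l; lra.
Qed.

Lemma nrm_geomprod_sqr t n ph : nrm (geomprod t n ph) ^+ 2 = \prod_(1 <= k < n.+1)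
  (1 + 2 * (geomu t k + geomu t k ^+ 2) * (1 - cos (k%:R * ph)))^-1.
Proof.
rewrite nrm_prod -prodrXl; apply: eq_bigr => k _.
by rewrite nrmV exprVn nrm_geomz_sqr.
Qed.

(** Factors beyond [m] have modulus at most 1 and are dropped. For the others, 1 / (1 + q) = 1 - q /
    (1 + q) <= exp (- q / (1 + Q)). *)
Lemma nrm_geomprod_decay t n m ph (q : nat -> R) (Q : R) : 0 < t -> (m <= n)%N ->
  (forall k, (0 < k <= m)%N -> 0 <= q k <= Q /\
     q k <= 2 * (geomu t k + geomu t k ^+ 2) * (1 - cos (k%:R * ph))) ->
  nrm (geomprod t n ph) ^+ 2 <= expR (- ((\sum_(1 <= k < m.+1) q k) / (1 + Q))).
Proof.
move=> t0 mn Hq; rewrite nrm_geomprod_sqr.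
have X0 k : 0 <= 2 * (geomu t k + geomu t k ^+ 2) * (1 - cos (k%:R * ph)).
  have /andP[c0 _] := oneBcos_le (k%:R * ph).
  apply: mulr_ge0 => //; apply: mulr_ge0 => //.
  by rewrite addr_ge0 ?sqr_ge0 ?geomu_ge0.
rewrite (@big_cat_nat _ _ _ m.+1) //=.
apply: (@le_trans _ _ (\prod_(1 <= k < m.+1)
  (1 + 2 * (geomu t k + geomu t k ^+ 2) * (1 - cos (k%:R * ph)))^-1)).
  rewrite ler_piMr //.
    by apply: prodr_ge0 => k _; rewrite invr_ge0 addr_ge0.
  rewrite -[leRHS](@big1_eq R 1 *%R _ (index_iota m.+1 n.+1) (fun=> true)).
  apply: ler_prod => k _; rewrite invr_ge0 addr_ge0 //=.
  by rewrite invf_le1 ?ltr_pwDl // lerDl.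
rewrite mulr_suml -sumrN expR_sum !big_nat; apply: ler_prod => k km.
rewrite invr_ge0 addr_ge0 //=.
have [/andP[q0 qQ] qX] := Hq k km.
have X1 : 0 < 1 + q k by rewrite ltr_pwDl.
apply: (@le_trans _ _ (1 + q k)^-1).
  by rewrite lef_pV2 ?posrE ?ltr_pwDl // lerD2l.
have -> : (1 + q k)^-1 = 1 + (- (q k / (1 + q k))) by field; rewrite gt_eqF.
apply: le_trans (expR_ge1Dx _) _; rewrite ler_expR lerN2.
by rewrite ler_wpM2l // lef_pV2 ?posrE ?lerD2l //; lra.
Qed.

Lemma geomu_var_ge t k : 0 < t -> (0 < k)%N -> k%:R * t <= 1 ->
  bosevar 1 / (k%:R * t) ^+ 2 <= geomu t k + geomu t k ^+ 2.
Proof.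
move=> t0 k0 kt; have x0 : 0 < k%:R * t by rewrite mulr_gt0 ?ltr0n.
have -> : geomu t k + geomu t k ^+ 2 = bosevar (k%:R * t) / (k%:R * t) ^+ 2.
  by rewrite /geomu /bosevar; field; rewrite !gt_eqF // ltr0n.
by rewrite ler_pM2r ?invr_gt0 ?exprn_gt0 // le_bosevar.
Qed.

(** Two regimes, split at |ph| = 2 / m with m about 1 / (3 t). Below, k |ph| <= 2 for all k <= m and
    the quadratic bound on 1 - cos gives a Gaussian. Above, 3 m |ph| > 6 and the Dirichlet kernel
    bound over 3 m terms gives exp (- const / t). *)
Lemma geomprod_tail t n N ph : 0 < t <= 3^-1 -> 1 <= n%:R * t -> `|ph| <= 4 -> (0 < N)%N ->
  nrm (geomprod t n ph) ^+ N <=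
    expR (- (N%:R * (bosevar 1 / 1836 * ph ^+ 2 / t ^+ 3))) + expR (- (bosevar 1 / 20 / t)).
Proof.
move=> /andP[t0 t3] nt p4 N0.
pose b : R := bosevar 1.
have b0 : 0 < b by exact: bosevar_gt0.
have b1 : b <= 1 by exact: bosevar_le1.
have i3 : 1 <= (3 * t)^-1 by rewrite invf_ge1 ?mulr_gt0 //; lra.
(* So 3 m t <= 1, which makes the variance bound valid up to k = 3 m, and 6 m t >= 1, which turns m
   back into 1 / t. *)
pose m := Num.truncn (3 * t)^-1.
have /andP[m1 m2] : m%:R <= (3 * t)^-1 < m.+1%:R by apply: truncn_itv; lra.
have m0 : (0 < m)%N by rewrite truncn_gt0.
have mR : 1 <= m%:R :> R by rewrite ler1n.
have mt : 3 * m%:R * t <= 1.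
  by move: m1; rewrite -[(3 * t)^-1]mul1r ler_pdivlMr ?mulr_gt0 //; lra.
have mt6 : 1 <= 6 * m%:R * t.
  move: m2; rewrite -[(3 * t)^-1]mul1r ltr_pdivrMr ?mulr_gt0 // -natr1; nra.
have m3n : (3 * m <= n)%N.
  by rewrite -(ler_nat R) natrM -(ler_pM2r t0); lra.
have g0 : 0 <= nrm (geomprod t n ph) by exact: nrm_ge0.
have g1 := nrm_geomprod_le1 n ph t0.
have kb k : (0 < k <= 3 * m)%N -> 0 < k%:R * t <= 1.
  move=> /andP[k0 km]; rewrite mulr_gt0 ?ltr0n //=; apply: le_trans mt.
  by rewrite ler_pM2r // -natrM ler_nat.
have [pm|pm] := leP `|ph| (2 / m%:R).
  (* The constant 1836 is 2 * 9 * 17 * 6: a square root, the 9 of [q], 1 + Q with Q = 16, and m >= 1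
     / (6 t). *)
  pose q := b * ph ^+ 2 / (9 * t ^+ 2).
  have q0 : 0 <= q.
    by apply: divr_ge0; apply: mulr_ge0; rewrite ?sqr_ge0 ?(ltW b0).
  have q16 : q <= 16.
    rewrite ler_pdivrMr ?mulr_gt0 ?exprn_gt0 // -[ph ^+ 2]real_normK ?num_real //.
    have : `|ph| <= 12 * t.
      apply: le_trans pm _; rewrite ler_pdivrMr ?(lt_le_trans ltr01) //; lra.
    have := normr_ge0 ph; move: `|ph| => x x0 x12.
    have : x ^+ 2 <= 144 * t ^+ 2 by rewrite !expr2; nra.
    have : 0 <= x ^+ 2 by exact: sqr_ge0.
    move: (x ^+ 2) (t ^+ 2) => u v; nra.
  have := @nrm_geomprod_decay t n m ph (fun=> q) 16 t0 _ _.
  move=> /(_ (leq_trans (leq_pmull _ _) m3n)) H.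
  have {}H : nrm (geomprod t n ph) ^+ 2 <= expR (- ((\sum_(1 <= k < m.+1) q) / (1 + 16))).
    apply: H => // k /andP[k0 km]; split; first by rewrite q0.
    have /kb/andP[kt0 kt1] : (0 < k <= 3 * m)%N by rewrite k0 (leq_trans km) // leq_pmull.
    have V := geomu_var_ge t0 k0 kt1.
    have kR : 0 < k%:R :> R by rewrite ltr0n.
    have C : (k%:R * ph) ^+ 2 / 18 <= 1 - cos (k%:R * ph).
      apply: oneBcos_ge; rewrite normrM ger0_norm ?ler0n //.
      apply: (@le_trans _ _ (m%:R * (2 / m%:R))).
        by apply: ler_pM; rewrite ?normr_ge0 ?ler0n // ler_nat.
      by rewrite mulrC divfK ?gt_eqF ?(lt_le_trans ltr01) //; lra.
    have -> : q = 2 * (b / (k%:R * t) ^+ 2) * ((k%:R * ph) ^+ 2 / 18).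
      by rewrite /q; field; rewrite !gt_eqF.
    apply: ler_pM => //; last by rewrite ler_pM2l.
      by apply: mulr_ge0 => //; apply: divr_ge0; rewrite ?(ltW b0) ?sqr_ge0.
    by apply: divr_ge0; rewrite ?sqr_ge0.
  rewrite -[leLHS]addr0; apply: lerD; last exact: expR_ge0.
  rewrite -(@ler_pXn2r _ 2) ?nnegrE ?exprn_ge0 ?expR_ge0 // exprAC.
  apply: (@le_trans _ _ (expR (- ((\sum_(1 <= k < m.+1) q) / (1 + 16))) ^+ N)).
    by rewrite lerXn2r ?nnegrE ?exprn_ge0 ?expR_ge0.
  rewrite -!expRM_natl ler_expR big_const_nat iter_addr addr0 subn1 /= -[q *+ m]mulr_natr.
  have K : 2 * (bosevar 1 / 1836 * ph ^+ 2 / t ^+ 3) <= q * m%:R / (1 + 16).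
    have -> : 2 * (bosevar 1 / 1836 * ph ^+ 2 / t ^+ 3) = q / 17 * (6 * t)^-1.
      by rewrite /q -/b; field; rewrite gt_eqF.
    rewrite [leRHS](_ : _ = q / 17 * m%:R); last by field.
    apply: ler_wpM2l; first by rewrite divr_ge0.
    by rewrite -[(6 * t)^-1]mul1r ler_pdivrMr ?mulr_gt0 //; lra.
  by have := ler_wpM2l (ler0n R N) K; lra.
rewrite -[leLHS]add0r; apply: lerD; first exact: expR_ge0.
apply: (@le_trans _ _ (nrm (geomprod t n ph))).
  by case: N N0 => // N _; rewrite exprS ler_piMr // exprn_ile1.
rewrite -(@ler_pXn2r _ 2) ?nnegrE ?expR_ge0 //.
(* The exponent for the squared modulus is 2 b (3 m / 2) / 5 >= b / (10 t); the square root turns 10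
   into 20. *)
pose q k := 2 * b * (1 - cos (k%:R * ph)).
have := @nrm_geomprod_decay t n (3 * m) ph q 4 t0 m3n.
move=> H; apply: le_trans (H _) _.
  move=> k km; have /andP[kt0 kt1] := kb k km; have /andP[k0 _] := km.
  have V := geomu_var_ge t0 k0 kt1.
  have /andP[c0 _] := oneBcos_le (k%:R * ph); have c2 := cos_geN1 (k%:R * ph).
  split; first by rewrite /q; apply/andP; split; nra.
  rewrite /q ler_wpM2r // ler_pM2l //.
  apply: le_trans V; rewrite ler_peMr ?(ltW b0) // invf_ge1 ?exprn_gt0 //.
  by rewrite exprn_ile1 // ltW.
rewrite -expRM_natl ler_expR mulrN lerN2 /q -mulr_sumr.
have D : (3 * m)%:R / 2 <= \sum_(1 <= k < (3 * m).+1) (1 - cos (k%:R * ph)).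
  have -> : \sum_(1 <= k < (3 * m).+1) (1 - cos (k%:R * ph)) =
     \sum_(1 <= k < (3 * m).+1) (1 - cos (k%:R * `|ph|)).
    apply: eq_bigr => k _; rewrite -[cos (k%:R * ph)]cos_norm normrM ger0_norm ?ler0n //.
  have p0 : 0 < `|ph| by apply: lt_trans pm; apply: divr_gt0 => //; exact: lt_le_trans ltr01 mR.
  apply: sum_oneBcos_ge; first by rewrite p0.
  rewrite natrM; move: pm; rewrite ltr_pdivrMr ?(lt_le_trans ltr01) //; lra.
rewrite natrM in D.
have -> : 2%:R * (bosevar 1 / 20 / t) = b / 10 * t^-1 by rewrite -/b; field; rewrite gt_eqF.
have ti : t^-1 <= 6 * m%:R by rewrite -[t^-1]mul1r ler_pdivrMr //; lra.
set S := \sum_(_ <= _ < _) _ in D *.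
rewrite (_ : 1 + 4 = 5 :> R); last by ring.
have : b / 10 * t^-1 <= b / 10 * (6 * m%:R) by apply: ler_wpM2l => //; lra.
have : b * (3 * m%:R / 2) <= b * S by rewrite ler_pM2l.
lra.
Qed.

End GeometricMoments.

(** * Fourier inversion for the weights *)

Section FourierInversion.
Context {R : realType}.
Local Open Scope complex_scope.
Local Notation toC := (real_complex R).
Implicit Types (t s y : R) (k n N L : nat).

Lemma sin_natpi k : sin (k%:R * pi) = 0 :> R.
Proof.
elim: k => [|k IHk]; first by rewrite mul0r sin0.
by rewrite -natr1 mulrDl mul1r sinDpi IHk oppr0.
Qed.

Lemma sin_natBpi j n : sin ((j%:R - n%:R) * pi) = 0 :> R.
Proof.
have [nj|/ltnW jn] := leqP n j; first by rewrite -natrB // sin_natpi.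
by rewrite -opprB mulNr sinN -natrB // sin_natpi oppr0.
Qed.

Definition weight t N n L k : R :=
  ((Apoly N n L)`_k)%:~R * expR (- t) ^+ k / evalz (expR (- t)) (Apoly N n L).

Lemma Re_charf t N n L (ph : R) d : (size (Apoly N n L) <= d)%N ->
  complex.Re (charf t N n L ph) = \sum_(j < d) weight t N n L j * cos ((j%:R - n%:R) * ph).
Proof.
move=> Ad; rewrite /charf (evalz_coef _ Ad).
have -> : (\sum_(j < d) ((Apoly N n L)`_j)%:~R * polar t ph ^+ j) * cis (- (n%:R * ph)) /
    toC (evalz (expR (- t)) (Apoly N n L)) =
  \sum_(j < d) toC (weight t N n L j) * cis ((j%:R - n%:R) * ph).
  rewrite !mulr_suml; apply: eq_bigr => j _.
  rewrite /weight /polar exprMn cisX mulrBl cisD !rmorphM /= fmorphV rmorph_int rmorphXn /=.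
  by ring.
elim/big_ind2 : _ => [//|? x ? y <- <-|j _].
  by case: x y => [? ?] [? ?].
by rewrite /= mul0r subr0.
Qed.

(** Orthogonality of characters in terms of a primitive: the terms j != n contribute sines of
    integer multiples of pi at the ends. Inversion thereby becomes an increment to which
    [der_abs_le] applies. *)
Lemma fourier_primitive t s N n L : 0 < s -> exists F : R -> R,
  (forall y, is_derive y 1 F (complex.Re (charf t N n L (s * y)))) /\
  F (pi / s) - F (- (pi / s)) = 2 * pi / s * weight t N n L n.
Proof.
move=> s0; pose d := maxn (size (Apoly N n L)) n.+1.
have nd : (n < d)%N by rewrite leq_max leqnn orbT.
pose P (j : nat) y : R := if j == n then y else sin ((j%:R - n%:R) * (s * y)) / ((j%:R - n%:R) * s).
exists (fun y => \sum_(j < d) weight t N n L j * P j y); split.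
  move=> y; rewrite (@Re_charf _ _ _ _ _ d) ?leq_maxl //.
  apply: der_sum => j.
  have [->|jn] := eqVneq (j : nat) n.
    rewrite /P eqxx; apply: (is_derive_eq (derM (der_cst _ _) (der_id _))).
    by rewrite subrr [0 * (s * y)]mul0r cos0 mul0r add0r.
  rewrite /P (negbTE jn); have jn0 : j%:R - n%:R != 0 :> R by rewrite subr_eq0 eqr_nat.
  have d1 := derM (der_cst y (j%:R - n%:R)) (derM (der_cst y s) (der_id y)).
  apply: (is_derive_eq (derM (der_cst _ _) (derM (der_sin d1) (der_cst _ _)))).
  by field; rewrite jn0 gt_eqF.
rewrite -sumrB (bigD1 (Ordinal nd)) //= big1 ?addr0.
  by rewrite /P eqxx; field; rewrite gt_eqF.
move=> j /negbTE jn; rewrite /P.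
have -> : (j : nat) == n = false by rewrite -jn -val_eqE.
have s1 : s != 0 by rewrite gt_eqF.
have -> : s * (pi / s) = pi by rewrite mulrC divfK.
have -> : s * - (pi / s) = - pi by rewrite mulrN mulrC divfK.
by rewrite mulrN sinN sin_natBpi oppr0 !mul0r subrr.
Qed.

Lemma pi_le4 : pi <= 4 :> R.
Proof. by have := @pihalf_lt2 R; rewrite ltr_pdivrMr // => /ltW; lra. Qed.

Lemma ler_norm4 (x1 x2 x3 x4 : R) : `|x1 - x2 - x3 - x4| <= `|x1| + `|x2| + `|x3| + `|x4|.
Proof.
by do 3!(apply: le_trans (ler_normB _ _) _; rewrite lerD2r).
Qed.

End FourierInversion.

(** * The local limit theorem at the saddle point *)

Section LocalLimit.
Context {R : realType}.
Variables (N delta : nat).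
Hypothesis N0 : (0 < N)%N.
Local Open Scope complex_scope.
Local Notation nrm := (@Normc.normc R).
Local Notation toC := (real_complex R).
Implicit Types (y Y : R) (n : nat).
Let c : R := boseint.

(* The saddle point: the mean of the weights is [N * boseint / t ^ 2] to first order in [t], and
   [tsad n] makes it equal to [n + delta]. *)
Definition tsad n : R := Num.sqrt (N%:R * boseint / (maxn 1 (n + delta))%:R).
Let tau n : R := Num.sqrt (tsad n).
(** With ph = sc y, the variance 2 N c / t^3 is rescaled to 2 c, so the limit is exp (- c y^2). All
    errors are measured in [tau], the square root of t. *)
Let sc n : R := tau n ^+ 3 / Num.sqrt N%:R.

Let c0 : 0 < c. Proof. exact: boseint_gt0. Qed.
Let NR : 0 < N%:R :> R. Proof. by rewrite ltr0n. Qed.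
Let NR1 : 1 <= N%:R :> R. Proof. by rewrite ler1n. Qed.

Lemma tsad_gt0 n : 0 < tsad n.
Proof. by rewrite sqrtr_gt0 divr_gt0 ?mulr_gt0 ?boseint_gt0 // ltr0n leq_max. Qed.

Let tau0 n : 0 < tau n. Proof. by rewrite sqrtr_gt0 tsad_gt0. Qed.

Let tau2 n : tau n ^+ 2 = tsad n.
Proof. by rewrite sqr_sqrtr // ltW // tsad_gt0. Qed.

Let sN0 : 0 < Num.sqrt N%:R :> R. Proof. by rewrite sqrtr_gt0. Qed.
Let sN1 : 1 <= Num.sqrt N%:R :> R. Proof. by rewrite -[leLHS]sqrtr1 ler_sqrt. Qed.

Let sc0 n : 0 < sc n. Proof. by rewrite divr_gt0 // exprn_gt0. Qed.
Let sc2 n : sc n ^+ 2 = tsad n ^+ 3 / N%:R.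
Proof. by rewrite exprMn exprVn sqr_sqrtr ?ler0n // exprAC tau2. Qed.
Let scle n : sc n <= tau n ^+ 3.
Proof. by rewrite ler_pdivrMr // ler_peMr // exprn_ge0 // ltW. Qed.

Lemma tsad_sqr n : (0 < n)%N -> tsad n ^+ 2 * (n%:R + delta%:R) = N%:R * boseint.
Proof.
move=> n0; rewrite sqr_sqrtr; last by rewrite divr_ge0 ?mulr_ge0 ?ler0n ?ltW ?boseint_gt0.
have -> : maxn 1 (n + delta) = (n + delta)%N by apply/maxn_idPr; rewrite ltn_addr.
by rewrite -natrD divfK // pnatr_eq0 -lt0n ltn_addr.
Qed.

Lemma cvg_tsad : tsad @ \oo --> (0 : R).
Proof.
rewrite -[X in _ --> X]sqrtr0; apply: continuous_cvg; first exact: sqrt_continuous.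
rewrite -[X in _ --> X](mulr0 (N%:R * boseint)); apply: cvgM; first exact: cvg_cst.
apply: (@cvg_comp _ _ _ (fun n => maxn 1 (n + delta)) (fun k => k%:R^-1 : R) _ \oo); last first.
  by rewrite -cvg_shiftS; exact: cvg_harmonic.
apply/cvgnyPge => A; near=> n; rewrite leq_max; apply/orP; right.
by rewrite (@leq_trans n) ?leq_addr //; near: n; exact: nbhs_infty_ge.
Unshelve. all: end_near. Qed.

Let cvg_tau : tau @ \oo --> (0 : R).
Proof.
rewrite -[X in _ --> X]sqrtr0; apply: continuous_cvg; first exact: sqrt_continuous.
exact: cvg_tsad.
Qed.

Lemma expRN_le3 (x : R) : 0 < x -> expR (- x) <= 6 / x ^+ 3.
Proof.
move=> x0; rewrite expRN -[leRHS]invf_div lef_pV2 ?posrE ?expR_gt0 ?divr_gt0 ?exprn_gt0 //.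
have := @expR_ge1Dxn R x 2 (ltW x0).
have -> : (3`!)%:R = 6 :> R by [].
lra.
Qed.

(* [tsad n * n] is at least of the order of [1 / tsad n], so that [exp (- tsad n * n / 2)] is
   smaller than any power of [tsad n]. *)
Lemma expR_tsad_le n : (0 < n)%N -> (delta <= n)%N ->
  expR (- (n%:R * tsad n / 2)) <= 384 / (N%:R * boseint) ^+ 3 * tsad n ^+ 3.
Proof.
move=> n0 dn; have t0 := tsad_gt0 n; have Nc : 0 < N%:R * c by rewrite mulr_gt0.
have x0 : 0 < N%:R * c / (4 * tsad n) by rewrite divr_gt0 ?mulr_gt0.
apply: (@le_trans _ _ (expR (- (N%:R * c / (4 * tsad n))))).
  rewrite ler_expR lerN2 ler_pdivrMr ?mulr_gt0 // /c -(tsad_sqr n0).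
  have : delta%:R <= n%:R :> R by rewrite ler_nat.
  have := sqr_ge0 (tsad n).
  have -> : n%:R * tsad n / 2 * (4 * tsad n) = tsad n ^+ 2 * (2 * n%:R) by field.
  by move=> h1 h2; apply: ler_wpM2l => //; lra.
apply: le_trans (expRN_le3 x0) _; rewrite le_eqVlt; apply/orP; left; apply/eqP.
by rewrite /c; field; rewrite !gt_eqF.
Qed.

(** The box size at which [theta_poly_coef] is exact up to degree n; it also grows fast enough for
    the Gaussian sums by [cvg_sqrt_tsad]. *)
Let L n := (2 * n)%N.
Let cf n y := charf (tsad n) N n (L n) (sc n * y).

Let near_small (e : R) : 0 < e -> \forall n \near \oo, tau n <= e.
Proof. by move=> e0; apply: (cvgr_le _ cvg_tau). Qed.

Let tsad_tau n : tau n <= 1 -> tsad n <= tau n.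
Proof. by move=> t1; rewrite -tau2 expr2 ler_piMr // ltW. Qed.

Lemma cvg_sqrt_tsad : (fun n => Num.sqrt (tsad n) * (2 * n)%:R) @ \oo --> +oo.
Proof.
apply/cvgryPge => A; have A0 : 0 < `|A| + 1 by have := normr_ge0 A; lra.
have Nc : 0 < N%:R * c by rewrite mulr_gt0.
near=> n; rewrite -/(tau n).
have n0 : (0 < n)%N by near: n; exact: nbhs_infty_gt.
have dn : delta%:R <= n%:R :> R by rewrite ler_nat; near: n; exact: nbhs_infty_ge.
have t1 : tau n <= 1 by near: n; exact: near_small.
have tA : tau n <= N%:R * c / (`|A| + 1) by near: n; apply: near_small; rewrite divr_gt0.
have t30 : 0 < tau n ^+ 3 by rewrite exprn_gt0.
rewrite -(ler_pM2l t30) mulrA -exprSr natrM.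
have -> : tau n ^+ 4 = tsad n ^+ 2 by rewrite -tau2 -exprM.
apply: (@le_trans _ _ (N%:R * c)); last first.
  by rewrite /c -(tsad_sqr n0); apply: ler_wpM2l; [exact: sqr_ge0 | lra].
have t3 : tau n ^+ 3 <= tau n by rewrite exprS ler_piMr ?exprn_ile1 // ltW.
apply: (@le_trans _ _ (tau n * (`|A| + 1))); last by rewrite -ler_pdivlMr.
apply: (@le_trans _ _ (tau n ^+ 3 * (`|A| + 1))); first by rewrite ler_pM2l //; have := ler_norm A; lra.
by rewrite ler_pM2r.
Unshelve. all: end_near. Qed.

Let K1 : R := 384 / (N%:R * boseint) ^+ 3.
Let K10 : 0 < K1.
Proof.
apply: divr_gt0; first by rewrite ltr0n.
by apply: exprn_gt0; apply: mulr_gt0 => //; exact: boseint_gt0.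
Qed.

Let n_tsad n : (0 < n)%N -> n%:R * tsad n ^+ 2 <= N%:R * c.
Proof.
move=> n0; rewrite /c -(tsad_sqr n0) mulrC; apply: ler_wpM2l; first exact: sqr_ge0.
by rewrite lerDl ler0n.
Qed.

(** n exp (- n t) is at most (n t^2) K1^2 t^4, by squaring [expR_tsad_le] and since n t^2 is
    bounded. *)
Let trunc_err : exists2 K : R, 0 <= K & \forall n \near \oo,
  expR (N%:R * (n%:R * expR (- tsad n) ^+ n.+1)) - 1 <= K * tau n.
Proof.
pose K2 := N%:R * (N%:R * c * K1 ^+ 2).
have K20 : 0 < K2.
  apply: mulr_gt0 => //; apply: mulr_gt0; [exact: mulr_gt0 | exact: exprn_gt0].
exists (2 * K2); first by rewrite mulr_ge0 // ltW.
near=> n.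
have n0 : (0 < n)%N by near: n; exact: nbhs_infty_gt.
have dn : (delta <= n)%N by near: n; exact: nbhs_infty_ge.
have t1 : tau n <= 1 by near: n; exact: near_small.
have tK : tau n <= (2 * K2)^-1 by near: n; apply: near_small; rewrite invr_gt0 mulr_gt0.
have t0 := tsad_gt0 n; have tt := tsad_tau t1.
set x := N%:R * _.
have xK : x <= K2 * tau n.
  have E : expR (- tsad n) ^+ n.+1 <= (K1 * tsad n ^+ 3) ^+ 2.
    apply: (@le_trans _ _ (expR (- (n%:R * tsad n / 2)) ^+ 2)).
      rewrite -!expRM_natl ler_expR -natr1.
      by rewrite [leRHS](_ : _ = - (n%:R * tsad n)); [lra | field].
    by rewrite lerXn2r ?nnegrE ?expR_ge0 ?expR_tsad_le // mulr_ge0 ?exprn_ge0 ?ltW.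
  rewrite /x /K2 -mulrA ler_pM2l //.
  apply: (@le_trans _ _ (n%:R * (K1 * tsad n ^+ 3) ^+ 2)).
    by apply: ler_wpM2l => //; exact: ler0n.
  have -> : n%:R * (K1 * tsad n ^+ 3) ^+ 2 = n%:R * tsad n ^+ 2 * K1 ^+ 2 * tsad n ^+ 4 by ring.
  apply: ler_pM.
  - apply: mulr_ge0; last exact: sqr_ge0.
    by apply: mulr_ge0; [exact: ler0n | exact: sqr_ge0].
  - by rewrite exprn_ge0 ?ltW.
  - by rewrite ler_pM2r ?exprn_gt0 // n_tsad.
  - rewrite exprS; apply: (@le_trans _ _ (tsad n)) => //; apply: ler_piMr; first exact: ltW.
    by rewrite exprn_ile1 ?(ltW t0) // (le_trans tt t1).
have x0 : 0 <= x by rewrite !mulr_ge0 ?ler0n ?exprn_ge0 ?expR_ge0.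
have x2 : x <= 2^-1.
  apply: le_trans xK _; rewrite mulrC -ler_pdivlMr //; apply: le_trans tK _.
  by rewrite invfM.
have : expR x <= 1 + 2 * x.
  rewrite -[expR x]invrK -expRN -[leRHS]invrK lef_pV2 ?posrE ?expR_gt0 ?invr_gt0 //; last by lra.
  apply: le_trans (expR_ge1Dx _); rewrite -[(1 + 2 * x)^-1]mul1r ler_pdivrMr; last by lra.
  nra.
lra.
Unshelve. all: end_near. Qed.

Let expRB_le (p q : R) : 0 <= p -> 0 <= q -> `|expR (- p) - expR (- q)| <= `|p - q|.
Proof.
suff H (a b : R) : 0 <= a -> a <= b -> `|expR (- a) - expR (- b)| <= b - a.
  move=> p0 q0; have [pq|/ltW qp] := leP p q.
    by rewrite [leRHS]distrC [leRHS]ger0_norm ?subr_ge0 ?H.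
  by rewrite distrC [leRHS]ger0_norm ?subr_ge0 ?H.
move=> a0 ab; rewrite ger0_norm; last by rewrite subr_ge0 ler_expR lerN2.
have -> : expR (- b) = expR (- a) * expR (- (b - a)) by rewrite -expRD; congr expR; ring.
have e1 : expR (- a) <= 1 by rewrite expR_le1 oppr_le0.
have := expR_ge1Dx (- (b - a)); have := expR_gt0 (- a); have := expR_gt0 (- (b - a)).
have : expR (- (b - a)) <= 1 by rewrite expR_le1 oppr_le0 subr_ge0.
move: (expR _) (expR _) e1 => u v; nra.
Qed.

(** Uniform only up to the polynomial 1 + |y|^3, which is enough on a fixed window; beyond it
    [charf_tail] provides domination over the whole period. *)
Let charf_gauss : exists K : R, \forall n \near \oo, forall y,
  sc n * `|y| <= tsad n ->
  `|complex.Re (cf n y) - expR (- (c * y ^+ 2))| <= K * (1 + `|y| ^+ 3) * tau n.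
Proof.
have [Ke Ke0 He] := trunc_err.
have [C HC] := theta_moment N.-1 tsad_gt0 cvg_tsad cvg_sqrt_tsad.
(* [A1] bounds the third-moment error (264 = 8 * 33 from [gthird_le]), [A2] the recentring of the
   mean, [A3] the theta variable, [A5] the variance; 4 [Ke] is the truncation. *)
pose A1 := N%:R * (264 * (c + 3)); pose A2 := 2 * (N%:R * (1 + 2 * K1) + delta%:R).
pose A3 := 2 * `|C|; pose A5 := (3 + 4 * K1 + N%:R * c * K1) / 2.
exists (A1 + A2 + A3 + 4 * Ke + A5); near=> n => y.
set a := `|y| => sa.
have n0 : (0 < n)%N by near: n; exact: nbhs_infty_gt.
have dn : (delta <= n)%N by near: n; exact: nbhs_infty_ge.
have t1 : tau n <= 1 by near: n; exact: near_small.
have tK : Ke * tau n <= 2^-1.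
  have : tau n <= (2 * (Ke + 1))^-1 by near: n; apply: near_small; rewrite invr_gt0; lra.
  rewrite -[_^-1]mul1r ler_pdivlMr; last by lra.
  by have := tau0 n; nra.
have e1 : expR (N%:R * (n%:R * expR (- tsad n) ^+ n.+1)) - 1 <= Ke * tau n by near: n.
have mC : tsad n * (\sum_(s <- box (L n) N.-1) (thetas s)%:R * expR (- tsad n) ^+ thetas s) <=
      `|C| * thsum (tsad n) 1 (L n) N.-1.
  apply: (@le_trans _ _ (C * thsum (tsad n) 1 (L n) N.-1)); first by near: n.
  by rewrite ler_pM2r ?thsum_gt0 // ler_norm.
have t0 := tsad_gt0 n; have tt := tsad_tau t1; have tn := tau0 n.
have a0 : 0 <= a by exact: normr_ge0.
have pa : `|sc n * y| = sc n * a by rewrite normrM gtr0_norm.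
have pt : `|sc n * y| <= tsad n by rewrite pa.
have := charf_approx t0 N0 pt mC (le_trans e1 tK).
rewrite -/(cf n y) pa.
set E0 := expR (- (n%:R * tsad n / 2)).
have EK : E0 <= K1 * tsad n ^+ 3 by exact: expR_tsad_le.
have EK1 : E0 <= K1 * tsad n.
  apply: le_trans EK _; rewrite ler_pM2l // exprS; apply: ler_piMr; first exact: ltW.
  by rewrite exprn_ile1 ?(ltW t0) // (le_trans tt t1).
have E00 : 0 < E0 by exact: expR_gt0.
have tau3 : tau n ^+ 3 = tau n * tsad n by rewrite exprS tau2.
have scn : 0 < sc n := sc0 n.
have scle' : sc n <= tau n * tsad n by rewrite -tau3.
have q1 : N%:R * (8 * (sc n * a) ^+ 3 * gthird (tsad n) n) <= A1 * a ^+ 3 * tau n.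
  have g := @gthird_le _ (tsad n) n; rewrite t0 (le_trans tt t1) in g.
  have s3 : (sc n * a) ^+ 3 <= (tau n * tsad n * a) ^+ 3.
    apply: lerXn2r; rewrite ?nnegrE; [ | | exact: ler_wpM2r].
      by apply: mulr_ge0 => //; exact: ltW.
    by apply: mulr_ge0 => //; apply: mulr_ge0; exact: ltW.
  have s30 : 0 <= (sc n * a) ^+ 3 by apply: exprn_ge0; apply: mulr_ge0 => //; exact: ltW.
  have g0 : 0 <= 33 * (c + 3) / tsad n ^+ 4.
    by apply: divr_ge0; [apply: mulr_ge0 => //; apply: addr_ge0 => //; exact: ltW |
      apply: exprn_ge0; exact: ltW].
  have -> : A1 * a ^+ 3 * tau n =
      N%:R * (8 * ((tau n * tsad n * a) ^+ 3 * (33 * (c + 3) / tsad n ^+ 4))).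
    by rewrite /A1 -tau2; field; rewrite gt_eqF.
  rewrite -[8 * _ * _]mulrA; apply: ler_wpM2l; first exact: ltW.
  apply: ler_wpM2l => //.
  apply: (@le_trans _ _ ((sc n * a) ^+ 3 * (33 * (c + 3) / tsad n ^+ 4))).
    by apply: ler_wpM2l => //; exact: g.
  exact: ler_wpM2r.
have q2 : 2 * `|N%:R * gmean (tsad n) n - n%:R| * (sc n * a) <= A2 * a * tau n.
  have E : N%:R * gmean (tsad n) n - n%:R =
      N%:R * (gmean (tsad n) n - boseint / tsad n ^+ 2) + delta%:R.
    have : N%:R * boseint / tsad n ^+ 2 = n%:R + delta%:R :> R.
      by rewrite -(tsad_sqr n0) mulrC mulKf // expf_neq0 // gt_eqF.
    by rewrite mulrBr mulrA => ->; ring.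
  have B : `|N%:R * gmean (tsad n) n - n%:R| <= N%:R * ((1 + 2 * K1) / tsad n) + delta%:R.
    rewrite E; apply: le_trans (ler_normD _ _) _; rewrite (ger0_norm (ler0n R delta)).
    rewrite lerD2r normrM (gtr0_norm NR) ler_pM2l //.
    apply: le_trans (gmean_near t0 n0) _; rewrite -/E0 ler_pdivrMr ?exprn_gt0 //.
    have -> : (1 + 2 * K1) / tsad n * tsad n ^+ 2 = (1 + 2 * K1) * tsad n.
      by field; rewrite gt_eqF.
    have := EK1; lra.
  have -> : 2 * `|N%:R * gmean (tsad n) n - n%:R| * (sc n * a) =
      2 * a * (`|N%:R * gmean (tsad n) n - n%:R| * sc n) by ring.
  have -> : A2 * a * tau n = 2 * a * ((N%:R * (1 + 2 * K1) + delta%:R) * tau n) by rewrite /A2; ring.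
  apply: ler_wpM2l; first by rewrite mulr_ge0.
  apply: le_trans (ler_pM _ _ B scle') _ => //; first exact: ltW.
  have -> : (N%:R * ((1 + 2 * K1) / tsad n) + delta%:R) * (tau n * tsad n) =
    N%:R * (1 + 2 * K1) * tau n + delta%:R * tau n * tsad n by field; rewrite gt_eqF.
  rewrite [leRHS]mulrDl lerD2l; apply: ler_piMr; last exact: le_trans tt t1.
  by rewrite mulr_ge0 ?ler0n // ltW.
have q3 : 2 * (sc n * a) * `|C| / tsad n <= A3 * a * tau n.
  rewrite ler_pdivrMr //.
  have -> : A3 * a * tau n * tsad n = 2 * a * `|C| * (tau n * tsad n) by rewrite /A3; ring.
  have -> : 2 * (sc n * a) * `|C| = 2 * a * `|C| * sc n by ring.
  by apply: ler_wpM2l => //; rewrite !mulr_ge0 ?normr_ge0.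
have q5 : `|expR (- (N%:R * ((sc n * y) ^+ 2 / 2 * gvar (tsad n) n))) - expR (- (c * y ^+ 2))| <=
    A5 * a ^+ 2 * tau n.
  have -> : N%:R * ((sc n * y) ^+ 2 / 2 * gvar (tsad n) n) = y ^+ 2 / 2 * (tsad n ^+ 3 * gvar (tsad n) n).
    by rewrite exprMn sc2; field; rewrite gt_eqF.
  have y20 : 0 <= y ^+ 2 / 2 by rewrite divr_ge0 ?sqr_ge0.
  apply: le_trans (expRB_le _ _) _.
  - apply: mulr_ge0 => //; apply: mulr_ge0; last exact: gvar_ge0.
    by apply: exprn_ge0; exact: ltW.
  - by apply: mulr_ge0; [exact: ltW | exact: sqr_ge0].
  have -> : y ^+ 2 / 2 * (tsad n ^+ 3 * gvar (tsad n) n) - c * y ^+ 2 =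
      y ^+ 2 / 2 * (tsad n ^+ 3 * gvar (tsad n) n - 2 * boseint) by rewrite /c; field.
  rewrite normrM (ger0_norm y20).
  have -> : A5 * a ^+ 2 * tau n = y ^+ 2 / 2 * ((3 + 4 * K1 + N%:R * c * K1) * tau n).
    by rewrite /A5 real_normK ?num_real //; field.
  apply: ler_wpM2l => //; apply: le_trans (gvar_near t0 n0) _; rewrite -/E0.
  have w1 : n%:R * tsad n * E0 <= N%:R * c * K1 * tau n.
    apply: (@le_trans _ _ (n%:R * tsad n * (K1 * tsad n ^+ 3))).
      by apply: ler_wpM2l => //; rewrite mulr_ge0 ?ler0n // ltW.
    have -> : n%:R * tsad n * (K1 * tsad n ^+ 3) = n%:R * tsad n ^+ 2 * (K1 * tsad n ^+ 2) by ring.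
    rewrite -[leRHS]mulrA; apply: ler_pM.
    - by rewrite mulr_ge0 ?ler0n ?exprn_ge0 // ltW.
    - by apply: mulr_ge0; [exact: ltW | apply: exprn_ge0; exact: ltW].
    - exact: n_tsad.
    - rewrite ler_pM2l // expr2; apply: (le_trans _ tt); apply: ler_piMr; first exact: ltW.
      exact: le_trans tt t1.
  have w2 : E0 <= K1 * tau n by apply: le_trans EK1 _; rewrite ler_pM2l.
  have := tt; lra.
move=> H; have R1 := Re_le_nrm (cf n y - toC (expR (- (N%:R * ((sc n * y) ^+ 2 / 2 * gvar (tsad n) n))))).
have -> : complex.Re (cf n y) - expR (- (c * y ^+ 2)) =
  complex.Re (cf n y - toC (expR (- (N%:R * ((sc n * y) ^+ 2 / 2 * gvar (tsad n) n))))) +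
  (expR (- (N%:R * ((sc n * y) ^+ 2 / 2 * gvar (tsad n) n))) - expR (- (c * y ^+ 2))).
  by case: (cf n y) => u v /=; ring.
apply: le_trans (ler_normD _ _) _.
have x1 : a <= 1 + a ^+ 3 by case: (leP a 1) => ?; rewrite ?exprS ?expr0; nra.
have x2 : a ^+ 2 <= 1 + a ^+ 3 by case: (leP a 1) => ?; rewrite ?exprS ?expr0; nra.
have x3 : a ^+ 3 <= 1 + a ^+ 3 by lra.
have x4 : 1 <= 1 + a ^+ 3 by rewrite lerDl exprn_ge0.
have A10 : 0 <= A1.
  apply: mulr_ge0; first exact: ltW.
  by apply: mulr_ge0 => //; apply: addr_ge0 => //; exact: ltW.
have A20 : 0 <= A2.
  apply: mulr_ge0 => //; apply: addr_ge0; last exact: ler0n.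
  apply: mulr_ge0; first exact: ltW.
  by apply: addr_ge0 => //; apply: mulr_ge0 => //; exact: ltW.
have A30 : 0 <= A3 by exact: mulr_ge0.
have A50 : 0 <= A5.
  apply: divr_ge0 => //; apply: addr_ge0; last first.
    by apply: mulr_ge0; [apply: mulr_ge0; exact: ltW | exact: ltW].
  by apply: addr_ge0 => //; apply: mulr_ge0 => //; exact: ltW.
have mono (A x : R) : 0 <= A -> x <= 1 + a ^+ 3 -> A * x * tau n <= A * (1 + a ^+ 3) * tau n.
  by move=> ? ?; rewrite ler_pM2r // ler_wpM2l.
have m1 := mono _ _ A10 x3; have m2 := mono _ _ A20 x1; have m3 := mono _ _ A30 x1.
have m4 := mono _ _ Ke0 x4; have m5 := mono _ _ A50 x2.
rewrite mulr1 in m4; lra.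
Unshelve. all: end_near. Qed.

Let charf_tail : \forall n \near \oo, forall y, sc n * `|y| <= 4 ->
  `|complex.Re (cf n y)| <=
    3 * (expR (- (bosevar 1 / 1836 * y ^+ 2)) + expR (- (bosevar 1 / 20 / tsad n))).
Proof.
have [Ke Ke0 He] := trunc_err; near=> n => y y4.
have n0 : (0 < n)%N by near: n; exact: nbhs_infty_gt.
have dn : delta%:R <= n%:R :> R by rewrite ler_nat; near: n; exact: nbhs_infty_ge.
have t1 : tau n <= 1 by near: n; exact: near_small.
have t3 : tau n <= 3^-1 by near: n; exact: near_small.
have tc : tau n <= N%:R * c / 2 by near: n; apply: near_small; rewrite divr_gt0 ?mulr_gt0.
have tK : Ke * tau n <= 2^-1.
  have : tau n <= (2 * (Ke + 1))^-1 by near: n; apply: near_small; rewrite invr_gt0; lra.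
  rewrite -[_^-1]mul1r ler_pdivlMr; last by lra.
  by have := tau0 n; nra.
have e1 : expR (N%:R * (n%:R * expR (- tsad n) ^+ n.+1)) - 1 <= Ke * tau n by near: n.
have t0 := tsad_gt0 n; have tt := tsad_tau t1.
apply: le_trans (Re_le_nrm _) _.
apply: le_trans (nrm_charf_le _ _ t0 N0 (le_trans e1 tK)) _.
rewrite ler_pM2l //.
have -> : bosevar 1 / 1836 * y ^+ 2 =
    N%:R * (bosevar 1 / 1836 * (sc n * y) ^+ 2 / tsad n ^+ 3) :> R.
  by rewrite exprMn sc2; field; rewrite !gt_eqF.
apply: geomprod_tail => //.
- by rewrite t0 (le_trans tt t3).
- rewrite -(ler_pM2r t0) mul1r.
  apply: le_trans (le_trans tt tc) _; rewrite /c -(tsad_sqr n0).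
  have -> : n%:R * tsad n * tsad n = tsad n ^+ 2 * n%:R by ring.
  by rewrite -mulrA; apply: ler_wpM2l; [exact: sqr_ge0 | lra].
- by rewrite normrM gtr0_norm.
Unshelve. all: end_near. Qed.

Lemma expR_tail_small (A s e : R) : 0 < A -> 0 < s -> 0 < e ->
  forall Y, (1 + A / e) / s <= Y -> A * expR (1 - s * Y) <= e.
Proof.
move=> A0 s0 e0 Y; rewrite ler_pdivrMr // => Ys.
have Ae : 0 < A / e by rewrite divr_gt0.
apply: (@le_trans _ _ (A * expR (- (A / e)))).
  by rewrite ler_pM2l // ler_expR; lra.
rewrite expRN ler_pdivrMr ?expR_gt0 //.
have := expR_ge1Dx (A / e); rewrite -(ler_pM2l e0) => h; apply: le_trans h.
have -> : e * (1 + A / e) = e + A by field; rewrite gt_eqF.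
lra.
Qed.

(** Dominated convergence by hand: the inversion formula is compared with the Gaussian primitive on
    a fixed window [-Y, Y], and the rest of the period is bounded by the primitive [H] of the tail
    majorant. *)
Lemma local_limit :
  (fun n => 2 * pi / (Num.sqrt (tsad n) ^+ 3 / Num.sqrt N%:R) * weight (tsad n) N n (2 * n) n)
    @ \oo --> gaussint / Num.sqrt boseint.
Proof.
apply/cvgrPdist_le => e e0.
have [K HK] := charf_gauss.
pose q : R := Num.sqrt c; have q0 : 0 < q by rewrite sqrtr_gt0.
pose b : R := bosevar 1 / 1836; have b0 : 0 < b by apply: divr_gt0; [exact: bosevar_gt0 | rewrite ltr0n].
pose b2 : R := bosevar 1 / 20; have b20 : 0 < b2 by apply: divr_gt0; [exact: bosevar_gt0 | rewrite ltr0n].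
pose p : R := Num.sqrt b; have p0 : 0 < p by rewrite sqrtr_gt0.
have e4 : 0 < e / 4 by rewrite divr_gt0.
have q20 : 0 < 2 / q by rewrite divr_gt0.
have p20 : 0 < 6 / p by rewrite divr_gt0.
have Hq := expR_tail_small q20 q0 e4; have Hp := expR_tail_small p20 p0 e4.
(* Large enough that the tails of the limiting Gaussian and of the majorant are each at most e /
   4. *)
pose Y : R := (1 + 2 / q / (e / 4)) / q + (1 + 6 / p / (e / 4)) / p.
have Y1 : 0 < (1 + 2 / q / (e / 4)) / q by rewrite divr_gt0 // addr_gt0 // divr_gt0.
have Y2 : 0 < (1 + 6 / p / (e / 4)) / p by rewrite divr_gt0 // addr_gt0 // divr_gt0.
have Y0 : 0 < Y by rewrite addr_gt0.
have {}Hq : 2 / q * expR (1 - q * Y) <= e / 4 by apply: Hq; rewrite /Y; lra.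
have {}Hp : 6 / p * expR (1 - p * Y) <= e / 4 by apply: Hp; rewrite /Y; lra.
move: Y Y0 Hq Hp {Y1 Y2} => Y Y0 Hq Hp.
(* The coefficient of [tau] in the remaining error: the window, then the non-Gaussian part of both
   tails (144 = 6 * 24), plus 1. *)
pose B : R := 2 * Y * (`|K| * (1 + Y ^+ 3)) + 144 * Num.sqrt N%:R / b2 ^+ 3 + 1.
have B1 : 0 <= 2 * Y * (`|K| * (1 + Y ^+ 3)).
  apply: mulr_ge0; first by rewrite mulr_ge0 // ltW.
  by rewrite mulr_ge0 // addr_ge0 // exprn_ge0 // ltW.
have B2 : 0 <= 144 * Num.sqrt N%:R / b2 ^+ 3.
  by apply: divr_ge0; [apply: mulr_ge0; [rewrite ler0n | exact: ltW] | apply: exprn_ge0; exact: ltW].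
have B0 : 0 < B by rewrite /B; lra.
near=> n.
have t0 := tsad_gt0 n; have tn := tau0 n; have scn := sc0 n.
have t1 : tau n <= 1 by near: n; exact: near_small.
have tY : tau n <= Y^-1 by near: n; apply: near_small; rewrite invr_gt0.
have tB : tau n <= e / 2 / B by near: n; apply: near_small; rewrite divr_gt0 // divr_gt0.
have HG : forall y, sc n * `|y| <= tsad n ->
  `|complex.Re (cf n y) - expR (- (c * y ^+ 2))| <= K * (1 + `|y| ^+ 3) * tau n by near: n.
have HT : forall y, sc n * `|y| <= 4 -> `|complex.Re (cf n y)| <=
    3 * (expR (- (b * y ^+ 2)) + expR (- (b2 / tsad n))) by near: n; exact: charf_tail.
have tt := tsad_tau t1.
have scY : sc n * Y <= tsad n.
  apply: (@le_trans _ _ (tau n ^+ 3 * Y)); first by rewrite ler_pM2r.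
  rewrite exprSr tau2 -mulrA; apply: ler_piMr; first exact: ltW.
  by rewrite -ler_pdivlMr // div1r.
have pi2 : 2 <= pi :> R := pi_ge2 R.
have pi4 := @pi_le4 R.
set T := pi / sc n.
have YT : Y <= T.
  rewrite ler_pdivlMr // mulrC; apply: le_trans scY _; apply: le_trans tt _.
  by apply: le_trans t1 _; lra.
have [F [dF FT]] := @fourier_primitive R (tsad n) (sc n) N n (L n) scn.
change (`|gaussint / q - 2 * pi / sc n * weight (tsad n) N n (L n) n| <= e).
rewrite -FT -/T.
have cF y : {for y, continuous F} by exact: der_continuous (dF y).
pose G y : R := erf (q * y) / q.
have dG y : is_derive y 1 G (expR (- (c * y ^+ 2))).
  have d1 := der_comp (der_erf (q * y)) (derM (der_cst y q) (der_id y)).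
  apply: (is_derive_eq (derM d1 (der_cst y q^-1))).
  rewrite /gauss exprMn sqr_sqrtr ?ltW //.
  by field; rewrite gt_eqF.
pose eta := expR (- (b2 / tsad n)).
pose H y : R := 3 * (erf (p * y) / p + eta * y).
have dH y : is_derive y 1 H (3 * (expR (- (b * y ^+ 2)) + eta)).
  have d1 := der_comp (der_erf (p * y)) (derM (der_cst y p) (der_id y)).
  apply: (is_derive_eq (derM (der_cst y 3) (derD (derM d1 (der_cst y p^-1)) (derM (der_cst y eta) (der_id y))))).
  rewrite /gauss exprMn sqr_sqrtr ?ltW //.
  by field; rewrite gt_eqF.
have cH y : {for y, continuous H} by exact: der_continuous (dH y).
have tail (x1 x2 : R) : - T <= x1 -> x1 <= x2 -> x2 <= T -> `|F x2 - F x1| <= H x2 - H x1.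
  move=> h1 h2 h3; apply: (@der_abs_le _ F _ H) => // y /andP[y1 y2].
  apply: HT; rewrite mulrC -ler_pdivlMr //.
  apply: (@le_trans _ _ T); last by rewrite ler_pdivrMr // divfK ?gt_eqF.
  by rewrite ler_norml (le_trans h1 (ltW y1)) (le_trans (ltW y2) h3).
have NT : - T <= - Y by rewrite lerN2.
have tail1 := tail Y T ltac:(lra) YT (lexx _).
have tail2 := tail (- T) (- Y) (lexx _) NT ltac:(lra).
have HN y : H (- y) = - H y by rewrite /H !mulrN erfN; ring.
rewrite !HN in tail2.
pose M := `|K| * (1 + Y ^+ 3) * tau n.
have mid : `|(F Y - G Y) - (F (- Y) - G (- Y))| <= M * Y - M * (- Y).
  have dM y : is_derive y 1 (fun y => M * y) M.
    by apply: (is_derive_eq (derM (der_cst y M) (der_id y))); ring.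
  have dFG y : is_derive y 1 (fun y => F y - G y) (complex.Re (cf n y) - expR (- (c * y ^+ 2))).
    exact: derD (dF y) (derN (dG y)).
  apply: (@der_abs_le _ (fun y => F y - G y) _ (fun y => M * y)) => //.
  - lra.
  - by move=> y _; exact: der_continuous (dFG y).
  - by move=> y _; exact: der_continuous (dM y).
  move=> y /andP[y1 y2].
  have ay : `|y| <= Y by rewrite ler_norml !ltW.
  apply: le_trans (HG y _) _; first by apply: le_trans scY; rewrite ler_pM2l.
  rewrite /M ler_pM2r //; apply: (@le_trans _ _ (`|K| * (1 + `|y| ^+ 3))).
    by apply: ler_wpM2r; [rewrite addr_ge0 ?exprn_ge0 | exact: ler_norm].
  by apply: ler_wpM2l => //; rewrite lerD2l lerXn2r ?nnegrE // ltW.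
have HTY : H T - H Y <= 3 * (expR (1 - p * Y) / p + eta * T).
  have := @erf_tail R (p * Y) (p * T); rewrite ler_pM2l // => /(_ YT) h.
  have h' : erf (p * T) / p - erf (p * Y) / p <= expR (1 - p * Y) / p.
    by rewrite -mulrBl ler_pM2r ?invr_gt0.
  have : 0 <= eta * Y by rewrite mulr_ge0 ?expR_ge0 // ltW.
  by rewrite /H; lra.
(* Although the period has length of order t^(-3/2), the constant part exp (- b2 / t) of the
   majorant wins. *)
have etaT : eta * T <= 24 * Num.sqrt N%:R / b2 ^+ 3 * tau n.
  have h1 : eta <= 6 / (b2 / tsad n) ^+ 3 by apply: expRN_le3; rewrite divr_gt0.
  have h2 : T <= 4 / sc n by rewrite ler_pM2r ?invr_gt0.
  apply: le_trans (ler_pM _ _ h1 h2) _; rewrite ?expR_ge0 //.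
    by apply: le_trans YT; exact: ltW.
  have -> : 6 / (b2 / tsad n) ^+ 3 * (4 / sc n) = 24 * Num.sqrt N%:R / b2 ^+ 3 * tau n ^+ 3.
    rewrite /sc -(tau2 n); field; rewrite gt_eqF // gt_eqF //= gt_eqF //.
  apply: ler_wpM2l; first by apply: divr_ge0;
    [apply: mulr_ge0; [rewrite ler0n | exact: ltW] | apply: exprn_ge0; exact: ltW].
  by rewrite exprS; apply: ler_piMr; rewrite ?exprn_ile1 // ltW.
have /andP[g1 g2] := @gaussint_near R (q * Y).
have GY : `|gaussint / q - (G Y - G (- Y))| <= 2 / q * expR (1 - q * Y).
  have -> : gaussint / q - (G Y - G (- Y)) = 2 / q * (gaussint / 2 - erf (q * Y)).
    by rewrite /G mulrN erfN; field; rewrite gt_eqF.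
  by rewrite normrM gtr0_norm // ler_pM2l // ger0_norm.
have BM : tau n * B <= e / 2 by rewrite -ler_pdivlMr.
have -> : gaussint / q - (F T - F (- T)) = (gaussint / q - (G Y - G (- Y)))
   - ((F Y - G Y) - (F (- Y) - G (- Y))) - (F T - F Y) - (F (- Y) - F (- T)) by ring.
apply: le_trans (ler_norm4 _ _ _ _) _.
have -> : e = e / 4 + e / 4 + e / 2 by field.
have E1 : tau n * B = M * Y - M * (- Y) + 6 * (24 * Num.sqrt N%:R / b2 ^+ 3 * tau n) + tau n.
  by rewrite /B /M; ring.
have E2 : 6 / p * expR (1 - p * Y) = 6 * (expR (1 - p * Y) / p) by ring.
lra.
Unshelve. all: end_near. Qed.

End LocalLimit.

(** * Logarithm of the partition product *)

Section PgenAsymptotics.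
Context {R : realType}.
Implicit Types (t x : R) (k n N : nat).

Lemma ln1B_bounds x : 0 <= x <= 2^-1 -> 0 <= - ln (1 - x) <= 2 * x.
Proof.
move=> /andP[x0 x2]; have y0 : 0 < 1 - x by lra.
apply/andP; split; first by rewrite oppr_ge0 ln_le0 //; lra.
rewrite -lnV ?posrE // (_ : (1 - x)^-1 = 1 + x / (1 - x)); last by field; rewrite gt_eqF.
apply: (@le_trans _ _ (x / (1 - x))).
  by apply: le_ln1Dx; apply: (@lt_le_trans _ _ 0) => //; rewrite divr_ge0 // ltW.
by rewrite ler_pdivrMr //; nra.
Qed.

Lemma ln_prod (I : eqType) (s : seq I) (F : I -> R) : (forall k : I, k \in s -> 0 < F k) ->
  ln (\prod_(k <- s) F k) = \sum_(k <- s) ln (F k).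
Proof.
elim: s => [|k s IHs] F0; first by rewrite !big_nil ln1.
have Fs j : j \in s -> 0 < F j by move=> js; rewrite F0 // inE js orbT.
rewrite !big_cons lnM ?IHs // posrE ?F0 ?inE ?eqxx // big_seq.
by elim/big_ind : _ => [|? ?|j /Fs //]; [exact: ltr01 | exact: mulr_gt0].
Qed.

Lemma expRN_lt1 t k : 0 < t -> (0 < k)%N -> 0 < 1 - expR (- t) ^+ k.
Proof. by move=> t0 k0; rewrite subr_gt0 exprn_ilt1 ?expR_ge0 -?lt0n // expR_lt1 oppr_lt0. Qed.

Lemma ln_evalz_pgen t n : 0 < t -> ln (evalz (expR (- t)) (pgen n)) =
  \sum_(1 <= k < n.+1) ln (1 - expR (- t) ^+ (k * n.+1)) -
  \sum_(1 <= k < n.+1) ln (1 - expR (- t) ^+ k).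
Proof.
move=> t0; apply/eqP; rewrite eq_sym subr_eq eq_sym; apply/eqP.
have g0 (F : nat -> nat) : (forall k, (0 < k)%N -> (0 < F k)%N) ->
    forall k, k \in index_iota 1 n.+1 -> 0 < 1 - expR (- t) ^+ F k.
  by move=> F0 k; rewrite mem_index_iota => /andP[k0 _]; apply: expRN_lt1 => //; exact: F0.
rewrite -!ln_prod; [|by apply: g0 => k k0; rewrite muln_gt0 k0|exact: g0].
rewrite -evalz_pgen lnM // posrE ?evalz_pgen_gt0 // big_seq.
elim/big_ind : _ => [|? ?|k]; [exact: ltr01 | exact: mulr_gt0 | exact: (g0 id)].
Qed.

(** - ln (1 - exp (- k t)) = lnbose (k t) - ln k - ln t; summing ln k produces n!, the entry point
    of Stirling's constant. *)
Lemma sum_ln1B_pgen t n : 0 < t ->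
  - (\sum_(1 <= k < n.+1) ln (1 - expR (- t) ^+ k)) =
  \sum_(1 <= k < n.+1) lnbose (k%:R * t) - ln n`!%:R - n%:R * ln t.
Proof.
move=> t0.
have -> : ln n`!%:R = \sum_(1 <= k < n.+1) ln k%:R :> R.
  rewrite fact_prod natr_prod ln_prod // => k; rewrite mem_index_iota => /andP[k0 _].
  by rewrite ltr0n.
have -> : n%:R * ln t = \sum_(1 <= k < n.+1) ln t.
  by rewrite sumr_const_nat subn1 mulr_natl.
rewrite -sumrN -!sumrB !big_nat; apply: eq_bigr => k /andP[k0 _].
have kR : 0 < k%:R :> R by rewrite ltr0n.
rewrite lnboseE ?mulr_gt0 // lnM ?posrE // -expRM_natl mulrN; ring.
Qed.

(** Once [sum_lnbose] is inserted and n! is written through [stirling_rem], all terms in n ln n, n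
    ln t and n t cancel. Replacing [Bose (n t)] by its limit costs 2 E / t; the truncation factors
    cost 2 n E^2 and ln (1 - exp (- n t)) costs 3 n E^2. *)
Lemma ln_evalz_pgen_near t n (E := expR (- (n%:R * t / 2))) : 0 < t -> (0 < n)%N -> E <= 2^-1 ->
  `|ln (evalz (expR (- t)) (pgen n)) - (boseint / t + 2^-1 * ln t - stirling_rem n)| <=
  t + 2 * E / t + 5 * n%:R * E ^+ 2.
Proof.
move=> t0 n0 E2; have E0 : 0 < E := expR_gt0 _.
have nR : 1 <= n%:R :> R by rewrite ler1n.
have n1 : 0 < n%:R :> R by lra.
have EE : expR (- (n%:R * t)) = E ^+ 2.
  by rewrite -expRM_natl; congr expR; field.
have EE2 : 0 <= E ^+ 2 <= 2^-1 by rewrite exprn_ge0 ?(ltW E0) //= expr2; nra.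
rewrite ln_evalz_pgen // -addrA sum_ln1B_pgen //.
set S1 := \sum_(_ <= k < _) ln (1 - _); set X := \sum_(_ <= k < _) _.
have S1b : - (2 * n%:R * E ^+ 2) <= S1 <= 0.
  have term k : (1 <= k < n.+1)%N -> - (2 * E ^+ 2) <= ln (1 - expR (- t) ^+ (k * n.+1)) <= 0.
    move=> /andP[k1 _].
    have rE : expR (- t) ^+ (k * n.+1) <= E ^+ 2.
      rewrite -EE -expRM_natl ler_expR mulrN lerN2 ler_pM2r // ler_nat.
      by rewrite (leq_trans (leqnSn n)) // leq_pmull.
    have r0 : 0 <= expR (- t) ^+ (k * n.+1) by rewrite exprn_ge0 ?expR_ge0.
    have /andP[e0 e2] := EE2.
    have /ln1B_bounds /andP[h1 h2] : 0 <= expR (- t) ^+ (k * n.+1) <= 2^-1.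
      by rewrite r0 (le_trans rE e2).
    by apply/andP; split; lra.
  apply/andP; split.
    have -> : - (2 * n%:R * E ^+ 2) = \sum_(1 <= k < n.+1) - (2 * E ^+ 2).
      by rewrite sumr_const_nat subn1 -mulr_natl /=; ring.
    by rewrite /S1 !big_nat; apply: ler_sum => k /term /andP[].
  by rewrite /S1 big_nat; apply: sumr_le0 => k /term /andP[].
have x0 : 0 < n%:R * t by rewrite mulr_gt0.
have := sum_lnbose t0 n0; rewrite -/X.
have -> : Lnbose (n%:R * t) = Bose (n%:R * t) + n%:R * t * lnbose (n%:R * t) - n%:R * t.
  by rewrite /Bose (gtr0_norm x0); ring.
have := boseint_near (ltW x0); rewrite -/E.
have /ln1B_bounds := EE2.
rewrite /stirling_rem lnboseE // lnM ?posrE // EE.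
move: (ln (1 - E ^+ 2)) (Bose _) (ln n%:R) => u b l /andP[u1 u2] /andP[b1 b2] H.
move: (ln n`!%:R) => f.
have H' : `|X - (l + ln t - u) / 2 - b / t - n%:R * (l + ln t - u) + n%:R| <= t.
  rewrite -(ler_pM2l t0) -{1}(gtr0_norm t0) -normrM -expr2.
  rewrite (_ : t * _ = t * X - t * (l + ln t - u) / 2 - (b + n%:R * t * (l + ln t - u) - n%:R * t)) //.
  by field; rewrite gt_eqF.
have b3 : 0 <= (boseint - b) / t <= 2 * E / t.
  by rewrite divr_ge0 ?(ltW t0) //= ler_pM2r ?invr_gt0.
have -> : S1 + (X - f - n%:R * ln t - (boseint / t + 2^-1 * ln t - (f - (n%:R + 2^-1) * l + n%:R))) =
  S1 + (X - (l + ln t - u) / 2 - b / t - n%:R * (l + ln t - u) + n%:R) - (boseint - b) / t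
   - (n%:R + 2^-1) * u by field; rewrite gt_eqF.
move: (X - _ / 2 - _ - _ + _) ((boseint - b) / t) (2 * E / t) H' b3 S1b => y z w.
rewrite ler_norml => /andP[y1 y2] /andP[z1 z2] /andP[s1 s2].
have v1 : 0 <= - ((n%:R + 2^-1) * u) by rewrite -mulrN mulr_ge0 //; lra.
have v2 : - ((n%:R + 2^-1) * u) <= 3 * n%:R * E ^+ 2.
  rewrite -mulrN; apply: (@le_trans _ _ ((n%:R + 2^-1) * (2 * E ^+ 2))).
    by rewrite ler_wpM2l //; lra.
  by rewrite mulrA; case/andP: EE2 => e0 _; apply: ler_wpM2r => //; lra.
rewrite ler_norml; apply/andP; split; lra.
Qed.

Lemma cvg_expn (f : nat -> R) (l : R) k :
  f @ \oo --> l -> (fun n => f n ^+ k) @ \oo --> l ^+ k.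
Proof.
move=> fl; elim: k => [|k IHk]; first by rewrite expr0; exact: cvg_cst.
rewrite exprS (_ : (fun n => _) = (fun n => f n * f n ^+ k)); first exact: cvgM.
by apply/funext => n; rewrite exprS.
Qed.

Lemma ln_sqrt x : 0 < x -> ln (Num.sqrt x) = 2^-1 * ln x.
Proof.
move=> x0; rewrite -[in RHS](sqr_sqrtr (ltW x0)) lnXn ?sqrtr_gt0 //.
by rewrite -[X in _ = _ * X]mulr_natl; field.
Qed.

End PgenAsymptotics.

(** * Asymptotics of the coefficients *)

Section CoefAsymptotics.
Context {R : realType}.
Variables (N delta : nat).
Hypothesis N0 : (0 < N)%N.
Local Notation t := (tsad N delta : nat -> R).

Let NR : 0 < N%:R :> R. Proof. by rewrite ltr0n. Qed.

(** The classical E(r) ~ sqrt (t / (2 pi)) exp (c / t), where sqrt 2 [gaussint] plays the role of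
    sqrt (2 pi) thanks to [stirling_gauss]. *)
Lemma pgen_asymp :
  (fun n => evalz (expR (- t n)) (pgen n) * expR (- (boseint / t n)) / Num.sqrt (t n)) @ \oo -->
  (Num.sqrt 2 * gaussint : R)^-1.
Proof.
have g0 := @gaussint_gt0 R; have s2 : 0 < Num.sqrt 2 :> R by rewrite sqrtr_gt0.
pose K1 : R := 384 / (N%:R * boseint) ^+ 3.
have Nc : 0 < N%:R * boseint :> R by apply: mulr_gt0 => //; exact: boseint_gt0.
have K10 : 0 < K1 by apply: divr_gt0; [rewrite ltr0n | exact: exprn_gt0].
pose u n := ln (evalz (expR (- t n)) (pgen n)) - (boseint / t n + 2^-1 * ln (t n)) + stirling_rem n.
have u0 : u @ \oo --> (0 : R).
  pose K := 1 + 2 * K1 + 5 * (N%:R * boseint * K1 ^+ 2).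
  have K0 : 0 < K.
    apply: addr_gt0; first by apply: addr_gt0 => //; exact: mulr_gt0.
    by apply: mulr_gt0 => //; apply: mulr_gt0 => //; exact: exprn_gt0.
  apply/cvgr0Pnorm_le => e e0; near=> n.
  have n0 : (0 < n)%N by near: n; exact: nbhs_infty_gt.
  have dn : (delta <= n)%N by near: n; exact: nbhs_infty_ge.
  have t0 : 0 < t n := tsad_gt0 delta N0 n.
  have t1 : t n <= 1 by near: n; apply: (cvgr_le _ (cvg_tsad N delta)).
  have tK : t n <= (2 * K1)^-1.
    by near: n; apply: (cvgr_le _ (cvg_tsad N delta)); rewrite invr_gt0 mulr_gt0.
  have te : t n <= e / K.
    by near: n; apply: (cvgr_le _ (cvg_tsad N delta)); rewrite divr_gt0.
  have := @expR_tsad_le R N delta N0 n n0 dn; rewrite -/K1.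
  have := @ln_evalz_pgen_near R (t n) n t0 n0.
  set E := expR _ => H EK; have E0 : 0 < E := expR_gt0 _.
  have EK1 : E <= K1 * t n.
    apply: le_trans EK _; rewrite ler_pM2l // exprS; apply: ler_piMr; first exact: ltW.
    by rewrite exprn_ile1 // ltW.
  have EK2 : E / t n <= K1 * t n.
    rewrite ler_pdivrMr // -mulrA; apply: le_trans EK _; rewrite ler_pM2l // exprS.
    rewrite ler_pM2l // expr2; apply: ler_piMr => //; exact: ltW.
  have E2 : E <= 2^-1.
    apply: le_trans EK1 _; rewrite mulrC -ler_pdivlMr //; apply: le_trans tK _.
    by rewrite invfM.
  have nt : n%:R * t n ^+ 2 <= N%:R * boseint.
    rewrite -(tsad_sqr N delta n0) mulrC; apply: ler_wpM2l; first exact: sqr_ge0.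
    by rewrite lerDl ler0n.
  have nE : n%:R * E ^+ 2 <= N%:R * boseint * K1 ^+ 2 * t n.
    apply: (@le_trans _ _ (n%:R * (K1 * t n ^+ 3) ^+ 2)).
      apply: ler_wpM2l; first exact: ler0n.
      by apply: lerXn2r => //; rewrite nnegrE ltW // mulr_gt0 // exprn_gt0.
    have -> : n%:R * (K1 * t n ^+ 3) ^+ 2 = n%:R * t n ^+ 2 * (K1 ^+ 2 * t n ^+ 4) by ring.
    have -> : N%:R * boseint * K1 ^+ 2 * t n = N%:R * boseint * (K1 ^+ 2 * t n) by ring.
    apply: ler_pM => //.
    - by apply: mulr_ge0; [exact: ler0n | exact: sqr_ge0].
    - by apply: mulr_ge0; apply: exprn_ge0; exact: ltW.
    - apply: ler_wpM2l; first exact: sqr_ge0.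
      by rewrite exprS; apply: ler_piMr; [exact: ltW | rewrite exprn_ile1 // ltW].
  have -> : u n = ln (evalz (expR (- t n)) (pgen n)) - (boseint / t n + 2^-1 * ln (t n) - stirling_rem n).
    by rewrite /u; ring.
  apply: le_trans (H E2) _.
  apply: (@le_trans _ _ (K * t n)); last by rewrite mulrC -ler_pdivlMr.
  rewrite /K; lra.
have E n : evalz (expR (- t n)) (pgen n) * expR (- (boseint / t n)) / Num.sqrt (t n) =
    expR (u n - stirling_rem n).
  have t0 : 0 < t n := tsad_gt0 delta N0 n.
  rewrite /u addrK -ln_sqrt // opprD addrA !expRD [expR (- ln _)]expRN.
  have V0 := evalz_pgen_gt0 (t n) n; have q0 : 0 < Num.sqrt (t n) by rewrite sqrtr_gt0.
  by rewrite (lnK V0) (lnK q0).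
have -> : (Num.sqrt 2 * gaussint)^-1 = expR (0 - stirling) :> R.
  rewrite sub0r expRN stirling_gauss expRD lnK ?posrE // -ln_sqrt //.
  by rewrite lnK // posrE.
rewrite (funext E); apply: continuous_cvg; first exact: continuous_expR.
by apply: cvgB => //; exact: cvg_stirling.
Unshelve. all: end_near. Qed.

(** The coefficient is its weight times the total mass times exp (n t). The powers of t add up: 3/2
    from the weight, N/2 from the partition products and - (N - 1)/2 from the theta sum make t^2.
    All but one power of sqrt 2 [gaussint] cancel between products and theta sum, and the numerator
    of [local_limit] removes the last [gaussint]. *)
Lemma coef_asymp :
  (fun n => N%:R * ((Apoly N n (2 * n))`_n)%:~R *
     expR (- (n%:R * t n + N%:R * boseint / t n)) / t n ^+ 2) @ \oo -->
  (2 * pi * Num.sqrt 2 * Num.sqrt boseint : R)^-1.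
Proof.
have g0 := @gaussint_gt0 R; have s2 : 0 < Num.sqrt 2 :> R by rewrite sqrtr_gt0.
have sc : 0 < Num.sqrt boseint :> R by rewrite sqrtr_gt0 boseint_gt0.
have sN : 0 < Num.sqrt N%:R :> R by rewrite sqrtr_gt0.
have p0 := @pi_gt0 R.
have lA := local_limit (R := R) delta N0.
have lB : (fun n => (evalz (expR (- t n)) (pgen n) * expR (- (boseint / t n)) /
     Num.sqrt (t n)) ^+ N) @ \oo --> (Num.sqrt 2 * gaussint : R)^-1 ^+ N.
  exact: cvg_expn pgen_asymp.
have lC := thsum_cvg (m := N.-1) (tsad_gt0 delta N0) (cvg_tsad (R := R) N delta)
  (cvg_sqrt_tsad (R := R) delta N0) (ltn0Sn 0).
have -> : (2 * pi * Num.sqrt 2 * Num.sqrt boseint : R)^-1 =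
  gaussint / Num.sqrt boseint * ((Num.sqrt 2 * gaussint)^-1 ^+ N *
    ((Num.sqrt 2 * gaussint) ^+ N.-1 * Num.sqrt (1%:R / (1 + N.-1)%:R))) *
   (Num.sqrt N%:R / (2 * pi)).
  rewrite sqrt_divM ?ler0n // sqrtr1 add1n (prednK N0).
  have -> : (Num.sqrt 2 * gaussint)^-1 ^+ N =
      (Num.sqrt 2 * gaussint : R)^-1 * (Num.sqrt 2 * gaussint)^-1 ^+ N.-1.
    by rewrite -exprS prednK.
  have x0 : (Num.sqrt 2 * gaussint : R) ^+ N.-1 != 0 by rewrite expf_neq0 // gt_eqF // mulr_gt0.
  rewrite exprVn; move: (_ ^+ N.-1) x0 => x x0.
  move: (Num.sqrt 2) (Num.sqrt boseint) (Num.sqrt N%:R) gaussint pi s2 sc sN g0 p0 {lA lB lC}.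
  move=> a b d g p a0 b0 d0 g0 p0.
  by field; rewrite x0 !gt_eqF.
have -> : (fun n => N%:R * ((Apoly N n (2 * n))`_n)%:~R *
     expR (- (n%:R * t n + N%:R * boseint / t n)) / t n ^+ 2) = (fun n =>
  2 * pi / (Num.sqrt (t n) ^+ 3 / Num.sqrt N%:R) * weight (t n) N n (2 * n) n *
  ((evalz (expR (- t n)) (pgen n) * expR (- (boseint / t n)) / Num.sqrt (t n)) ^+ N *
   (Num.sqrt (t n) ^+ N.-1 * thsum (t n) 1%:R^-1 (2 * n) N.-1)) * (Num.sqrt N%:R / (2 * pi))).
  apply/funext => n; have t0 : 0 < t n := tsad_gt0 delta N0 n.
  have EA : evalz (expR (- t n)) (Apoly N n (2 * n)) =
      thsum (t n) 1 (2 * n) N.-1 * evalz (expR (- t n)) (pgen n) ^+ N.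
    by rewrite /Apoly evalzM evalzX evalz_theta.
  have -> : expR (- (n%:R * t n + N%:R * boseint / t n)) =
      expR (- t n) ^+ n * expR (- (boseint / t n)) ^+ N.
    by rewrite -!expRM_natl -expRD; congr expR; ring.
  have V0 := evalz_pgen_gt0 (t n) n; have T0 := thsum_gt0 (t n) 1 (2 * n) N.-1.
  have q0 : 0 < Num.sqrt (t n) by rewrite sqrtr_gt0.
  have VN : evalz (expR (- t n)) (pgen n) ^+ N != 0 by rewrite expf_neq0 ?gt_eqF.
  have qN : Num.sqrt (t n) ^+ N.-1 != 0 by rewrite expf_neq0 ?gt_eqF.
  have tq : t n = Num.sqrt (t n) ^+ 2 by rewrite sqr_sqrtr // ltW.
  have Ns : N%:R = Num.sqrt N%:R ^+ 2 :> R by rewrite sqr_sqrtr ?ler0n.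
  have qS : Num.sqrt (t n) ^+ N = Num.sqrt (t n) * Num.sqrt (t n) ^+ N.-1.
    by rewrite -exprS prednK.
  rewrite /weight EA invr1 !exprMn exprVn qS [in t n ^+ 2]tq [in N%:R * _]Ns.
  move: (evalz _ _ ^+ N) VN (expR _ ^+ N) (expR _ ^+ n) (_ ^+ N.-1) qN => v v0 e f w w0.
  move: (Num.sqrt N%:R) (Num.sqrt (t n)) (thsum _ _ _ _) pi sN q0 T0 p0 {lA lB lC tq Ns qS EA}.
  move=> s q th p s0 q0 th0 p0.
  by field; rewrite v0 w0 !gt_eqF.
exact: cvgM (cvgM lA (cvgM lB lC)) (cvg_cst _).
Qed.

End CoefAsymptotics.

(** * Partition numbers far below the saddle *)

Section PartitionNumber.
Context {R : realType}.
Implicit Types (m n k : nat) (t e : R).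

Lemma pgen_coef_ge0 n k : 0 <= (pgen n)`_k.
Proof.
rewrite /pgen; elim/big_ind : _ k => [k|p q Hp Hq k|j _ k].
- by rewrite coef1; case: eqP.
- by rewrite coefM; apply: sumr_ge0 => i0 _; exact: mulr_ge0.
- by rewrite coef_sum; apply: sumr_ge0 => i0 _; rewrite coefXn; case: eqP.
Qed.

(** With no theta variable left, the results for general N become statements about p(n). *)
Lemma Apoly1 n L : Apoly 1 n L = pgen n.
Proof.
have E : thetas [::] = 0%N by rewrite /thetas /sumsq /sumz !big_nil.
by rewrite /Apoly expr1 /theta_poly /= big_seq1 E expr0 mul1r.
Qed.

Lemma evalz_pgen_prod t n : evalz (expR (- t)) (pgen n) =
  \prod_(1 <= k < n.+1) \sum_(j < n.+1) expR (- t) ^+ (k * j).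
Proof.
rewrite /pgen evalz_prod; apply: eq_bigr => k _; rewrite evalz_sum.
by apply: eq_bigr => j _; rewrite evalzXn.
Qed.

Lemma le_evalz_pgen t m n : (m <= n)%N ->
  evalz (expR (- t)) (pgen m) <= evalz (expR (- t)) (pgen n).
Proof.
move=> mn; rewrite !evalz_pgen_prod (@big_cat_nat _ _ _ m.+1 1 n.+1) //=.
have r0 j : 0 <= expR (- t) ^+ j by rewrite exprn_ge0 ?expR_ge0.
have ge1 k : 1 <= \sum_(j < n.+1) expR (- t) ^+ (k * j).
  by rewrite big_ord_recl /= muln0 expr0 lerDl sumr_ge0.
rewrite -[leLHS]mulr1; apply: ler_pM.
- by apply: prodr_ge0 => k _; apply: sumr_ge0.
- by [].
- apply: ler_prod => k _; rewrite sumr_ge0 //=.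
  rewrite -!(big_mkord xpredT (fun j => expR (- t) ^+ (k * j))).
  by rewrite (@big_cat_nat _ _ _ m.+1 0 n.+1) //= lerDl sumr_ge0.
- by elim/big_ind : _ => // x y x1 y1; rewrite -[leLHS]mulr1 ler_pM.
Qed.

Lemma partition_number_le t m n : (m <= n)%N ->
  (partition_number m)%:R * expR (- t) ^+ m <= evalz (expR (- t)) (pgen n).
Proof.
move=> mn; apply: le_trans (le_evalz_pgen t mn).
pose d := maxn (size (pgen m)) m.+1.
rewrite (@evalz_coef _ _ _ d) ?leq_maxl //.
have md : (m < d)%N by rewrite leq_max leqnn orbT.
rewrite (bigD1 (Ordinal md)) //= -partition_number_coef lerDl.
apply: sumr_ge0 => j _; apply: mulr_ge0; last by rewrite exprn_ge0 ?expR_ge0.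
by rewrite ler0z pgen_coef_ge0.
Qed.

(* At the saddle point of [m], the weight of [k] is at most the whole mass, whereas the local limit
   theorem makes the weight of [m] at least of the order of [t ^ (3 / 2)]; the tilting factor
   [exp (- t (m - k))] then decides. *)
Lemma partition_number_small (delta : nat) e : 0 < e ->
  \forall m \near \oo, forall k, (4 * k <= m + delta)%N ->
    (partition_number k)%:R <= e * (partition_number m)%:R.
Proof.
move=> e0; pose t : nat -> R := tsad 1 delta; pose l : R := gaussint / Num.sqrt boseint.
have c0 := @boseint_gt0 R.
have l0 : 0 < l by rewrite divr_gt0 ?gaussint_gt0 // sqrtr_gt0.
(* 6144 = 16 * 384: the 16 comes from the lower bound on the weight of m with pi <= 4, and 384 = 6 *
   4^3 from [expRN_le3] at boseint / (4 t). *)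
have C0 : 0 < 6144 / (boseint ^+ 3 * l).
  by apply: divr_gt0; [rewrite ltr0n | apply: mulr_gt0 => //; exact: exprn_gt0].
have lim := local_limit (R := R) delta (ltn0Sn 0).
have te0 : \forall m \near \oo, t m <= e / (6144 / (boseint ^+ 3 * l)).
  by apply: (cvgr_le _ (cvg_tsad 1 delta)); exact: divr_gt0.
have lw0 : \forall m \near \oo, l / 2 <=
    2 * pi / (Num.sqrt (t m) ^+ 3 / Num.sqrt 1%:R) * weight (t m) 1 m (2 * m) m.
  by apply: (cvgr_ge _ lim); rewrite -/l ltr_pdivrMr // ltr_pMr // ltr1n.
near=> m => k k4.
have m0 : (0 < m)%N by near: m; exact: nbhs_infty_gt.
have dm : (delta <= m)%N by near: m; exact: nbhs_infty_ge.
have km : (k <= m)%N by clear -k4 dm; lia.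
(* Hence t (m - k) >= t (m + delta) / 4 = boseint / (4 t). *)
have mk4 : (m + delta <= 4 * (m - k))%N by clear -k4 dm; lia.
have t0 : 0 < t m := tsad_gt0 delta (ltn0Sn 0) m.
have q0 : 0 < Num.sqrt (t m) by rewrite sqrtr_gt0.
have q2 : Num.sqrt (t m) ^+ 2 = t m by rewrite sqr_sqrtr // ltW.
have t1 : t m <= 1 by near: m; apply: (cvgr_le _ (cvg_tsad 1 delta)).
have te : t m <= e / (6144 / (boseint ^+ 3 * l)).
  by near: m; exact: te0.
have : l / 2 <= 2 * pi / (Num.sqrt (t m) ^+ 3 / Num.sqrt 1%:R) * weight (t m) 1 m (2 * m) m.
  by near: m; exact: lw0.
have V0 := evalz_pgen_gt0 (t m) m.
rewrite sqrtr1 divr1 /weight Apoly1 -partition_number_coef.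
have := partition_number_le (t m) km.
set V := evalz _ _ in V0 *; set r := expR (- t m); set q := Num.sqrt (t m) in q0 q2 *.
have r0 : 0 < r := expR_gt0 _.
rewrite -!(@pmulrn R); set P := (partition_number m)%:R => kV lw.
have P0 : 0 <= P by exact: ler0n.
have pi4 := @pi_le4 R.
have Vle : V <= 16 / (l * q ^+ 3) * (P * r ^+ m).
  have x0 : 0 <= P * r ^+ m by rewrite mulr_ge0 // exprn_ge0 // ltW.
  have q30 : 0 < q ^+ 3 by exact: exprn_gt0.
  move: lw; have -> : 2 * pi / q ^+ 3 * (P * r ^+ m / V) = 2 * (pi * (P * r ^+ m)) / (q ^+ 3 * V).
    by field; rewrite !gt_eqF.
  rewrite ler_pdivlMr ?mulr_gt0 // => lw.
  rewrite mulrAC ler_pdivlMr ?(mulr_gt0 l0 q30) //.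
  rewrite (_ : V * (l * q ^+ 3) = 2 * (l / 2 * (q ^+ 3 * V))); last by field.
  apply: le_trans (ler_wpM2l (ler0n R 2) lw) _.
  rewrite (_ : 16 * (P * r ^+ m) = 2 * (2 * (4 * (P * r ^+ m)))); last by ring.
  by rewrite !ler_pM2l //; exact: ler_wpM2r.
have rle : r ^+ (m - k) <= 384 * t m ^+ 3 / boseint ^+ 3.
  have x0 : 0 < boseint / (4 * t m) by rewrite divr_gt0 // mulr_gt0.
  have -> : 384 * t m ^+ 3 / boseint ^+ 3 = 6 / (boseint / (4 * t m)) ^+ 3.
    by field; rewrite !gt_eqF.
  apply: le_trans (expRN_le3 x0); rewrite /r -expRM_natl ler_expR mulrN lerN2.
  rewrite ler_pdivrMr ?mulr_gt0 //.
  have := @tsad_sqr R 1 delta m m0; rewrite mul1r => <-.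
  rewrite (_ : _ * (4 * t m) = t m ^+ 2 * (4 * (m - k)%:R)); last by ring.
  apply: ler_wpM2l; first exact: sqr_ge0.
  by rewrite -natrD -natrM ler_nat.
have kP : (partition_number k)%:R <= 16 / (l * q ^+ 3) * P * r ^+ (m - k).
  rewrite -(ler_pM2r (exprn_gt0 k r0)); apply: le_trans kV (le_trans Vle _).
  by rewrite -[leRHS]mulrA -exprD subnK // mulrA.
apply: (le_trans kP).
apply: (@le_trans _ _ (16 / (l * q ^+ 3) * P * (384 * t m ^+ 3 / boseint ^+ 3))).
  apply: ler_wpM2l => //; apply: mulr_ge0 => //; apply: divr_ge0 => //.
  by apply: mulr_ge0; [exact: ltW | apply: exprn_ge0; exact: ltW].
have -> : 16 / (l * q ^+ 3) * P * (384 * t m ^+ 3 / boseint ^+ 3) =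
    6144 / (boseint ^+ 3 * l) * q ^+ 3 * P.
  by rewrite -q2; field; rewrite !gt_eqF.
apply: ler_wpM2r => //; rewrite mulrC -ler_pdivlMr //; apply: le_trans te.
rewrite exprSr q2; apply: ler_piMr; first exact: ltW.
by rewrite -[leRHS]sqrtr1 ler_sqrt.
Unshelve. all: end_near. Qed.

End PartitionNumber.

(** * Comparison of the two coefficient asymptotics *)

Section FrobeniusAsymptotics.
Context {R : realType}.
Variables (N delta : nat).
Hypothesis N0 : (0 < N)%N.
Let NR : 0 < N%:R :> R. Proof. by rewrite ltr0n. Qed.

Lemma cvg_mulnB : (fun n => (N * n - delta)%N) @ \oo --> \oo.
Proof.
apply/cvgnyPge => A; near=> n.
have : (A + delta <= n)%N by near: n; exact: nbhs_infty_ge.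
by have := leq_pmull n N0; lia.
Unshelve. all: end_near. Qed.

(** The squares are c / (N n) and N c / n: the shift in the saddle point for N = 1 restores exactly
    N n. *)
Lemma tsad_mulnB n : (0 < n)%N -> (delta < N * n)%N ->
  tsad 1 delta (N * n - delta) = tsad N 0 n / N%:R :> R.
Proof.
move=> n0 dn; have t0 := @tsad_gt0 R 1 delta (ltn0Sn 0) (N * n - delta).
have s0 := @tsad_gt0 R N 0 N0 n.
have m0 : (0 < N * n - delta)%N by lia.
have := @tsad_sqr R 1 delta _ m0; rewrite -natrD subnK ?(ltnW dn) // mul1r natrM => E2.
have := @tsad_sqr R N 0 n n0; rewrite addr0 => E1.
have nR : 0 < n%:R :> R by rewrite ltr0n.
apply/eqP; rewrite -(@eqrXn2 _ 2) ?ltW ?divr_gt0 //; apply/eqP.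
apply: (@mulIf _ (N%:R * (N%:R * n%:R))); first by rewrite !mulf_neq0 // gt_eqF.
have -> : (tsad N 0 n / N%:R) ^+ 2 * (N%:R * (N%:R * n%:R)) = tsad N 0 n ^+ 2 * n%:R :> R.
  by field; rewrite gt_eqF.
by rewrite E1 -E2; ring.
Qed.

Lemma cphi_coef_Apoly n : cphi N n = (Apoly N n (2 * n))`_n.
Proof. by apply: cphi_coef => k kn; apply: theta_poly_coef; rewrite leq_mul2l. Qed.

Lemma partition_number_neq0 :
  \forall n \near \oo, (partition_number n)%:R != 0 :> R.
Proof.
have l0 : 0 < (2 * pi * Num.sqrt 2 * Num.sqrt boseint)^-1 :> R.
  by rewrite invr_gt0 !mulr_gt0 ?pi_gt0 ?sqrtr_gt0 ?boseint_gt0.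
apply: (filterS _ (cvgr_neq0 _ (coef_asymp (R := R) 0 (ltn0Sn 0)) (lt0r_neq0 l0))) => n.
apply: contraNN => /eqP p0.
by rewrite Apoly1 -partition_number_coef -(@pmulrn R) p0 mulr0 !mul0r.
Qed.

(** Dividing the two asymptotics, the prefactors N / t^2 and (N / t)^2 leave 1 / N. The exponents
    differ by delta t / N, which is why the third factor tending to 1 is multiplied in. *)
Lemma cphi_asymp :
  (fun n => (cphi N n)%:~R / (N%:R * (partition_number (N * n - delta))%:R)) @ \oo --> (1 : R).
Proof.
pose K : R := (2 * pi * Num.sqrt 2 * Num.sqrt boseint)^-1.
have K0 : 0 < K by rewrite invr_gt0 !mulr_gt0 ?pi_gt0 ?sqrtr_gt0 ?boseint_gt0.
have lA := coef_asymp (R := R) 0 N0; rewrite -/K in lA.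
have lB := coef_asymp (R := R) delta (ltn0Sn 0); rewrite -/K in lB.
have {}lB := cvg_comp _ _ cvg_mulnB lB.
have lC : (fun n => expR (delta%:R / N%:R * tsad N 0 n)) @ \oo --> (1 : R).
  rewrite -[X in _ --> X]expR0; apply: continuous_cvg; first exact: continuous_expR.
  rewrite -[X in _ --> X](mulr0 (delta%:R / N%:R)).
  by apply: cvgM; [exact: cvg_cst | exact: cvg_tsad].
have pn0 : \forall n \near \oo, (partition_number (N * n - delta))%:R != 0 :> R.
  exact: (cvg_mulnB partition_number_neq0).
have E : 1 = K / K * 1 :> R by rewrite mulr1 divff ?gt_eqF.
rewrite [X in _ --> X]E; apply: cvg_trans (cvgM (cvgM lA (cvgV (lt0r_neq0 K0) lB)) lC).
apply: near_eq_cvg; near=> n.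
have n0 : (0 < n)%N by near: n; exact: nbhs_infty_gt.
have dn : (delta < N * n)%N.
  have : (delta < n)%N by near: n; exact: nbhs_infty_gt.
  by have := leq_pmull n N0; lia.
have t0 := @tsad_gt0 R N 0 N0 n.
rewrite /= (tsad_mulnB n0 dn) Apoly1 -cphi_coef_Apoly -partition_number_coef -(@pmulrn R).
have p0 : (partition_number (N * n - delta))%:R != 0 :> R.
  by near: n; exact: pn0.
rewrite natrB ?(ltnW dn) // natrM.
set p := (partition_number _)%:R in p0 *; set t := tsad _ _ _ in t0 *.
have -> : - ((N%:R * n%:R - delta%:R) * (t / N%:R) + 1%:R * boseint / (t / N%:R)) =
  - (n%:R * t + N%:R * boseint / t) + delta%:R / N%:R * t :> R.
  by field; rewrite !gt_eqF.
rewrite expRD; have := expR_gt0 (delta%:R / N%:R * t).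
have := expR_gt0 (- (n%:R * t + N%:R * boseint / t)).
move: (expR _) (expR _) => x y x0 y0.
by field; rewrite p0 !gt_eqF.
Unshelve. all: end_near. Qed.

End FrobeniusAsymptotics.

(** * The terms of the divisor sum *)

Section DivisorSum.

Lemma dvdn24_sqrB1 N : gcdn N 6 = 1%N -> (24 %| N ^ 2 - 1)%N.
Proof.
move=> N6.
have N2 : ~~ (2 %| N)%N by apply/negP => d; have := dvdn_gcd 2 N 6; rewrite N6 d.
have N3 : ~~ (3 %| N)%N by apply/negP => d; have := dvdn_gcd 3 N 6; rewrite N6 d.
(* Adding 23 instead of subtracting 1 avoids truncated subtraction; a check of the residues modulo
   24 then suffices. *)
have : (24 %| N ^ 2 + 23)%N; last by lia.
rewrite /dvdn -modnDml -modnXm.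
have : ((N %% 24) %% 2 != 0)%N by rewrite modn_dvdm.
have : ((N %% 24) %% 3 != 0)%N by rewrite modn_dvdm.
have : (N %% 24 < 24)%N by rewrite ltn_mod.
by move: (N %% 24)%N; do 24?[case=> //].
Qed.

Lemma P_natr (k : nat) : P k%:R = partition_number k.
Proof. by rewrite /P natr_nat natrK. Qed.

Lemma P_divisor1 N delta n : (N ^ 2 = 24 * delta + 1)%N -> (delta <= N * n)%N ->
  P (N%:R / 1%:R ^+ 2 * n%:R - (N%:R ^+ 2 - 1%:R ^+ 2) / (24%:R * 1%:R ^+ 2)) =
  partition_number (N * n - delta).
Proof.
move=> N2 dn; rewrite -P_natr natrB // natrM; congr P.
have -> : N%:R ^+ 2 = 24%:R * delta%:R + 1 :> rat by rewrite -natrX N2 natrD natrM.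
by field.
Qed.

(** For d <= N the subtracted term is nonnegative, so the argument is at most N n / d^2 <= N n / 4.
    Non-integral arguments fall under the convention P = 0. *)
Lemma P_divisor N d n : (1 < d)%N -> (d <= N)%N ->
  let x : rat := N%:R / d%:R ^+ 2 * n%:R - (N%:R ^+ 2 - d%:R ^+ 2) / (24%:R * d%:R ^+ 2) in
  P x = 0%N \/ exists2 k, P x = partition_number k & (4 * k <= N * n)%N.
Proof.
move=> d1 dN x; have [/natrP[k xk]|xN] := boolP (x \is a Num.nat); last first.
  by left; rewrite /P (negbTE xN).
right; exists k; first by rewrite xk P_natr.
have dR : 0 < d%:R :> rat by rewrite ltr0n (ltn_trans _ d1).
have : k%:R * d%:R ^+ 2 <= N%:R * n%:R :> rat.
  have -> : k%:R * d%:R ^+ 2 = N%:R * n%:R - (N%:R ^+ 2 - d%:R ^+ 2) / 24%:R :> rat.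
    by rewrite -xk /x; field; rewrite gt_eqF.
  rewrite gerBl divr_ge0 // subr_ge0 lerXn2r ?nnegrE ?ler0n // ler_nat //.
rewrite -natrX -!natrM ler_nat => kd; apply: leq_trans kd.
by rewrite [leqRHS]mulnC leq_mul // -[4%N]/(2 ^ 2)%N leq_exp2r.
Qed.

Lemma cvg_sum_seq (R : realType) (I : eqType) (s : seq I) (f : I -> nat -> R) (l : I -> R) :
  (forall j : I, j \in s -> f j @ \oo --> l j) ->
  (fun n => \sum_(j <- s) f j n) @ \oo --> \sum_(j <- s) l j.
Proof.
elim: s => [|j s IHs] fl.
  by under eq_fun do rewrite big_nil; rewrite big_nil; exact: cvg_cst.
rewrite big_cons (_ : (fun n => _) = (fun n => f j n + \sum_(i0 <- s) f i0 n)).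
  apply: cvgD; first by apply: fl; rewrite inE eqxx.
  by apply: IHs => i0 i0s; apply: fl; rewrite inE i0s orbT.
by apply/funext => n; rewrite big_cons.
Qed.

End DivisorSum.

Unset Implicit Arguments.

Theorem theorem1p4 (R : realType) (N : nat)
    (hN : (0 < N)%N) (hsq : squarefree N) (hN6 : gcdn N 6 = 1%N) :
  (fun n : nat =>
     (cphi N n)%:~R /
     (\sum_(d <- divisors N)
        (N%:R / d%:R) *
        (P (N%:R / d%:R ^+ 2 * n%:R
            - (N%:R ^+ 2 - d%:R ^+ 2) / (24%:R * d%:R ^+ 2)))%:R) : R)
    @ \oo --> (1 : R).
Proof.
have [delta N2] : exists delta, (N ^ 2 = 24 * delta + 1)%N.
  exists ((N ^ 2 - 1) %/ 24)%N; rewrite mulnC divnK ?dvdn24_sqrB1 //.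
  by rewrite subnK // expn_gt0 hN.
have NR : 0 < N%:R :> R by rewrite ltr0n.
pose x (d n : nat) : rat := N%:R / d%:R ^+ 2 * n%:R - (N%:R ^+ 2 - d%:R ^+ 2) / (24%:R * d%:R ^+ 2).
pose p n : R := (partition_number (N * n - delta))%:R.
have p0 : \forall n \near \oo, p n != 0.
  exact: (cvg_mulnB delta hN (partition_number_neq0 (R := R))).
(* Every summand is measured against the one of d = 1, so that the limits are 1 and 0. *)
have term d : d \in divisors N ->
    (fun n => N%:R / d%:R * (P (x d n))%:R / (N%:R * p n)) @ \oo --> ((d == 1%N)%:R : R).
  rewrite -dvdn_divisors // => dN; have d0 := dvdn_gt0 hN dN.
  have [->|d1] := eqVneq d 1%N.
    apply: cvg_near_cst; near=> n.
    have pn : p n != 0 by near: n.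
    have dn : (delta <= N * n)%N.
      have : (delta <= n)%N by near: n; exact: nbhs_infty_ge.
      by have := leq_pmull n hN; lia.
    by rewrite /x (P_divisor1 N2 dn) -/(p n) divr1 divff // mulf_neq0 // gt_eqF.
  have {}d1 : (1 < d)%N by lia.
  apply/cvgr0Pnorm_le => e e0; near=> n.
  have pn : p n != 0 by near: n.
  have pn0 : 0 < p n by rewrite lt0r pn ler0n.
  (* The comparison point is N n - delta while [P_divisor] bounds 4 k by N n; the extra [delta]
     allowed in [partition_number_small] bridges the two. *)
  have small : forall k, (4 * k <= N * n - delta + delta)%N -> (partition_number k)%:R <= e * p n.
    by near: n; exact: (cvg_mulnB delta hN (partition_number_small delta e0)).
  have dR : 1 <= d%:R :> R by rewrite ler1n.
  have dR0 : 0 < d%:R :> R by rewrite ltr0n.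
  rewrite (_ : _ / _ = (P (x d n))%:R / (d%:R * p n)); last by field; rewrite pn !gt_eqF.
  rewrite ger0_norm ?divr_ge0 ?mulr_ge0 ?ler0n // ler_pdivrMr ?mulr_gt0 //.
  have eP : 0 <= e * p n by rewrite mulr_ge0 // ltW.
  have [->|[k -> k4]] := P_divisor n d1 (dvdn_leq hN dN).
    by rewrite mulrCA mulr_ge0 // ltW.
  apply: (@le_trans _ _ (e * p n)); first by apply: small; lia.
  by rewrite mulrCA ler_peMl.
have lS := cvg_sum_seq term.
have S1 : \sum_(d <- divisors N) (d == 1%N)%:R = 1 :> R.
  rewrite (bigD1_seq 1%N) ?divisors_uniq -?dvdn_divisors //=.
  by rewrite big1 ?addr0 // => d /negbTE ->.
rewrite S1 in lS.
have E : 1 = 1 / 1 :> R by rewrite divr1.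
rewrite [X in _ --> X]E.
apply: cvg_trans (cvgM (cphi_asymp (R := R) delta hN) (cvgV (oner_neq0 _) lS)).
apply: near_eq_cvg; near=> n.
have pn : p n != 0 by near: n.
by rewrite /= -mulr_suml invf_div mulrA divfK // mulf_neq0 // gt_eqF.
Unshelve. all: end_near. Qed.
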